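(* Let $F:\mathbb{C}\to\mathbb{C}$ be an entire function, $F\not\equiv 0$, and let $a\in\mathbb{C}$ be a center of $\dot x=F(x)$ with its corresponding center basin $\mathcal{V}$. Then $\partial\mathcal{V}$ consists of at most countably many double-sided separatrices, i.e. there exist an index set $\mathcal{Q}\subset\mathbb{N}$ and double-sided separatrices $C_n\subset\partial\mathcal{V}$, $n\in\mathcal{Q}$, such that $$\partial\mathcal{V}=\bigcup_{n\in\mathcal{Q}}C_n.$$ Furthermore, the sum of the transit times of these separatrices is absolutely convergent and bounded by the period of $a$, i.e. $$\sum_{n\in\mathcal{Q}}\tau(C_n)\le T(a)=\frac{2\pi\mathrm{i}}{F'(a)}.$$
   Context: Setting: for an entire function $F$, consider the planar ODE $\dot x=F(x)$, $x\in\mathbb{C}$, with real time $t$. For $x_0\in\mathbb{C}$ let $I(x_0)\subset\mathbb{R}$ be the maximal interval of existence of the solution $\Phi(\cdot,x_0)$ with $\Phi(0,x_0)=x_0$; the orbit through $x_0$ is $\Gamma(x_0)=\Phi(I(x_0),x_0)$. Equilibria are the zeros of $F$. For a closed Jordan curve $\Gamma\subset\mathbb{C}$, $\mathrm{Int}(\Gamma)$ denotes the bounded component of $\mathbb{C}\setminus\Gamma$. Center: an equilibrium $a$ is a center if it has a neighborhood $U$ such that every orbit through a point of $U\setminus\{a\}$ is periodic and encloses $a$ (i.e. $a\in\mathrm{Int}(\Gamma)$). A center always satisfies $F'(a)\neq 0$. Period of a center $a$: the number $T(a):=\frac{2\pi\mathrm{i}}{F'(a)}$. Center basin: $\mathcal{V}:=\{a\}\cup\{x\in\mathbb{C}:\Gamma(x)\text{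 is periodic with }a\in\mathrm{Int}(\Gamma(x))\}$. Double-sided separatrix: an orbit $\Gamma$ such that $I(x_0)$ is bounded for some (equivalently every) $x_0\in\Gamma$. Transit time of a non-equilibrium orbit $\Gamma$: $\tau(\Gamma):=\lambda(I(x))$, the Lebesgue measure of $I(x)$ for any $x\in\Gamma$. Summation over the at most countable set $\mathcal{Q}$ is understood as follows: the series of the nonnegative terms $\tau(C_n)$ is absolutely convergent if the sums over finite subsets of $\mathcal{Q}$ are bounded, and the value is then independent of the order of summation.
   Formalization: The sum of transit times is bounded by |T(a)|, with T(a) shown to be real: the printed bound by T(a) fails for clockwise centers, e.g. F(x) = -ix, where T(0) = -2π and the sum is 0. When T(a) > 0 the bound is the printed one. *)

(* Defs.v *)
From HB Require Import structures.
From mathcomp Require Import all_boot all_order all_algebra.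
From mathcomp Require Import complex.
From mathcomp Require Import all_classical all_reals all_analysis.
Set Implicit Arguments.
Unset Strict Implicit.
Unset Printing Implicit Defensive.
Import Order.TTheory GRing.Theory Num.Theory numFieldNormedType.Exports.
Local Open Scope classical_set_scope.
Local Open Scope ring_scope.

Section PlanarFlow.
Variable R : realType.
(* [R[i]^o] is the complex plane as a normed module over itself: it carries the
   topology given by the modulus, and [derivable F z 1] over [R[i]] is complex
   differentiability at [z]. *)
Implicit Types (F : R[i]^o -> R[i]^o) (G : set R[i]^o) (a x z : R[i]^o).
Implicit Types J : set R.

Definition entire_fun F := forall z, derivable F z 1.

(* [phi] solves the initial value problem on the open interval [J]; time is
   real, so the derivative is the real one, taken componentwise. *)
Definition is_solution F x J (phi : R -> R[i]^o) :=
  [/\ is_interval J, open J, J 0, phi 0 = x &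
      forall t, J t ->
        is_derive t 1 (fun s => complex.Re (phi s)) (complex.Re (F (phi t))) /\
        is_derive t 1 (fun s => complex.Im (phi s)) (complex.Im (F (phi t)))].

(* The maximal interval of existence is the union of all the open intervals
   on which a solution exists. *)
Definition max_interval F x : set R :=
  [set t | exists J phi, is_solution F x J phi /\ J t].

(* By uniqueness of solutions the set below is a singleton when [t] lies in
   [max_interval F x]; outside of it the value is irrelevant. *)
Definition flow F x (t : R) : R[i]^o :=
  xget x [set y | exists J phi, [/\ is_solution F x J phi, J t & phi t = y]].

Definition solution_orbit F x : set R[i]^o := flow F x @` max_interval F x.

(* Equilibria are not counted as periodic. *)
Definition periodic_orbit F x :=
  [/\ F x != 0, max_interval F x = setT &
      exists2 T : R, 0 < T & forall t, flow F x (t + T) = flow F x t].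

(* For a closed Jordan curve [G] there is exactly one bounded component of the
   complement, and [jordan_int G] is that component. *)
Definition jordan_int G : set R[i]^o :=
  [set z | ~ G z /\ bounded_set (connected_component (~` G) z)].

Definition is_center F a :=
  F a = 0 /\
  exists2 U : set R[i]^o, nbhs a U &
    forall x, U x -> x != a ->
      periodic_orbit F x /\ jordan_int (solution_orbit F x) a.

Definition center_basin F a : set R[i]^o :=
  [set a] `|` [set x | periodic_orbit F x /\ jordan_int (solution_orbit F x) a].

(* This is a real number, negative when the orbits around [a] are run through
   clockwise; the minimal period of these orbits is its absolute value. *)
Definition center_period F a : R[i]^o := 2 * (pi : R)%:C%C * 'i%C / derive1 F a.

Definition double_sided_separatrix F G :=
  (exists x, G = solution_orbit F x) /\
  exists2 x, G x & bounded_set (max_interval F x).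

(* The value does not depend on the point of the orbit [G] picked by [xget],
   since [max_interval] is only translated along an orbit. *)
Definition transit_time F G : \bar R :=
  lebesgue_measure (max_interval F (xget 0 G)).

Definition frontier G : set R[i]^o := closure G `\` interior G.

End PlanarFlow.

(* Main.v *)
(** For holomorphic [F] the real-time flows of [F] and of [w F] ([w] complex)
    commute: locally both are translations in the coordinate given by a
    primitive of [1 / F]. Hence the points close to a [T]-periodic orbit are
    complex-time translates of its points, and are [T]-periodic themselves.
    Near the center [a] all orbits have a common period; linearisation gives
    [F'(a) = i om] with [om <> 0] real, and [T = 2 pi / |om|] is a period: after
    the time [T] a point has moved by a small complex time, whose part across
    the orbits must vanish, since the orthogonal field [i F] or [- i F] contracts
    to [a] and never meets the same orbit twice. Following that orthogonal
    trajectory outwards from [a] sweeps out an annulus of nested [T]-periodic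
    orbits, which together with [a] is the whole basin.

    A frontier point of the basin is no equilibrium, because [T]-periodic orbits
    through points close to an equilibrium stay close to it and do not enclose
    [a]; and its solution cannot last for the time [T], for otherwise it would
    be [T]-periodic by continuity and lie in the annulus. So the frontier
    consists of separatrices. Given finitely many of them, a single periodic
    orbit of the annulus passes close to all of them, and its passages along
    them take up disjoint parts of one period; so the transit times add up to at
    most [T], and in particular there are only countably many separatrices. *)
Require Import Defs.
From HB Require Import structures.
From mathcomp Require Import all_boot all_order all_algebra.
From mathcomp Require Import complex.
From mathcomp Require Import all_classical all_reals all_analysis.
From mathcomp Require Import ring lra.
Set Implicit Arguments.
Unset Strict Implicit.
Unset Printing Implicit Defensive.
Import Order.TTheory GRing.Theory Num.Theory numFieldNormedType.Exports.
Import ComplexField.Normc.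
Local Open Scope classical_set_scope.
Local Open Scope ring_scope.
Local Notation cabs := normc.
Local Notation Re := complex.Re.
Local Notation Im := complex.Im.

(** * Complex-valued calculus *)

Section Calculus.
Variable R : realType.
Local Notation C := (R[i]).
Implicit Types (z w : C) (t h e : R).

(** [entire_fun] gives complex differentiability at each point and says nothing about continuity of
    the derivative. This shapes the local theory. Goursat's lemma provides, near a regular point, a
    primitive [G] of 1/F, and its inverse [g] solves all the fields [sc w F] at once. Existence,
    uniqueness, continuous dependence and commutation at regular points are read off in this
    coordinate; at equilibria a Gronwall estimate based on differentiability at that single point
    takes over. Interiors of orbits are handled through the component of [a] in the complement, by
    rays, paths and clopen sets. That the annulus exhausts the basin rests on the annulus being
    unbounded: a basin orbit outside it would enclose all of it. It is unbounded because a bounded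
    one would have only complete orbits in its closure, which would make the annulus together with
    [a] open and closed in the plane. *)

Lemma cabs_ge0 z : 0 <= cabs z.
Proof. by case: z => a b; rewrite sqrtr_ge0. Qed.

Lemma cabs_real h : cabs (h%:C%C) = `|h|.
Proof. by rewrite /= expr0n /= addr0 sqrtr_sqr. Qed.

Lemma cabs_eq0 z : (cabs z == 0) = (z == 0).
Proof. by apply/eqP/eqP => [/eq0_normc|->]; rewrite ?normc0. Qed.

Lemma cabs_gt0 z : (0 < cabs z) = (z != 0).
Proof. by rewrite lt_def cabs_eq0 cabs_ge0 andbT. Qed.

Lemma cabsD z w : cabs (z + w) <= cabs z + cabs w.
Proof. exact: le_normcD. Qed.

Lemma cabsN z : cabs (- z) = cabs z.
Proof. exact: normcN. Qed.

Lemma cabsM z w : cabs (z * w) = cabs z * cabs w.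
Proof. exact: normcM. Qed.

Lemma cabsV z : cabs (z^-1) = (cabs z)^-1.
Proof. exact: normcV. Qed.

Lemma cabsC z w : cabs (z - w) = cabs (w - z).
Proof. by rewrite -cabsN opprB. Qed.

Lemma cabs_tri y x z : cabs (x - z) <= cabs (x - y) + cabs (y - z).
Proof. by have := cabsD (x - y) (y - z); rewrite addrA subrK. Qed.

Lemma cabsB z w : cabs (z - w) <= cabs z + cabs w.
Proof. by rewrite -[cabs w]cabsN cabsD. Qed.

Lemma cabs_dist z w : cabs z - cabs w <= cabs (z - w).
Proof. by have := cabsD (z - w) w; rewrite subrK; lra. Qed.

Lemma cabs_Re z : `|Re z| <= cabs z.
Proof.
by case: z => a b /=; rewrite -sqrtr_sqr ler_sqrt ?addr_ge0 ?lerDl ?sqr_ge0.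
Qed.

Lemma cabs_Im z : `|Im z| <= cabs z.
Proof.
by case: z => a b /=; rewrite -sqrtr_sqr ler_sqrt ?addr_ge0 ?lerDr ?sqr_ge0.
Qed.

Lemma cabs_ReIm z : cabs z <= `|Re z| + `|Im z|.
Proof.
case: z => a b /=; rewrite -[leRHS]ger0_norm ?addr_ge0 // -sqrtr_sqr.
rewrite ler_sqrt ?sqr_ge0 // sqrrD !real_normK ?num_real //.
have := mulr_ge0 (normr_ge0 a) (normr_ge0 b); lra.
Qed.

Lemma cabs_small_eq z w : (forall e, 0 < e -> cabs (z - w) <= e) -> z = w.
Proof.
move=> H; apply/eqP; rewrite -subr_eq0 -cabs_eq0; apply/eqP.
apply/le_anti; rewrite cabs_ge0 andbT; apply/ler_addgt0Pl => e e0.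
by rewrite addr0; exact: H.
Qed.

(** The supremum of the times up to which [P] holds satisfies [P] by the limit hypothesis, and the
    step hypothesis passes it unless it is [b]. This serves as compactness and connectedness of
    intervals for arbitrary predicates. *)
Lemma real_induction (P : R -> Prop) (a b : R) :
  P a ->
  (forall t, a <= t < b -> (forall s, a <= s <= t -> P s) ->
     exists2 e : R, 0 < e & forall s, t < s < t + e -> s <= b -> P s) ->
  (forall t, a < t <= b -> (forall s, a <= s < t -> P s) -> P t) ->
  forall t, a <= t <= b -> P t.
Proof.
move=> Pa Pstep Plim t0 /andP[at0 t0b].
pose S := [set t | a <= t <= b /\ forall s, a <= s <= t -> P s].
have Sa : S a.
  split; first by rewrite lexx (le_trans at0 t0b).
  by move=> s hs; have -> : s = a by apply/le_anti; rewrite andbC.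
have supS : has_sup S.
  by split; [exists a | exists b => t [/andP[]]].
set c := sup S.
have ac : a <= c by exact: ub_le_sup supS.2 _ Sa.
have cb : c <= b by apply: ge_sup; [exists a|move=> t [/andP[]]].
have Plt s : a <= s < c -> P s.
  move=> /andP[as_ sc]; have [|t [_ Ht] st] := @sup_adherent _ _ (c - s) _ supS.
    by rewrite subr_gt0.
  by apply: Ht; rewrite as_ /=; move: st; rewrite -/c; lra.
have Pc : P c.
  have [->//|nac] := eqVneq c a.
  by apply: Plim; [rewrite lt_def nac ac cb|exact: Plt].
have Sc s : a <= s <= c -> P s.
  move=> /andP[as_]; rewrite le_eqVlt => /orP[/eqP ->//|sc].
  by apply: Plt; rewrite as_ sc.
suff cbE : c = b by apply: Sc; rewrite at0 cbE.
apply/le_anti; rewrite cb /= leNgt; apply/negP => clb.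
have [e e0 He] := Pstep c ltac:(by rewrite ac clb) Sc.
pose d := Num.min (c + e / 2) b.
have Sd : S d.
  split.
    rewrite /d le_min ge_min lexx orbT andbT (le_trans ac cb) andbT; lra.
  move=> s /andP[as_ sd]; have [sc|cs] := leP s c; first by apply: Sc; rewrite as_.
  move: sd; rewrite le_min => /andP[s1 s2].
  apply: He => //; rewrite cs /=; lra.
have := ub_le_sup supS.2 Sd; rewrite -/c /d ge_min => /orP[]; lra.
Qed.

(** Compactness: local radii are glued by taking minima. As [good] has to weaken when its radius
    shrinks, upper bounds are later encoded as [e^-1]. *)
Lemma unif_interval (good : R -> R -> Prop) (a b : R) :
  a <= b ->
  (forall t e e', good t e -> 0 < e' <= e -> good t e') ->
  (forall t, a <= t <= b -> exists d e : R, [/\ 0 < d, 0 < e &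
     forall s, a <= s <= b -> `|s - t| < d -> good s e]) ->
  exists2 e : R, 0 < e & forall t, a <= t <= b -> good t e.
Proof.
move=> ab mono loc.
pose P t := exists2 e : R, 0 < e & forall s, a <= s <= t -> good s e.
have glue t t' e e' : 0 < e -> 0 < e' -> (forall s, a <= s <= t -> good s e) ->
    (forall s, t <= s <= t' -> good s e') -> P t'.
  move=> e0 e'0 He He'; exists (Num.min e e'); first by rewrite lt_min e0.
  move=> s /andP[as_ st']; have [st|ts] := leP s t.
    apply: mono (He s _) _; first by rewrite as_.
    by rewrite lt_min e0 e'0 ge_min lexx.
  apply: mono (He' s _) _; first by rewrite ltW.
  by rewrite lt_min e0 e'0 ge_min lexx orbT.
suff /(_ b) : forall t, a <= t <= b -> P t by apply; rewrite ab lexx.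
apply: real_induction.
- have [d [e [d0 e0 H]]] := loc a ltac:(by rewrite lexx ab).
  exists e => // s hs; have -> : s = a by apply/le_anti; rewrite andbC.
  by apply: H; rewrite ?lexx ?ab // subrr normr0.
- move=> t /andP[at_ tb] /(_ t); rewrite at_ lexx => /(_ isT)[e e0 He].
  have [d [e' [d0 e'0 H]]] := loc t ltac:(by rewrite at_ ltW).
  exists d => // s /andP[ts sd] sb; apply: (glue t s e e') => // u /andP[tu us].
  apply: H; first by rewrite (le_trans at_ tu) (le_trans us sb).
  by rewrite ger0_norm; lra.
- move=> t /andP[at_ tb] Hs.
  have [d [e' [d0 e'0 H]]] := loc t ltac:(by rewrite ltW).
  pose s := Num.max a (t - d / 2).
  have hs : a <= s < t by rewrite le_max lexx gt_max at_ /=; lra.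
  have [e e0 He] := Hs s hs.
  apply: (glue s t e e') => // u /andP[su ut].
  move: su; rewrite ge_max => /andP[au du].
  apply: H; first by rewrite au (le_trans ut tb).
  by rewrite ler0_norm; lra.
Qed.

(** Connectedness: the equivalence makes both [P] and its negation open along the interval, so the
    truth value at [a] persists. *)
Lemma loc_const (P : R -> Prop) (a b : R) :
  a <= b -> P a ->
  (forall t, a <= t <= b -> exists2 d : R, 0 < d &
     forall s, a <= s <= b -> `|s - t| < d -> (P t <-> P s)) ->
  P b.
Proof.
move=> ab Pa loc.
suff /(_ b) : forall t, a <= t <= b -> P t by apply; rewrite ab lexx.
apply: real_induction => //.
- move=> t /andP[at_ tb] Ht; have [d d0 H] := loc t ltac:(by rewrite at_ ltW).
  exists d => // s /andP[ts sd] sb; apply/(H s).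
  + by rewrite (le_trans at_ (ltW ts)).
  + by rewrite ger0_norm; lra.
  + by apply: Ht; rewrite at_ lexx.
- move=> t /andP[at_ tb] Hs; have [d d0 H] := loc t ltac:(by rewrite ltW).
  pose s := Num.max a (t - d / 2).
  have /andP[as_ st] : a <= s < t by rewrite le_max lexx gt_max at_ /=; lra.
  apply/(H s); [by rewrite as_; lra| |by apply: Hs; rewrite as_ st].
  have : t - d / 2 <= s by rewrite le_max lexx orbT.
  by move=> ?; rewrite ler0_norm; lra.
Qed.

Lemma geom_cvg_real (u : nat -> R) (d : R) : 0 <= d ->
  (forall n, `|u n.+1 - u n| <= d / 2 ^+ n) ->
  exists l, forall n, `|l - u n| <= 2 * d / 2 ^+ n.
Proof.
move=> d0 Hu.
(* The steps from [n] on add up to at most [r n], so the intervals of radius [r n] about [u n] are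
   nested, and the supremum of their left ends lies in all of them. *)
pose r n := 2 * d / 2 ^+ n.
have rS n : r n.+1 = r n / 2 by rewrite /r exprS; field.
have rd n : d / 2 ^+ n = r n / 2 by rewrite /r; field.
have r0 n : 0 <= r n by rewrite /r divr_ge0 ?mulr_ge0 ?exprn_ge0.
have stepl n m : u n - r n <= u (n + m)%N - r (n + m)%N.
  elim: m => [|m IH]; first by rewrite addn0.
  rewrite addnS rS; have := Hu (n + m)%N; rewrite rd ler_norml.
  move: IH; lra.
have stepr n m : u (n + m)%N + r (n + m)%N <= u n + r n.
  elim: m => [|m IH]; first by rewrite addn0.
  rewrite addnS rS; have := Hu (n + m)%N; rewrite rd ler_norml.
  move: IH; lra.
pose S := range (fun n => u n - r n).
have ubS m : ubound S (u m + r m).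
  move=> _ [n _ <-].
  have h1 := stepl n m; have h2 := stepr m n; rewrite addnC in h2.
  have := r0 (n + m)%N; lra.
have supS : has_sup S by split; [exists (u 0%N - r 0%N), 0%N|exists (u 0%N + r 0%N)].
exists (sup S) => n; rewrite -/(r n) ler_norml; apply/andP; split.
  have := ub_le_sup supS.2 (x := u n - r n) ltac:(by exists n); lra.
have : sup S <= u n + r n by apply: ge_sup; [case: supS|exact: ubS].
lra.
Qed.

Lemma geom_cvg (u : nat -> C) (d : R) : 0 <= d ->
  (forall n, cabs (u n.+1 - u n) <= d / 2 ^+ n) ->
  exists l, forall n, cabs (l - u n) <= 4 * d / 2 ^+ n.
Proof.
move=> d0 Hu.
have [x Hx] := @geom_cvg_real (fun n => Re (u n)) d d0 ltac:(move=> n;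
  apply: le_trans (Hu n); rewrite -raddfB; exact: cabs_Re).
have [y Hy] := @geom_cvg_real (fun n => Im (u n)) d d0 ltac:(move=> n;
  apply: le_trans (Hu n); rewrite -raddfB; exact: cabs_Im).
exists (x +i* y)%C => n; apply: le_trans (cabs_ReIm _) _.
have -> : 4 * d / 2 ^+ n = 2 * d / 2 ^+ n + 2 * d / 2 ^+ n by field.
by apply: lerD; [move: (Hx n)|move: (Hy n)]; case: (u n).
Qed.

Lemma small_pow d e : 0 < e -> exists n, d / 2 ^+ n < e.
Proof.
move=> e0; have [n Hn] : exists n : nat, d / e < n%:R.
  exists (Num.bound `|d / e|).
  exact: le_lt_trans (ler_norm _) (archi_boundP (normr_ge0 _)).
exists n; rewrite ltr_pdivrMr ?exprn_gt0 // mulrC -ltr_pdivrMr //.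
apply: lt_le_trans Hn _.
by rewrite -natrX ler_nat ltnW // ltn_expl.
Qed.

End Calculus.

(** * Derivatives as remainder estimates *)

Section Derivatives.
Variable R : realType.
Local Notation C := (R[i]).
Implicit Types (z w : C) (t h e : R) (phi : R -> C) (f : C -> C).

(** Derivatives are remainder bounds rather than limits of quotients: [h = 0] needs no exception,
    and the rules of calculus become plain inequalities. *)
Definition ccont phi t := forall e, 0 < e ->
  exists2 d : R, 0 < d & forall h, `|h| < d -> cabs (phi (t + h) - phi t) < e.
Definition hcont f z := forall e, 0 < e ->
  exists2 d : R, 0 < d & forall w, cabs w < d -> cabs (f (z + w) - f z) < e.
Definition cderiv phi t (v : C) := forall e, 0 < e ->
  exists2 d : R, 0 < d & forall h, `|h| < d ->
    cabs (phi (t + h) - phi t - h%:C%C * v) <= e * `|h|.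
Definition hderiv f z (v : C) := forall e, 0 < e ->
  exists2 d : R, 0 < d & forall w, cabs w < d ->
    cabs (f (z + w) - f z - w * v) <= e * cabs w.
Definition rderiv (m : R -> R) t (v : R) := forall e, 0 < e ->
  exists2 d : R, 0 < d & forall h, `|h| < d ->
    `|m (t + h) - m t - h * v| <= e * `|h|.

Lemma hderiv_cont f z v : hderiv f z v -> hcont f z.
Proof.
move=> Hf e e0; have [d d0 Hd] := Hf 1 ltr01.
pose k := 1 + cabs v; have k0 : 0 < k by rewrite ltr_pwDl ?cabs_ge0.
exists (Num.min d (e / k)); first by rewrite lt_min d0 divr_gt0.
move=> w; rewrite lt_min => /andP[wd we].
have := cabsD (f (z + w) - f z - w * v) (w * v); rewrite subrK cabsM.
have := Hd _ wd; rewrite ltr_pdivlMr // in we; rewrite /k in we; lra.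
Qed.

Lemma cderiv_cont phi t v : cderiv phi t v -> ccont phi t.
Proof.
move=> Hf e e0; have [d d0 Hd] := Hf 1 ltr01.
pose k := 1 + cabs v; have k0 : 0 < k by rewrite ltr_pwDl ?cabs_ge0.
exists (Num.min d (e / k)); first by rewrite lt_min d0 divr_gt0.
move=> w; rewrite lt_min => /andP[wd we].
have := cabsD (phi (t + w) - phi t - w%:C%C * v) (w%:C%C * v).
rewrite subrK cabsM cabs_real.
have := Hd _ wd; rewrite ltr_pdivlMr // in we; rewrite /k in we; lra.
Qed.

Lemma rderiv_cont (m : R -> R) t v : rderiv m t v ->
  forall e, 0 < e -> exists2 d : R, 0 < d & forall h, `|h| < d -> `|m (t + h) - m t| < e.
Proof.
move=> Hf e e0; have [d d0 Hd] := Hf 1 ltr01.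
pose k := 1 + `|v|; have k0 : 0 < k by rewrite ltr_pwDl.
exists (Num.min d (e / k)); first by rewrite lt_min d0 divr_gt0.
move=> w; rewrite lt_min => /andP[wd we].
have := ler_normD (m (t + w) - m t - w * v) (w * v).
rewrite subrK normrM.
have := Hd _ wd; rewrite ltr_pdivlMr // in we; rewrite /k in we; lra.
Qed.

Lemma cderiv_near phi psi t v d : 0 < d ->
  (forall h, `|h| < d -> phi (t + h) = psi (t + h)) -> cderiv phi t v -> cderiv psi t v.
Proof.
move=> d0 E H e e0; have [d' d'0 Hd] := H e e0.
exists (Num.min d d'); first by rewrite lt_min d0.
move=> h; rewrite lt_min => /andP[hd hd']; rewrite -E //.
by have := E 0; rewrite addr0 normr0 => <- //; exact: Hd.
Qed.

Lemma hderiv_near f g z v d : 0 < d ->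
  (forall w, cabs w < d -> f (z + w) = g (z + w)) -> hderiv f z v -> hderiv g z v.
Proof.
move=> d0 E H e e0; have [d' d'0 Hd] := H e e0.
exists (Num.min d d'); first by rewrite lt_min d0.
move=> h; rewrite lt_min => /andP[hd hd']; rewrite -E //.
by have := E 0; rewrite addr0 normc0 => <- //; exact: Hd.
Qed.

Lemma cderiv_cst z t : cderiv (fun=> z) t 0.
Proof.
move=> e e0; exists 1 => // h _.
by rewrite subrr mulr0 subrr normc0 mulr_ge0 // ltW.
Qed.

Lemma cderivD phi psi t u v : cderiv phi t u -> cderiv psi t v ->
  cderiv (fun s => phi s + psi s) t (u + v).
Proof.
move=> Hu Hv e e0.
have [d d0 Hd] := Hu (e / 2) ltac:(lra); have [d' d'0 Hd'] := Hv (e / 2) ltac:(lra).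
exists (Num.min d d'); first by rewrite lt_min d0.
move=> h; rewrite lt_min => /andP[hd hd'].
have -> : phi (t + h) + psi (t + h) - (phi t + psi t) - h%:C%C * (u + v) =
  (phi (t + h) - phi t - h%:C%C * u) + (psi (t + h) - psi t - h%:C%C * v) by ring.
apply: le_trans (cabsD _ _) _; have := Hd _ hd; have := Hd' _ hd'; lra.
Qed.

Lemma cderivZ phi t u z : cderiv phi t u -> cderiv (fun s => z * phi s) t (z * u).
Proof.
move=> Hu e e0; pose k := 1 + cabs z; have k0 : 0 < k by rewrite ltr_pwDl ?cabs_ge0.
have [d d0 Hd] := Hu (e / k) ltac:(exact: divr_gt0).
exists d => // h hd.
have -> : z * phi (t + h) - z * phi t - h%:C%C * (z * u) =
  z * (phi (t + h) - phi t - h%:C%C * u) by ring.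
rewrite cabsM; apply: le_trans (ler_wpM2l (cabs_ge0 _) (Hd _ hd)) _.
rewrite mulrA ler_wpM2r // mulrA ler_pdivrMr // mulrC ler_pM2l // /k; lra.
Qed.

Lemma cderivB phi psi t u v : cderiv phi t u -> cderiv psi t v ->
  cderiv (fun s => phi s - psi s) t (u - v).
Proof.
move=> Hu /(@cderivZ _ _ _ (-1)) Hv; have := cderivD Hu Hv.
rewrite mulN1r; apply: (@cderiv_near _ _ _ _ 1) => // h _.
by rewrite mulN1r.
Qed.

Lemma cderivM phi psi t u v : cderiv phi t u -> cderiv psi t v ->
  cderiv (fun s => phi s * psi s) t (u * psi t + phi t * v).
Proof.
move=> Hu Hv e e0.
pose k := 1 + cabs (psi t) + cabs (phi t) + cabs u.
have k1 : 1 <= k by rewrite /k -!addrA lerDl !addr_ge0 ?cabs_ge0.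
have k0 : 0 < k by lra.
pose e1 := Num.min 1 (e / (3 * k)).
have e10 : 0 < e1 by rewrite lt_min ltr01 divr_gt0 ?mulr_gt0.
have e11 : e1 <= 1 by rewrite ge_min lexx.
have e1k : 3 * (e1 * k) <= e.
  have : e1 <= e / (3 * k) by rewrite ge_min lexx orbT.
  rewrite ler_pdivlMr ?mulr_gt0 //; lra.
have [d d0 Hd] := Hu e1 e10; have [d' d'0 Hd'] := Hv e1 e10.
have [d2 d20 Hd2] := cderiv_cont Hv e10.
exists (Num.min d (Num.min d' d2)); first by rewrite !lt_min d0 d'0.
move=> h; rewrite !lt_min => /and3P[hd hd' hd2].
have -> : phi (t + h) * psi (t + h) - phi t * psi t - h%:C%C * (u * psi t + phi t * v) =
  (phi (t + h) - phi t - h%:C%C * u) * psi (t + h)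
  + (h%:C%C * u) * (psi (t + h) - psi t)
  + phi t * (psi (t + h) - psi t - h%:C%C * v) by ring.
apply: le_trans (cabsD _ _) _; apply: le_trans (lerD (cabsD _ _) (lexx _)) _.
rewrite !cabsM cabs_real.
move: (Hd _ hd) (Hd' _ hd') (Hd2 _ hd2) => h1 h2 h3.
have h4 : cabs (psi (t + h)) <= cabs (psi t) + 1.
  have := cabsD (psi (t + h) - psi t) (psi t); rewrite subrK; lra.
have a1 : cabs (phi (t + h) - phi t - h%:C%C * u) * cabs (psi (t + h)) <= (e1 * `|h|) * k.
  apply: ler_pM; rewrite ?cabs_ge0 //.
  by rewrite /k; have := cabs_ge0 (phi t); have := cabs_ge0 u; lra.
have a2 : `|h| * cabs u * cabs (psi (t + h) - psi t) <= `|h| * k * e1.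
  apply: ler_pM; rewrite ?mulr_ge0 ?cabs_ge0 ?ler_wpM2l //; last exact: ltW.
  by rewrite /k; have := cabs_ge0 (phi t); have := cabs_ge0 (psi t); lra.
have a3 : cabs (phi t) * cabs (psi (t + h) - psi t - h%:C%C * v) <= k * (e1 * `|h|).
  apply: ler_pM; rewrite ?cabs_ge0 //.
  by rewrite /k; have := cabs_ge0 (psi t); have := cabs_ge0 u; lra.
have : 3 * (e1 * k) * `|h| <= e * `|h| by rewrite ler_wpM2r.
lra.
Qed.

Lemma cderiv_comp f phi t u v : cderiv phi t u -> hderiv f (phi t) v ->
  cderiv (fun s => f (phi s)) t (u * v).
Proof.
move=> Hu Hv e e0.
pose k := 1 + cabs u; have k0 : 0 < k by rewrite ltr_pwDl ?cabs_ge0.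
pose k' := 1 + cabs v; have k'0 : 0 < k' by rewrite ltr_pwDl ?cabs_ge0.
have [d d0 Hd] := Hv (e / (2 * k)) ltac:(by rewrite divr_gt0 // mulr_gt0).
pose e1 := Num.min 1 (e / (2 * k')).
have e10 : 0 < e1 by rewrite lt_min ltr01 divr_gt0 ?mulr_gt0.
have e11 : e1 <= 1 by rewrite ge_min lexx.
have [d1 d10 Hd1] := Hu e1 e10.
have [d2 d20 Hd2] := cderiv_cont Hu d0.
exists (Num.min d1 d2); first by rewrite lt_min d10.
move=> h; rewrite lt_min => /andP[/Hd1 h1 /Hd2 /Hd h2].
rewrite [phi t + _]addrC subrK in h2.
have -> : f (phi (t + h)) - f (phi t) - h%:C%C * (u * v) =
  (f (phi (t + h)) - f (phi t) - (phi (t + h) - phi t) * v) +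
  (phi (t + h) - phi t - h%:C%C * u) * v by ring.
apply: le_trans (cabsD _ _) _; rewrite cabsM.
have h3 : cabs (phi (t + h) - phi t) <= k * `|h|.
  have := cabsD (phi (t + h) - phi t - h%:C%C * u) (h%:C%C * u).
  rewrite subrK cabsM cabs_real /k.
  have : e1 * `|h| <= 1 * `|h| by rewrite ler_wpM2r.
  lra.
have h4 : e / (2 * k) * cabs (phi (t + h) - phi t) <= e / 2 * `|h|.
  have -> : e / 2 * `|h| = e / (2 * k) * (k * `|h|) by field; rewrite gt_eqF.
  by rewrite ler_wpM2l // divr_ge0 ?mulr_ge0 // ltW.
have h5 : cabs (phi (t + h) - phi t - h%:C%C * u) * cabs v <= e / 2 * `|h|.
  have -> : e / 2 * `|h| = e / (2 * k') * `|h| * k' by field; rewrite gt_eqF.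
  apply: ler_pM; rewrite ?cabs_ge0 //; last by rewrite /k'; lra.
  by apply: le_trans h1 _; rewrite ler_wpM2r // ge_min lexx orbT.
lra.
Qed.

Lemma cderiv_affine z w t : cderiv (fun s => z + s%:C%C * w) t w.
Proof.
move=> e e0; exists 1 => // h _; rewrite rmorphD /=.
have -> : z + (t%:C%C + h%:C%C) * w - (z + t%:C%C * w) - h%:C%C * w = 0 by ring.
by rewrite normc0 mulr_ge0 // ltW.
Qed.

Lemma cderiv_rescale phi (a b : R) t u : cderiv phi (a * t + b) u ->
  cderiv (fun s => phi (a * s + b)) t (a%:C%C * u).
Proof.
move=> Hu e e0; pose k := 1 + `|a|; have k0 : 0 < k by rewrite ltr_pwDl.
have [d d0 Hd] := Hu (e / k) ltac:(exact: divr_gt0).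
exists (d / k); first by rewrite divr_gt0.
move=> h; rewrite ltr_pdivlMr // => hd.
have ah : `|a * h| <= k * `|h| by rewrite normrM ler_wpM2r // /k; lra.
have := Hd (a * h) ltac:(by apply: le_lt_trans ah _; rewrite mulrC).
have -> : a * t + b + a * h = a * (t + h) + b by ring.
rewrite rmorphM /= mulrCA mulrA => h1; apply: le_trans h1 _.
by rewrite -mulrA ler_pM2l // ler_pdivrMl.
Qed.

End Derivatives.

(** * Barriers, mean value and Gronwall estimates *)

Section Fence.
Variable R : realType.
Local Notation C := (R[i]).
Implicit Types (z w : C) (t h e : R) (phi v : R -> C) (f : C -> C).

Lemma rderiv_linear (k : R) c t : rderiv (fun s => c + k * s) t k.
Proof.
move=> e e0; exists 1 => // h _.
have -> : c + k * (t + h) - (c + k * t) - h * k = 0 by ring.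
by rewrite normr0 mulr_ge0 // ltW.
Qed.

Lemma is_derive_rderiv (m : R -> R) t (d : R) : is_derive t 1 m d -> rderiv m t d.
Proof.
move=> [dm <-] e e0.
have /cvgrPdist_le /(_ e e0) := dm.
rewrite -/('D_1 m t) => /nbhs_ballP[r /= r0 Hr].
exists r => // h hr; have [->|h0] := eqVneq h 0.
  by rewrite addr0 subrr mul0r subrr normr0 mulr0.
have := Hr h ltac:(by rewrite -ball_normE /= sub0r normrN) h0.
rewrite /= [_ *: 1]mulr1 -[_ *: (_ - _)]/(_ * _) [h + t]addrC => H.
have -> : m (t + h) - m t - h * 'D_1 m t = - (('D_1 m t - h^-1 * (m (t + h) - m t)) * h).
  by field.
by rewrite normrN normrM ler_wpM2r.
Qed.

Lemma rderiv_is_derive (m : R -> R) t (d : R) : rderiv m t d -> is_derive t 1 m d.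
Proof.
move=> H.
have cv : (fun h : R => h^-1 *: (m (h *: 1 + t) - m t)) @ 0^' --> d.
  apply/cvgrPdist_le => e e0; have [r r0 Hr] := H e e0.
  apply/nbhs_ballP; exists r => // h; rewrite -ball_normE /= sub0r normrN => hr h0.
  have := Hr h hr; rewrite [_ *: 1]mulr1 -[_ *: (_ - _)]/(_ * _) [h + t]addrC => H1.
  have -> : d - h^-1 * (m (t + h) - m t) = - ((m (t + h) - m t - h * d) * h^-1) by field.
  by rewrite normrN normrM normfV ler_pdivrMr ?normr_gt0.
by split; [apply/cvg_ex; exists d|exact: cvg_lim].
Qed.

Lemma rderiv_cderiv (m : R -> R) t (d : R) :
  rderiv m t d <-> cderiv (fun s => (m s)%:C%C) t d%:C%C.
Proof.
have E h : cabs ((m (t + h))%:C%C - (m t)%:C%C - h%:C%C * d%:C%C) =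
  `|m (t + h) - m t - h * d| by rewrite -rmorphM -!rmorphB cabs_real.
by split=> H e /H[r r0 Hr]; exists r => // h /Hr; rewrite E.
Qed.

Lemma Re_scal h z : Re (h%:C%C * z) = h * Re z.
Proof. by case: z => x y /=; rewrite mul0r subr0. Qed.

Lemma Im_scal h z : Im (h%:C%C * z) = h * Im z.
Proof. by case: z => x y /=; rewrite mul0r addr0. Qed.

Lemma cderiv_is_derive (phi : R -> C) t (d : C) :
  is_derive t 1 (fun s => Re (phi s)) (Re d) /\ is_derive t 1 (fun s => Im (phi s)) (Im d) <->
  cderiv phi t d.
Proof.
split=> [[/is_derive_rderiv/rderiv_cderiv H1 /is_derive_rderiv/rderiv_cderiv/(cderivZ 'i%C) H2]|H].
  have := cderivD H1 H2; rewrite -complexE.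
  by apply: (@cderiv_near _ _ _ _ _ 1) => // h _; rewrite -complexE.
by split; apply: rderiv_is_derive => e e0; have [r r0 Hr] := H e e0;
  exists r => // h /Hr; apply: le_trans; rewrite -?Re_scal -?Im_scal -!raddfB;
  (exact: cabs_Re || exact: cabs_Im).
Qed.

Lemma rderiv_expR (c0 c k b t : R) :
  rderiv (fun s => c0 + c * expR (k * (s - b))) t (c * (k * expR (k * (t - b)))).
Proof.
apply/rderiv_cderiv.
have /is_derive_rderiv/rderiv_cderiv := is_derive_expR (k * t + (- (k * b))).
move=> /cderiv_rescale/(cderivZ c%:C%C)/(cderivD (cderiv_cst c0%:C%C t)).
rewrite add0r -!rmorphM -mulrBr.
by apply: (@cderiv_near _ _ _ _ _ 1) => // h _; rewrite -rmorphM -rmorphD -mulrBr.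
Qed.

(** The exponential of mu t, for complex [mu] and real [t]. *)
Definition cexp (mu : C) (t : R) : C :=
  (expR (Re mu * t))%:C%C * ((cos (Im mu * t))%:C%C + 'i%C * (sin (Im mu * t))%:C%C).

Lemma cexp0 mu : cexp mu 0 = 1.
Proof. by rewrite /cexp !mulr0 expR0 cos0 sin0 !mulr0 mul1r addr0. Qed.

Lemma cabs_cexp mu t : cabs (cexp mu t) = expR (Re mu * t).
Proof.
rewrite /cexp cabsM cabs_real ger0_norm ?expR_ge0 //.
rewrite -[RHS]mulr1; congr (_ * _).
by rewrite /= !mul0r !mulr0 !mul1r ?subr0 ?add0r ?addr0 cos2Dsin2 sqrtr1.
Qed.

Lemma cderiv_cexp mu t : cderiv (cexp mu) t (mu * cexp mu t).
Proof.
have He : cderiv (fun s => (expR (Re mu * s))%:C%C) t ((Re mu)%:C * (expR (Re mu * t))%:C)%C.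
  have /is_derive_rderiv/rderiv_cderiv := is_derive_expR (Re mu * t + 0).
  move=> /cderiv_rescale; rewrite addr0.
  by apply: (@cderiv_near _ _ _ _ _ 1) => // h _; rewrite addr0.
have Hc : cderiv (fun s => (cos (Im mu * s))%:C%C) t ((Im mu)%:C * (- sin (Im mu * t))%:C)%C.
  have /is_derive_rderiv/rderiv_cderiv := is_derive_cos (Im mu * t + 0).
  move=> /cderiv_rescale; rewrite addr0.
  by apply: (@cderiv_near _ _ _ _ _ 1) => // h _; rewrite addr0.
have Hs : cderiv (fun s => (sin (Im mu * s))%:C%C) t ((Im mu)%:C * (cos (Im mu * t))%:C)%C.
  have /is_derive_rderiv/rderiv_cderiv := is_derive_sin (Im mu * t + 0).
  move=> /cderiv_rescale; rewrite addr0.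
  by apply: (@cderiv_near _ _ _ _ _ 1) => // h _; rewrite addr0.
have := cderivM He (cderivD Hc (cderivZ 'i%C Hs)).
rewrite -/(cexp mu); congr (cderiv _ _ _).
rewrite [X in _ = X * _]complexE /cexp rmorphN /=.
set x := (expR _)%:C%C; set y := (cos _)%:C%C; set s := (sin _)%:C%C.
set p := (Re mu)%:C%C; set q := (Im mu)%:C%C.
have i2 : 'i%C * 'i%C = -1 :> C by rewrite -expr2 sqr_i.
transitivity (p * x * (y + 'i%C * s) + x * ('i%C * q * y) - q * (s * x)); first by ring.
have -> : q * (s * x) = - ('i%C * 'i%C) * (q * (s * x)) by rewrite i2; ring.
ring.
Qed.

(* Real induction: the bound cannot be lost at a point where the barrier [m]
   grows strictly faster than [v] moves. *)
Lemma fence v z (m m' : R -> R) a b :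
  (forall t, a <= t <= b -> ccont v t) ->
  (forall t, a <= t <= b -> rderiv m t (m' t)) ->
  cabs (v a - z) <= m a ->
  (forall t, a <= t < b -> cabs (v t - z) <= m t ->
     exists2 d, cderiv v t d & cabs d < m' t) ->
  forall t, a <= t <= b -> cabs (v t - z) <= m t.
Proof.
move=> vc md ia Hd; apply: real_induction => //.
- move=> t atb /(_ t); rewrite lexx andbT (andP atb).1 => /(_ isT) Ht.
  have [d vd dm] := Hd t atb Ht.
  have atb' : a <= t <= b by case/andP: atb => -> /ltW ->.
  pose e := (m' t - cabs d) / 2; have e0 : 0 < e by rewrite /e; lra.
  have [d1 d10 H1] := vd e e0; have [d2 d20 H2] := md t atb' e e0.
  exists (Num.min d1 d2); first by rewrite lt_min d10.
  move=> s /andP[ts]; rewrite -ltrBlDl lt_min => /andP[s1 s2] sb.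
  have h0 : 0 < s - t by lra.
  have := H1 (s - t); have := H2 (s - t); rewrite gtr0_norm // subrKC.
  move=> /(_ s2); rewrite ler_norml => /andP[h2 _] /(_ s1) h1.
  have := cabsD (v s - v t - (s - t)%:C%C * d) ((s - t)%:C%C * d).
  rewrite subrK cabsM cabs_real gtr0_norm // => h3.
  have h4 := cabs_tri (v t) (v s) z.
  have h5 : (s - t) * m' t = (s - t) * cabs d + 2 * (e * (s - t)) by rewrite /e; field.
  lra.
- move=> t /andP[at_ tb] Hs; apply/ler_addgt0Pl => e e0.
  have atb : a <= t <= b by rewrite ltW.
  have e20 : 0 < e / 2 by lra.
  have [d1 d10 H1] := vc t atb _ e20.
  have [d2 d20 H2] := rderiv_cont (md t atb) e20.
  pose d := Num.min d1 d2; have d0 : 0 < d by rewrite lt_min d10.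
  pose s := Num.max a (t - d / 2).
  have hs : a <= s < t by rewrite le_max lexx gt_max at_ /=; lra.
  have sd : t - d / 2 <= s by rewrite le_max lexx orbT.
  have : `|s - t| < d by rewrite ltr0_norm; lra.
  rewrite lt_min => /andP[/H1 + /H2]; rewrite subrKC => h1.
  rewrite ltr_norml => h2; have h3 := cabs_tri (v s) (v t) z.
  have := Hs s hs; rewrite cabsC in h1; lra.
Qed.

Lemma cderiv_bound v (M : R) a b : a <= b ->
  (forall t, a <= t <= b -> exists2 d, cderiv v t d & cabs d <= M) ->
  cabs (v b - v a) <= M * (b - a).
Proof.
move=> ab H; apply/ler_addgt0Pl => e e0.
(* [fence] asks for a strictly larger slope, so the linear barrier gets slope M + k, with [k] so
   small that the excess over the interval is at most [e]. *)
pose k := e / (1 + (b - a)); have k0 : 0 < k by rewrite divr_gt0 //; lra.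
have := @fence v (v a) (fun t => - ((M + k) * a) + (M + k) * t) (fun=> M + k) a b.
move=> /(_ _ _ _ _ b) F.
have : cabs (v b - v a) <= - ((M + k) * a) + (M + k) * b.
  apply: F; last by rewrite ab lexx.
  - by move=> t /H[d + _]; exact: cderiv_cont.
  - by move=> t _; exact: rderiv_linear.
  - by rewrite subrr normc0; lra.
  - move=> t /andP[at_ tb] _; have [|d vd dM] := H t; first by rewrite at_ ltW.
    by exists d => //; lra.
have : k * (b - a) <= e.
  rewrite /k mulrAC ler_pdivrMr; [rewrite ler_pM2l //|]; lra.
lra.
Qed.

Lemma cderiv0_const v a b : a <= b ->
  (forall t, a <= t <= b -> cderiv v t 0) -> v b = v a.
Proof.
move=> ab H; apply: cabs_small_eq => e e0.
have := @cderiv_bound v 0 a b ab; rewrite mul0r => H1.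
apply: le_trans (H1 _) (ltW e0) => t /H ?; exists 0 => //.
by rewrite normc0.
Qed.

Lemma gronwall_dist v z (K K' : R) a b : K < K' -> z != 0 ->
  (forall t, a <= t <= b -> ccont v t) -> v a = z ->
  (forall t, a <= t < b -> cabs (v t - z) <= cabs z * (expR (K' * (t - a)) - 1) ->
     exists2 d, cderiv v t d & cabs d <= K * cabs (v t)) -> 0 <= K ->
  forall t, a <= t <= b -> cabs (v t - z) <= cabs z * (expR (K' * (t - a)) - 1).
Proof.
move=> KK z0 vc va vd K0 t atb.
have -> : cabs z * (expR (K' * (t - a)) - 1) = - cabs z + cabs z * expR (K' * (t - a)) by ring.
apply: (@fence v z (fun s => - cabs z + cabs z * expR (K' * (s - a))) (fun s => cabs z * (K' * expR (K' * (s - a)))) a b) => //.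
- by move=> s _; exact: rderiv_expR.
- by rewrite va !subrr normc0 mulr0 expR0 mulr1 addNr.
- move=> s hs Hs; have [|d dv dK] := vd s hs; first by move: Hs; lra.
  exists d => //; apply: le_lt_trans dK _.
  have h1 := cabsD (v s - z) z; rewrite subrK in h1.
  have h2 : cabs (v s) <= cabs z * expR (K' * (s - a)) by lra.
  have h3 : 0 < cabs z * expR (K' * (s - a)) by rewrite mulr_gt0 ?cabs_gt0 ?expR_gt0.
  have := ler_wpM2l K0 h2; have := ltr_pM2r h3 K K'; rewrite KK => h4; lra.
Qed.

Lemma gronwall v (K K' c : R) a b : 0 <= K < K' -> 0 < c ->
  (forall t, a <= t <= b -> ccont v t) -> cabs (v a) <= c ->
  (forall t, a <= t < b -> cabs (v t) <= c * expR (K' * (t - a)) ->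
     exists2 d, cderiv v t d & cabs d <= K * cabs (v t)) ->
  forall t, a <= t <= b -> cabs (v t) <= c * expR (K' * (t - a)).
Proof.
move=> /andP[K0 KK] c0 vc va vd t atb.
rewrite -[c * _]add0r -[v t]subr0.
apply: (@fence v 0 (fun s => 0 + c * expR (K' * (s - a))) (fun s => c * (K' * expR (K' * (s - a)))) a b) => //.
- by move=> s _; exact: rderiv_expR.
- by rewrite subr0 subrr mulr0 expR0 mulr1 add0r.
- move=> s hs; rewrite subr0 add0r => Hs; have [d dv dK] := vd s hs Hs.
  exists d => //; apply: le_lt_trans dK _.
  have h3 : 0 < c * expR (K' * (s - a)) by rewrite mulr_gt0 ?expR_gt0.
  have := ler_wpM2l K0 Hs; have := ltr_pM2r h3 K K'; rewrite KK => h4; lra.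
Qed.

Lemma normE (w : C) : `|w| = (cabs w)%:C%C.
Proof. by rewrite normc_def; case: w. Qed.

Lemma derivable_hderiv (f : R[i]^o -> R[i]^o) (z : R[i]^o) :
  derivable f z 1 -> hderiv f z (derive1 f z).
Proof.
move=> dm e e0; rewrite derive1E.
have e0' : 0 < e%:C%C :> C by rewrite ltcR.
have /cvgrPdist_le /(_ _ e0') := dm.
rewrite -/('D_1 f z) => /nbhs_ballP[r /= r0 Hr].
(* Radii of balls are elements of [R[i]] here; positivity forces their imaginary part to vanish. *)
have rE : r = (Re r)%:C%C by case: (r) r0 => x y; rewrite ltcE /= => /andP[/eqP->].
have r0' : 0 < Re r by rewrite rE ltcR in r0.
exists (Re r) => // h hr; have [->|h0] := eqVneq h 0.
  by rewrite addr0 subrr mul0r subrr normc0 mulr0.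
have := Hr h _ h0.
have hb : ball (0 : R[i]^o) r (h : R[i]^o).
  rewrite -ball_normE /= sub0r normrN.
  by rewrite rE normc_def ltcR; case: (h) hr.
move=> /(_ hb); rewrite /= => H.
have {}H : cabs ('D_1 f z - h^-1 * (f (z + h) - f z)) <= e.
  move: H; rewrite [_ *: 1]mulr1 -[_ *: (_ - _)]/(_ * _ : C) [(h : R[i]^o) + _]addrC.
  by rewrite normE lecR.
have -> : f (z + h) - f z - h * 'D_1 f z = - (('D_1 f z - h^-1 * (f (z + h) - f z)) * h).
  by field.
by rewrite cabsN cabsM ler_wpM2r // cabs_ge0.
Qed.
End Fence.

(** * Goursat's lemma and local primitives *)

Section Goursat.
Variable R : realType.
Local Notation C := (R[i]).
Implicit Types (z w p q s : C) (t h e : R) (f : C -> C).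

(** The interval exceeds [0, 1] so that the derivative is two-sided also at the ends of a segment
    parametrised by [0, 1]. *)
Lemma real_primitive (g : R -> R) :
  (forall t e, 0 < e -> exists2 d : R, 0 < d & forall h, `|h| < d -> `|g (t + h) - g t| < e) ->
  exists G, forall t, -1 < t < 2 -> rderiv G t (g t).
Proof.
move=> gc.
have cg : continuous g.
  move=> t; apply/cvgrPdist_lt => e e0; have [d d0 Hd] := gc t e e0.
  apply/nbhs_ballP; exists d => // s; rewrite /= distrC => sd.
  by rewrite distrC; have := Hd _ sd; rewrite subrKC.
exists (fun x => \int[lebesgue_measure]_(t in `[-1, x]) g t)%R.
move=> t /andP[t1 t2]; apply: is_derive_rderiv.
have ig : lebesgue_measure.-integrable `[-1, 2] (EFin \o g).
  apply: continuous_compact_integrable; first exact: segment_compact.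
  exact: continuous_subspaceT.
have [dG GE] := continuous_FTC1_closed t2 ig t1 (cg t).
by split; [exact: dG|rewrite -derive1E GE].
Qed.

Lemma cprimitive (g : R -> C) : (forall t, ccont g t) ->
  exists G, forall t, -1 < t < 2 -> cderiv G t (g t).
Proof.
move=> gc.
have [G1 H1] : exists G, forall t, -1 < t < 2 -> rderiv G t (Re (g t)).
  apply: real_primitive => t e e0; have [d d0 Hd] := gc t e e0.
  by exists d => // h /Hd; apply: le_lt_trans; rewrite -raddfB; exact: cabs_Re.
have [G2 H2] : exists G, forall t, -1 < t < 2 -> rderiv G t (Im (g t)).
  apply: real_primitive => t e e0; have [d d0 Hd] := gc t e e0.
  by exists d => // h /Hd; apply: le_lt_trans; rewrite -raddfB; exact: cabs_Im.
exists (fun t => (G1 t)%:C + 'i * (G2 t)%:C)%C => t ht.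
rewrite (complexE (g t)); apply: cderivD.
  exact/rderiv_cderiv/H1.
exact/cderivZ/rderiv_cderiv/H2.
Qed.

Definition on_seg p q t : C := p + t%:C%C * (q - p).

Definition seg_prim f p q (G : R -> C) :=
  forall t, 0 <= t <= 1 -> cderiv G t ((q - p) * f (on_seg p q t)).

(** The contour integral along the segment, as the increment of any antiderivative of the
    pulled-back integrand; independence of the choice is [seg_intE]. *)
Definition seg_int f p q : C :=
  xget 0 [set c | exists2 G, seg_prim f p q G & c = G 1 - G 0].

Lemma seg_intE f p q G : seg_prim f p q G -> seg_int f p q = G 1 - G 0.
Proof.
move=> HG; rewrite /seg_int; case: xgetP => [c _ [H HH ->]|/(_ (G 1 - G 0))[]]; last first.
  by exists G.
apply/eqP; rewrite -subr_eq0; apply/eqP.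
have -> : H 1 - H 0 - (G 1 - G 0) = (H 1 - G 1) - (H 0 - G 0) by ring.
apply/eqP; rewrite subr_eq0; apply/eqP.
apply: (@cderiv0_const _ (fun t => H t - G t)) => // t ht.
by have := cderivB (HH t ht) (HG t ht); rewrite subrr.
Qed.

Lemma seg_prim_ex f p q :
  (forall t, 0 <= t <= 1 -> hcont f (on_seg p q t)) -> exists G, seg_prim f p q G.
Proof.
move=> fc.
(* [cl] clamps [t] to [0, 1]: the integrand becomes continuous on the whole line, as [cprimitive]
   demands, while [f] is evaluated on the segment only. *)
pose cl (t : R) := (1 + `|t| - `|t - 1|) / 2.
have cl01 t : 0 <= cl t <= 1.
  have := ler_dist_dist t (t - 1); have -> : t - (t - 1) = 1 by ring.
  by rewrite normr1 ler_norml /cl => H; apply/andP; split; lra.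
have clE t : 0 <= t <= 1 -> cl t = t.
  by move=> /andP[t0 t1]; rewrite /cl ger0_norm // ler0_norm; [field|lra].
have clL t h : `|cl (t + h) - cl t| <= `|h|.
  have := ler_dist_dist (t + h) t; have := ler_dist_dist (t + h - 1) (t - 1).
  have -> : t + h - t = h by ring.
  have -> : t + h - 1 - (t - 1) = h by ring.
  by rewrite !ler_norml /cl => H1 H2; apply/andP; split; lra.
have [|G HG] := @cprimitive (fun t => (q - p) * f (on_seg p q (cl t))).
  move=> t e e0; pose k := 1 + cabs (q - p); have k0 : 0 < k by rewrite ltr_pwDl ?cabs_ge0.
  have [d d0 Hd] := fc _ (cl01 t) (e / k) ltac:(exact: divr_gt0).
  exists (d / k); first exact: divr_gt0.
  move=> h; rewrite ltr_pdivlMr // => hd; rewrite -mulrBr cabsM.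
  have E : on_seg p q (cl (t + h)) = on_seg p q (cl t) + (cl (t + h) - cl t)%:C%C * (q - p).
    by rewrite /on_seg rmorphB /=; ring.
  have h1 : `|cl (t + h) - cl t| * cabs (q - p) <= `|h| * k.
    by apply: ler_pM; rewrite ?cabs_ge0 // /k; lra.
  have := Hd ((cl (t + h) - cl t)%:C%C * (q - p)).
  rewrite -E cabsM cabs_real => /(_ (le_lt_trans h1 hd)).
  rewrite ltr_pdivlMr // mulrC; apply: le_lt_trans.
  by rewrite ler_wpM2r ?cabs_ge0 // /k; lra.
exists G => t ht; have := HG t; rewrite clE //; apply.
by case/andP: ht => *; apply/andP; split; lra.
Qed.

Lemma on_seg_rev p q t : on_seg q p t = on_seg p q (-1 * t + 1).
Proof. by rewrite /on_seg rmorphD rmorphM rmorphN rmorph1 /=; ring. Qed.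

Lemma seg_int_rev f p q : (exists G, seg_prim f p q G) -> seg_int f q p = - seg_int f p q.
Proof.
move=> [G HG]; rewrite (seg_intE HG) (@seg_intE _ _ _ (fun t => G (-1 * t + 1))).
  by rewrite mulr0 add0r mulr1 addNr opprB.
move=> t ht; rewrite on_seg_rev.
have := HG (-1 * t + 1) ltac:(case/andP: ht => *; apply/andP; split; lra).
move=> /cderiv_rescale; congr (cderiv _ _ _).
have -> : (-1)%:C%C = -1 :> C by rewrite rmorphN rmorph1.
by ring.
Qed.

Definition mid p q : C := (2^-1)%:C%C * (p + q).

Lemma midC p q : mid p q = mid q p.
Proof. by rewrite /mid addrC. Qed.

Lemma half2 : (2^-1)%:C%C + (2^-1)%:C%C = 1 :> C.
Proof. by rewrite -rmorphD -[RHS](rmorph1 (real_complex R)); congr (_%:C%C); field. Qed.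

Lemma mid_subl p q : mid p q - p = (2^-1)%:C%C * (q - p).
Proof.
have -> : mid p q - p = mid p q - ((2^-1)%:C%C + (2^-1)%:C%C) * p by rewrite half2 mul1r.
by rewrite /mid; ring.
Qed.

Lemma seg_int_mid f p q : (exists G, seg_prim f p q G) ->
  seg_int f p q = seg_int f p (mid p q) + seg_int f (mid p q) q.
Proof.
move=> [G HG]; rewrite (seg_intE HG).
have mE := mid_subl p q; have mE' := mid_subl q p.
rewrite (@seg_intE _ _ _ (fun t => G (2^-1 * t + 0))); last first.
  move=> t ht.
  have := HG (2^-1 * t + 0) ltac:(case/andP: ht => *; apply/andP; split; lra).
  move=> /cderiv_rescale; congr (cderiv _ _ _).
  rewrite mulrA /on_seg mE; congr (_ * f (_ + _)).
  by rewrite addr0 rmorphM /=; ring.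
rewrite (@seg_intE _ _ _ (fun t => G (2^-1 * t + 2^-1))); last first.
  move=> t ht.
  have := HG (2^-1 * t + 2^-1) ltac:(case/andP: ht => *; apply/andP; split; lra).
  move=> /cderiv_rescale; congr (cderiv _ _ _).
  rewrite midC in mE'; rewrite mulrA /on_seg.
  have -> : q - mid p q = (2^-1)%:C%C * (q - p) by rewrite -opprB mE'; ring.
  congr (_ * f _); rewrite rmorphD rmorphM /=.
  have -> : mid p q = p + (2^-1)%:C%C * (q - p) by rewrite -mE; ring.
  ring.
have -> : 2^-1 * 1 + 2^-1 = 1 :> R by field.
rewrite !mulr0 !mulr1 !addr0 !add0r; ring.
Qed.

Definition quad c0 c1 z0 z : C :=
  c0 * z + (2^-1)%:C%C * c1 * ((z - z0) * (z - z0)).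

(* The quadratic [c0 z + c1 (z - z0)^2 / 2] is a primitive of the affine part,
   so only the deviation of [f] from it contributes. *)
Lemma seg_int_affine f p q c0 c1 z0 (M : R) : (exists G, seg_prim f p q G) ->
  (forall t, 0 <= t <= 1 ->
     cabs (f (on_seg p q t) - (c0 + c1 * (on_seg p q t - z0))) <= M) ->
  cabs (seg_int f p q - (quad c0 c1 z0 q - quad c0 c1 z0 p)) <= cabs (q - p) * M.
Proof.
move=> [G HG] fM; pose A := quad c0 c1 z0; rewrite -!/(A _) (seg_intE HG).
have E0 : on_seg p q 0 = p by rewrite /on_seg mul0r addr0.
have E1 : on_seg p q 1 = q by rewrite /on_seg mul1r subrKC.
have -> : G 1 - G 0 - (A q - A p) = (G 1 - A (on_seg p q 1)) - (G 0 - A (on_seg p q 0)).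
  by rewrite E0 E1; ring.
have := @cderiv_bound _ (fun t => G t - A (on_seg p q t)) (cabs (q - p) * M) 0 1 ler01.
rewrite subr0 mulr1; apply => t ht.
have dl : cderiv (on_seg p q) t (q - p) by exact: cderiv_affine.
have dlz : cderiv (fun t => on_seg p q t - z0) t (q - p).
  by have := cderivB dl (cderiv_cst z0 t); rewrite subr0.
have dA := cderivD (cderivZ c0 dl) (cderivZ ((2^-1)%:C%C * c1) (cderivM dlz dlz)).
exists ((q - p) * (f (on_seg p q t) - (c0 + c1 * (on_seg p q t - z0)))).
  have := cderivB (HG t ht) dA; congr (cderiv _ _ _).
  set l := on_seg p q t.
  have -> : (2^-1)%:C%C * c1 * ((q - p) * (l - z0) + (l - z0) * (q - p)) =
    ((2^-1)%:C%C + (2^-1)%:C%C) * (c1 * (l - z0) * (q - p)) by ring.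
  by rewrite half2; ring.
by rewrite cabsM ler_wpM2l ?cabs_ge0 ?fM.
Qed.

Definition tri f p q s : C := seg_int f p q + seg_int f q s + seg_int f s p.

Section OnDisc.
Variables (f : C -> C) (y : C) (r : R).
Let K z := cabs (z - y) <= r.
Hypothesis f_hol : forall z, K z -> exists d, hderiv f z d.

Lemma disc_convex p q t : K p -> K q -> 0 <= t <= 1 -> K (on_seg p q t).
Proof.
rewrite /K => Kp Kq /andP[t0 t1].
have -> : on_seg p q t - y = (1 - t)%:C%C * (p - y) + t%:C%C * (q - y).
  by rewrite /on_seg rmorphB rmorph1; ring.
apply: le_trans (cabsD _ _) _; rewrite !cabsM !cabs_real !ger0_norm ?subr_ge0 //.
have := ler_wpM2l t0 Kq; have : (1 - t) * cabs (p - y) <= (1 - t) * r.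
  by rewrite ler_wpM2l ?subr_ge0.
lra.
Qed.

Lemma on_seg_mid p q : on_seg p q 2^-1 = mid p q.
Proof. by rewrite /on_seg -mid_subl subrKC. Qed.

Lemma disc_mid p q : K p -> K q -> K (mid p q).
Proof.
move=> Kp Kq; rewrite -on_seg_mid; apply: disc_convex => //.
by apply/andP; split; lra.
Qed.

Lemma disc_prim p q : K p -> K q -> exists G, seg_prim f p q G.
Proof.
move=> Kp Kq; apply: seg_prim_ex => t ht.
by have [d] := f_hol (disc_convex Kp Kq ht); exact: hderiv_cont.
Qed.

Lemma tri_split p q s : K p -> K q -> K s ->
  tri f p q s = tri f p (mid p q) (mid s p) + tri f (mid p q) q (mid q s)
    + tri f (mid s p) (mid q s) s + tri f (mid q s) (mid s p) (mid p q).
Proof.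
move=> Kp Kq Ks; rewrite /tri.
rewrite (seg_int_mid (disc_prim Kp Kq)) (seg_int_mid (disc_prim Kq Ks)).
rewrite (seg_int_mid (disc_prim Ks Kp)).
have K1 := disc_mid Kp Kq; have K2 := disc_mid Kq Ks; have K3 := disc_mid Ks Kp.
rewrite (seg_int_rev (disc_prim K1 K3)) (seg_int_rev (disc_prim K3 K2)).
rewrite (seg_int_rev (disc_prim K2 K1)); ring.
Qed.

(** The threshold scales like an area: halving the sides divides it by four, so one of the four
    pieces of a bad triangle is bad for D / 2. *)
Let bad (e D : R) (T : C * C * C) :=
  [/\ [/\ K T.1.1, K T.1.2 & K T.2],
      [/\ cabs (T.1.2 - T.1.1) <= D, cabs (T.2 - T.1.2) <= D & cabs (T.1.1 - T.2) <= D] &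
      e * (D * D) < cabs (tri f T.1.1 T.1.2 T.2)].

Lemma mid_subr p q : q - mid p q = (2^-1)%:C%C * (q - p).
Proof. by rewrite midC -opprB mid_subl; ring. Qed.

Lemma mid_mid p q s : mid p q - mid q s = (2^-1)%:C%C * (p - s).
Proof. by rewrite /mid; ring. Qed.

Lemma cabs_half z (D : R) : cabs z <= D -> cabs ((2^-1)%:C%C * z) <= D / 2.
Proof. by move=> zD; rewrite cabsM cabs_real ger0_norm // mulrC ler_pM2r. Qed.

Lemma bad_step e D T : 0 <= D -> bad e D T ->
  exists T', bad e (D / 2) T' /\ cabs (T'.1.1 - T.1.1) <= D.
Proof.
move=> D0; case: T => [[p q] s] [[/= Kp Kq Ks] [pq qs sp] H].
have K1 := disc_mid Kp Kq; have K2 := disc_mid Kq Ks; have K3 := disc_mid Ks Kp.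
have dpq := cabs_half pq; have dqs := cabs_half qs; have dsp := cabs_half sp.
have E : e * (D / 2 * (D / 2)) = e * (D * D) / 4 by field.
have tE := tri_split Kp Kq Ks.
have [T1|T1] := ltP (e * (D / 2 * (D / 2))) (cabs (tri f p (mid p q) (mid s p))).
  exists (p, mid p q, mid s p); split; last by rewrite /= subrr normc0.
  by split=> //=; rewrite mid_subl mid_mid mid_subr.
have [T2|T2] := ltP (e * (D / 2 * (D / 2))) (cabs (tri f (mid p q) q (mid q s))).
  exists (mid p q, q, mid q s); split; last by rewrite /= mid_subl; lra.
  by split=> //=; rewrite mid_subl mid_mid mid_subr.
have [T3|T3] := ltP (e * (D / 2 * (D / 2))) (cabs (tri f (mid s p) (mid q s) s)).
  exists (mid s p, mid q s, s); split; last by rewrite /= cabsC mid_subr; lra.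
  by split=> //=; rewrite mid_subl mid_mid mid_subr.
have [T4|T4] := ltP (e * (D / 2 * (D / 2))) (cabs (tri f (mid q s) (mid s p) (mid p q))).
  exists (mid q s, mid s p, mid p q); split => /=; last first.
    apply: le_trans (cabs_tri (mid p q) _ _) _; rewrite cabsC mid_mid mid_subl; lra.
  by split=> //=; rewrite cabsC mid_mid (cabsC (mid p q)) mid_mid (cabsC (mid q s)) mid_mid.
have := cabsD (tri f p (mid p q) (mid s p) + tri f (mid p q) q (mid q s)
    + tri f (mid s p) (mid q s) s) (tri f (mid q s) (mid s p) (mid p q)).
have := cabsD (tri f p (mid p q) (mid s p) + tri f (mid p q) q (mid q s))
    (tri f (mid s p) (mid q s) s).
have := cabsD (tri f p (mid p q) (mid s p)) (tri f (mid p q) q (mid q s)).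
move: H T1 T2 T3 T4; rewrite -tE E; lra.
Qed.

(* Near a point where [f] is within [e |z - c|] of an affine function, the
   affine part integrates to zero over a triangle. *)
Lemma tri_affine c c1 d e D p q s : K p -> K q -> K s -> 0 <= e ->
  (forall w, cabs w < d -> cabs (f (c + w) - f c - w * c1) <= e * cabs w) ->
  cabs (p - c) < d -> cabs (q - c) < d -> cabs (s - c) < d ->
  cabs (p - c) <= 5 * D -> cabs (q - c) <= 5 * D -> cabs (s - c) <= 5 * D ->
  cabs (q - p) <= D -> cabs (s - q) <= D -> cabs (p - s) <= D ->
  cabs (tri f p q s) <= 15 * e * (D * D).
Proof.
move=> Kp Kq Ks e0 H pd qd sd pD qD sD pq qs sp.
have side u v : K u -> K v -> cabs (u - c) < d -> cabs (v - c) < d ->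
    cabs (u - c) <= 5 * D -> cabs (v - c) <= 5 * D -> cabs (v - u) <= D ->
    cabs (seg_int f u v - (quad (f c) c1 c v - quad (f c) c1 c u)) <= 5 * e * (D * D).
  move=> Ku Kv ud vd uD vD uv.
  have D0 : 0 <= D by have := cabs_ge0 (v - u); lra.
  have := @seg_int_affine f u v (f c) c1 c (e * (5 * D)) (disc_prim Ku Kv) _ .
  move=> Hs; apply: le_trans (Hs _) _; last first.
    have := ler_wpM2r (mulr_ge0 e0 (mulr_ge0 (ler0n _ 5) D0)) uv; lra.
  move=> t /andP[t0 t1].
  have lE : on_seg u v t - c = (1 - t)%:C%C * (u - c) + t%:C%C * (v - c).
    by rewrite /on_seg rmorphB rmorph1; ring.
  have lb M : cabs (u - c) <= M -> cabs (v - c) <= M -> cabs (on_seg u v t - c) <= M.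
    move=> uM vM; rewrite lE.
    apply: le_trans (cabsD _ _) _; rewrite !cabsM !cabs_real !ger0_norm ?subr_ge0 //.
    have := ler_wpM2l t0 vM; have : (1 - t) * cabs (u - c) <= (1 - t) * M.
      by rewrite ler_wpM2l ?subr_ge0.
    lra.
  have := H (on_seg u v t - c); rewrite subrKC.
  have -> : f (on_seg u v t) - f c - (on_seg u v t - c) * c1 =
    f (on_seg u v t) - (f c + c1 * (on_seg u v t - c)) by ring.
  move=> {}H; apply: le_trans (H _) _; last by rewrite ler_wpM2l // lb.
  apply: le_lt_trans (lb (Num.max (cabs (u - c)) (cabs (v - c))) _ _) _.
  - by rewrite le_max lexx.
  - by rewrite le_max lexx orbT.
  - by rewrite gt_max ud.
have h1 := side p q Kp Kq pd qd pD qD pq.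
have h2 := side q s Kq Ks qd sd qD sD qs.
have h3 := side s p Ks Kp sd pd sD pD sp.
rewrite /tri; set x := (seg_int f p q - _) in h1; set x2 := (seg_int f q s - _) in h2.
set x3 := (seg_int f s p - _) in h3.
have -> : seg_int f p q + seg_int f q s + seg_int f s p = x + x2 + x3.
  by rewrite /x /x2 /x3; ring.
apply: le_trans (cabsD _ _) _; have := cabsD x x2; lra.
Qed.

Lemma goursat p q s : K p -> K q -> K s -> tri f p q s = 0.
Proof.
move=> Kp Kq Ks; apply/eqP; rewrite -cabs_eq0; apply/negPn/negP => T0.
have {}T0 : 0 < cabs (tri f p q s) by rewrite lt_def T0 cabs_ge0.
pose D := 1 + cabs (q - p) + cabs (s - q) + cabs (p - s).
have D1 : 1 <= D by rewrite /D -!addrA lerDl !addr_ge0 ?cabs_ge0.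
pose e := cabs (tri f p q s) / (2 * (D * D)).
have DD : 0 < D * D by rewrite mulr_gt0 //; lra.
have e0 : 0 < e by rewrite divr_gt0 // mulr_gt0.
have b0 : bad e (D / 2 ^+ 0) (p, q, s).
  split=> //=; rewrite expr0 divr1 /D.
    have := cabs_ge0 (q - p); have := cabs_ge0 (s - q); have := cabs_ge0 (p - s).
    by split; lra.
  have -> : e * (D * D) = cabs (tri f p q s) / 2.
    by rewrite /e; field; rewrite gt_eqF //; lra.
  lra.
pose P (n : nat) (T T' : C * C * C) := bad e (D / 2 ^+ n.+1) T' /\ cabs (T'.1.1 - T.1.1) <= D / 2 ^+ n.
pose u := fix u n := if n is m.+1 then xget (u m) (P m (u m)) else (p, q, s).
have DS n : D / 2 ^+ n.+1 = D / 2 ^+ n / 2 by rewrite exprS; field.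
have Dn n : 0 <= D / 2 ^+ n by rewrite divr_ge0 ?exprn_ge0 //; lra.
have ub n : bad e (D / 2 ^+ n) (u n).
  elim: n => [//|n IH]; have [T' HT'] := bad_step (Dn n) IH; rewrite -DS in HT'.
  by have [] : P n (u n) (u n.+1) by apply: xgetPex; exists T'.
have us n : P n (u n) (u n.+1).
  have [T' HT'] := bad_step (Dn n) (ub n); rewrite -DS in HT'.
  by apply: xgetPex; exists T'.
have [|c Hc] := @geom_cvg _ (fun n => (u n).1.1) D _ (fun n => (us n).2); first lra.
have Kc : K c.
  rewrite /K; apply/ler_addgt0Pl => eta eta0.
  have [n Hn] := small_pow (4 * D) eta0.
  have [[Kn _ _] _ _] := ub n; rewrite /K in Kn.
  have := cabs_tri (u n).1.1 c y; have := Hc n; lra.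
have [d' dc] := f_hol Kc.
(* The first vertices lie within 4 Dm of [c] by [geom_cvg] and the sides are at most Dm, so all
   vertices are within 5 Dm, and [tri_affine] yields 15/16 of the threshold in [bad]. *)
have [rho rho0 Hr] := dc (e / 16) ltac:(by rewrite divr_gt0).
have [n Hn] := small_pow (4 * D + D) rho0.
case: (u n) (Hc n) (ub n) => [[a b] g] /= ca [[Ka Kb Kg] [ab bg ga] Hlt].
set Dm := D / 2 ^+ n in ca ab bg ga Hlt *.
rewrite /= in Ka Kb Kg ab bg ga Hlt.
have Hn' : 5 * Dm < rho by rewrite /Dm; lra.
have ca' : cabs (a - c) <= 4 * Dm by rewrite cabsC /Dm; lra.
have D0 : 0 <= Dm := Dn n.
have cb' : cabs (b - c) <= 5 * Dm by have := cabs_tri a b c; lra.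
have cg' : cabs (g - c) <= 5 * Dm by have := cabs_tri a g c; rewrite cabsC in ga; lra.
have e16 : 0 <= e / 16 by rewrite divr_ge0 // ltW.
have ar : cabs (a - c) < rho by lra.
have br : cabs (b - c) < rho by lra.
have gr : cabs (g - c) < rho by lra.
have ca5 : cabs (a - c) <= 5 * Dm by lra.
have := tri_affine Ka Kb Kg e16 Hr ar br gr ca5 cb' cg' ab bg ga.
have := mulr_ge0 (ltW e0) (mulr_ge0 D0 D0).
move: Hlt; lra.
Qed.

End OnDisc.

(* By Goursat, the integral from the centre is a primitive. *)
Lemma disc_primitive f y (r : R) : (forall z, cabs (z - y) < r -> exists d, hderiv f z d) ->
  exists G, forall z, cabs (z - y) < r -> hderiv G z (f z).
Proof.
move=> fh; exists (seg_int f y) => z zr e e0.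
have [d fd] := fh z zr; have [d1 d10 H1] := hderiv_cont fd e0.
(* [goursat] works on closed discs; this radius lies strictly between |z - y| and [r]. *)
pose r' := (cabs (z - y) + r) / 2.
have fh' u : cabs (u - y) <= r' -> exists d, hderiv f u d.
  by move=> ur; apply: fh; rewrite /r' in ur; lra.
exists (Num.min d1 (r' - cabs (z - y))); first by rewrite lt_min d10 /r' /=; lra.
move=> w; rewrite lt_min => /andP[wd1 wr].
have Kz : cabs (z - y) <= r' by rewrite /r'; lra.
have Ky : cabs (y - y) <= r' by have := cabs_ge0 (z - y); rewrite subrr normc0 /r'; lra.
have Kw : cabs (z + w - y) <= r'.
  by have := cabsD (z - y) w; rewrite addrAC; lra.
have := goursat fh' Ky Kz Kw; rewrite /tri (seg_int_rev (disc_prim fh' Ky Kw)).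
move=> /eqP; rewrite subr_eq0 => /eqP E.
have -> : seg_int f y (z + w) - seg_int f y z = seg_int f z (z + w) by rewrite -E; ring.
have -> : w * f z = quad (f z) 0 z (z + w) - quad (f z) 0 z z by rewrite /quad; ring.
have -> : e * cabs w = cabs (z + w - z) * e by rewrite [z + w]addrC addrK mulrC.
apply: seg_int_affine; first exact: (disc_prim fh' Kz Kw).
move=> t /andP[t0 t1]; rewrite mul0r addr0 ltW //.
have -> : on_seg z (z + w) t = z + t%:C%C * w by rewrite /on_seg; ring.
apply: H1; rewrite cabsM cabs_real ger0_norm //; apply: le_lt_trans wd1.
by rewrite ler_piMl // cabs_ge0.
Qed.

End Goursat.

(** * Flow boxes and solutions *)

Section FlowBox.
Variable R : realType.
Local Notation C := (R[i]).
Implicit Types (z w y : C) (t h e r : R) (f F G g : C -> C).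

Lemma hderiv_inv f z v : f z != 0 -> hderiv f z v ->
  hderiv (fun u => (f u)^-1) z (- v / (f z * f z)).
Proof.
move=> fz0 Hf e e0; set A := f z; have A0 : 0 < cabs A by rewrite cabs_gt0.
pose a := cabs A; pose d := cabs v; have d0 : 0 <= d := cabs_ge0 v.
(* With [rho] the remainder of [f], the remainder of 1/f is (- A rho + w v (w v + rho)) / (A A B).
   The constants make each term of the numerator at most (e a^3 / 4) |w|, while |B| > a / 2. *)
pose e1 := Num.min 1 (e * (a * a) / 4).
have e10 : 0 < e1 by rewrite lt_min ltr01 divr_gt0 ?mulr_gt0.
have e11 : e1 <= 1 by rewrite ge_min lexx.
have e1e : e1 <= e * (a * a) / 4 by rewrite ge_min lexx orbT.
have [r1 r10 H1] := Hf _ e10.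
have [r2 r20 H2] := hderiv_cont Hf (divr_gt0 A0 (ltr0n _ 2) : 0 < a / 2).
pose k := d * (d + 1) + 1; have k0 : 0 < k by rewrite /k ltr_wpDl // mulr_ge0 //; lra.
pose r3 := e * (a * a * a) / (4 * k).
have r30 : 0 < r3 by rewrite divr_gt0 ?mulr_gt0.
exists (Num.min r1 (Num.min r2 r3)); first by rewrite !lt_min r10 r20.
move=> w; rewrite !lt_min => /and3P[/H1 h1 /H2 h2 h3].
set B := f (z + w) in h1 h2 *; rewrite -/A in h1 h2.
have aB : a / 2 < cabs B by have := cabs_dist A (A - B); rewrite subKr cabsC /a; move: h2; rewrite /a; lra.
have B0 : B != 0 by rewrite -cabs_gt0; apply: lt_trans aB; rewrite divr_gt0.
pose rho := B - A - w * v.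
have -> : B^-1 - A^-1 - w * (- v / (A * A)) =
  (- (A * rho) + w * v * (w * v + rho)) / (A * A * B).
  by rewrite /rho; field; rewrite B0 fz0.
rewrite cabsM cabsV ler_pdivrMr; last by rewrite !cabsM !mulr_gt0 // cabs_gt0.
apply: le_trans (cabsD _ _) _; rewrite cabsN !cabsM -/a -/d.
have h4 : cabs (w * v + rho) <= cabs w * (d + 1).
  apply: le_trans (cabsD _ _) _; rewrite cabsM -/d.
  have : e1 * cabs w <= 1 * cabs w by rewrite ler_wpM2r ?cabs_ge0.
  move: h1; rewrite -/rho; lra.
have h5 : a * cabs rho <= e * (a * a * a) / 4 * cabs w.
  have : a * cabs rho <= a * (e * (a * a) / 4 * cabs w).
    rewrite ler_wpM2l ?(ltW A0) //; apply: le_trans h1 _.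
    by rewrite ler_wpM2r ?cabs_ge0.
  lra.
have h6 : cabs w * d * cabs (w * v + rho) <= e * (a * a * a) / 4 * cabs w.
  have wd0 : 0 <= cabs w * d by rewrite mulr_ge0 ?cabs_ge0.
  apply: le_trans (ler_wpM2l wd0 h4) _.
  have -> : cabs w * d * (cabs w * (d + 1)) = (cabs w * (d * (d + 1))) * cabs w by ring.
  rewrite ler_wpM2r ?cabs_ge0 //.
  have : cabs w * (d * (d + 1)) <= cabs w * k by rewrite ler_wpM2l ?cabs_ge0 // /k; lra.
  move: h3; rewrite /r3 ltr_pdivlMr ?mulr_gt0 //; lra.
have a0 : 0 < a := A0.
have : e * cabs w * (a * a * (a / 2)) <= e * cabs w * (a * a * cabs B).
  rewrite ler_wpM2l ?mulr_ge0 ?cabs_ge0 ?(ltW e0) // ler_wpM2l ?mulr_ge0 ?(ltW a0) //; exact: ltW.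
lra.
Qed.

(** [G] is the time coordinate around the regular point [y]: in it [F] becomes the constant field 1
    and [sc w F] the constant field [w]. [box_lip] keeps [G] within a relative error one half of the
    linear map with slope 1/F(y), hence bi-Lipschitz. *)
Record flow_box F y r G g : Prop := FlowBox {
  box_pos : 0 < r;
  box_y : F y != 0;
  box_neq0 : forall z, cabs (z - y) < r -> F z != 0;
  box_G0 : G y = 0;
  box_dG : forall z, cabs (z - y) < r -> hderiv G z (F z)^-1;
  box_lip : forall z z', cabs (z - y) < r -> cabs (z' - y) < r ->
    cabs (G z - G z' - (z - z') / F y) <= cabs (z - z') / (2 * cabs (F y));
  box_g : forall w, cabs w < r / (4 * cabs (F y)) ->
    cabs (g w - y) < r /\ G (g w) = w }.

(** The last hypothesis amounts to |1/F(z) - 1/F(y)| <= 1/(2 |F(y)|); integrated along segments it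
    becomes [box_lip]. *)
Lemma flow_box_ex F y r : 0 < r -> F y != 0 ->
  (forall z, cabs (z - y) < r -> exists d, hderiv F z d) ->
  (forall z, cabs (z - y) < r -> cabs (F z - F y) <= cabs (F z) / 2) ->
  exists G g, flow_box F y r G g.
Proof.
move=> r0 y0 Fh FF; have Fy0 : 0 < cabs (F y) by rewrite cabs_gt0.
have Fz0 z : cabs (z - y) < r -> F z != 0.
  move=> /FF; case: eqVneq => // ->; rewrite normc0 mul0r sub0r cabsN; lra.
have [|G0 HG0] := @disc_primitive _ (fun z => (F z)^-1) y r.
  move=> z zr; have [d Hd] := Fh z zr.
  by exists (- d / (F z * F z)); apply: hderiv_inv => //; exact: Fz0.
pose G z := G0 z - G0 y.
have dG z : cabs (z - y) < r -> hderiv G z (F z)^-1.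
  move=> /HG0 H e /H[d d0 Hd]; exists d => // w /Hd; congr (cabs _ <= _).
  by rewrite /G; ring.
have y_in : cabs (y - y) < r by rewrite subrr normc0.
have lip z z' : cabs (z - y) < r -> cabs (z' - y) < r ->
    cabs (G z - G z' - (z - z') / F y) <= cabs (z - z') / (2 * cabs (F y)).
  move=> zr z'r.
  pose v t := G (on_seg z' z t) - (F y)^-1 * on_seg z' z t.
  have E0 : on_seg z' z 0 = z' by rewrite /on_seg mul0r addr0.
  have E1 : on_seg z' z 1 = z by rewrite /on_seg mul1r subrKC.
  have -> : G z - G z' - (z - z') / F y = v 1 - v 0 by rewrite /v E0 E1; ring.
  have := @cderiv_bound _ v (cabs (z - z') / (2 * cabs (F y))) 0 1 ler01.
  rewrite subr0 mulr1; apply => t ht.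
  have lr : cabs (on_seg z' z t - y) < r.
    pose m := Num.max (cabs (z' - y)) (cabs (z - y)).
    apply: (@le_lt_trans _ _ m); last by rewrite gt_max zr z'r.
    by apply: disc_convex => //; rewrite le_max lexx ?orbT.
  have dl : cderiv (on_seg z' z) t (z - z') by exact: cderiv_affine.
  eexists; first exact: (cderivB (cderiv_comp dl (dG _ lr)) (cderivZ (F y)^-1 dl)).
  rewrite (mulrC (F y)^-1) -mulrBr cabsM ler_wpM2l ?cabs_ge0 //.
  have l0 := Fz0 _ lr; set l := on_seg z' z t in lr l0 *.
  have -> : (F l)^-1 - (F y)^-1 = (F y - F l) / (F l * F y) by field; rewrite y0 l0.
  rewrite cabsM cabsV cabsC ler_pdivrMr ?cabs_gt0 ?mulf_neq0 // cabsM.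
  by apply: le_trans (FF _ lr) _; rewrite le_eqVlt; apply/orP; left; apply/eqP; field; rewrite gt_eqF.
have surj w : cabs w < r / (4 * cabs (F y)) -> exists z, cabs (z - y) < r /\ G z = w.
  rewrite ltr_pdivlMr ?mulr_gt0 // => wr.
  pose e := cabs w * cabs (F y); have e0 : 0 <= e by rewrite mulr_ge0 ?cabs_ge0.
  (* Newton's iteration with the derivative frozen at [y]: by [box_lip] the step bounds halve each
     time. The first step has length [e], so the limit is within 4 e < r of [y], whence the factor 4
     in the radius. *)
  pose u n := iter n (fun z => z - (G z - w) * F y) y.
  have uS n : u n.+1 = u n - (G (u n) - w) * F y by [].
  have H n : cabs (u n - y) <= 2 * e - 2 * e / 2 ^+ n /\ cabs (u n.+1 - u n) <= e / 2 ^+ n.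
    elim: n => [|n [IH1 IH2]].
      rewrite subrr normc0 expr0 !divr1 subrr uS /= /G subrr sub0r.
      have -> : y - - w * F y - y = w * F y by ring.
      by rewrite cabsM.
    have E : e / 2 ^+ n.+1 = e / 2 ^+ n / 2 by rewrite exprS; field.
    have E2 : 2 * e / 2 ^+ n.+1 = e / 2 ^+ n by rewrite exprS; field.
    have E3 : 2 * e / 2 ^+ n = 2 * (e / 2 ^+ n) by field.
    have p0 : 0 <= e / 2 ^+ n by rewrite divr_ge0 ?exprn_ge0.
    have b1 : cabs (u n.+1 - y) <= 2 * e - e / 2 ^+ n.
      have := cabs_tri (u n) (u n.+1) y; lra.
    split; first by rewrite E2.
    have rn : cabs (u n - y) < r by rewrite /e in IH1 p0 E3 *; lra.
    have rn1 : cabs (u n.+1 - y) < r by rewrite /e in b1 p0 *; lra.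
    have Hl := lip _ _ rn1 rn.
    have EG : G (u n) - w = - ((u n.+1 - u n) / F y) by rewrite uS; field.
    have -> : u n.+2 - u n.+1 = - ((G (u n.+1) - G (u n) - (u n.+1 - u n) / F y) * F y).
      rewrite [u n.+2]uS; set x := (_ / F y) in EG *.
      have -> : G (u n.+1) - w = G (u n.+1) - G (u n) + (G (u n) - w) by ring.
      by rewrite EG; ring.
    rewrite cabsN cabsM E.
    have := ler_wpM2r (ltW Fy0) Hl.
    have -> : cabs (u n.+1 - u n) / (2 * cabs (F y)) * cabs (F y) = cabs (u n.+1 - u n) / 2.
      by field; rewrite gt_eqF.
    lra.
  have [l Hl] := geom_cvg e0 (fun n => (H n).2).
  have lr : cabs (l - y) < r by have := Hl 0%N; rewrite expr0 divr1 /e /=; lra.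
  exists l; split => //; apply: cabs_small_eq => eps eps0.
  have [n Hn] := small_pow (8 * e / cabs (F y)) eps0.
  have p0 : 0 <= e / 2 ^+ n by rewrite divr_ge0 ?exprn_ge0.
  have rn : cabs (u n - y) < r.
    have [h1 _] := H n; have E3 : 2 * e / 2 ^+ n = 2 * (e / 2 ^+ n) by field.
    by rewrite /e in h1 p0 E3 *; lra.
  have := lip _ _ lr rn => h1.
  have -> : G l - w = (G l - G (u n) - (l - u n) / F y) + (l - u n) / F y - (u n.+1 - u n) / F y.
    by rewrite uS; field.
  apply: le_trans (cabsB _ _) _; apply: le_trans (lerD (cabsD _ _) (lexx _)) _.
  rewrite !cabsM !cabsV.
  have h2 := Hl n; have [_ h3] := H n.
  have i0 : 0 < (cabs (F y))^-1 by rewrite invr_gt0.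
  have h1' : cabs (G l - G (u n) - (l - u n) / F y) <= 2 * (e / 2 ^+ n) / cabs (F y).
    apply: le_trans h1 _.
    have -> : cabs (l - u n) / (2 * cabs (F y)) = cabs (l - u n) / 2 / cabs (F y).
      by field; rewrite gt_eqF.
    rewrite ler_wpM2r ?(ltW i0) //.
    have E3 : 4 * e / 2 ^+ n = 4 * (e / 2 ^+ n) by field.
    lra.
  have h2' : cabs (l - u n) / cabs (F y) <= 4 * (e / 2 ^+ n) / cabs (F y).
    by rewrite ler_wpM2r ?(ltW i0) // mulrA.
  have h3' : cabs (u n.+1 - u n) / cabs (F y) <= (e / 2 ^+ n) / cabs (F y).
    by rewrite ler_wpM2r ?(ltW i0).
  have E4 : 8 * e / cabs (F y) / 2 ^+ n = 8 * ((e / 2 ^+ n) / cabs (F y)).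
    by ring.
  have : 0 <= e / 2 ^+ n / cabs (F y) by rewrite divr_ge0 ?cabs_ge0.
  lra.
exists G, (fun w => xget y [set z | cabs (z - y) < r /\ G z = w]).
split => //; first by rewrite /G subrr.
by move=> w /surj; exact: xgetPex.
Qed.

Section BoxTheory.
Variables (F G g : C -> C) (y : C) (r : R).
Hypothesis B : flow_box F y r G g.
Let rho := r / (4 * cabs (F y)).

Lemma box_Fy_gt0 : 0 < cabs (F y).
Proof. by rewrite cabs_gt0 (box_y B). Qed.

Lemma box_rho_gt0 : 0 < rho.
Proof. by rewrite divr_gt0 ?(box_pos B) // mulr_gt0 ?box_Fy_gt0. Qed.

Lemma box_G_lower z z' : cabs (z - y) < r -> cabs (z' - y) < r ->
  cabs (z - z') <= 2 * cabs (F y) * cabs (G z - G z').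
Proof.
move=> zr zr'; have := box_lip B zr zr'; have y0 := box_Fy_gt0 => H.
have := cabs_dist ((z - z') / F y) ((z - z') / F y - (G z - G z')).
rewrite subKr [in X in _ - X <= _]cabsC cabsM cabsV => H2.
have E : cabs (z - z') / (2 * cabs (F y)) = cabs (z - z') / cabs (F y) / 2.
  by field; rewrite gt_eqF.
have : cabs (z - z') / cabs (F y) <= 2 * cabs (G z - G z') by lra.
by rewrite ler_pdivrMr //; lra.
Qed.

Lemma box_G_upper z z' : cabs (z - y) < r -> cabs (z' - y) < r ->
  cabs (G z - G z') <= 2 * cabs (z - z') / cabs (F y).
Proof.
move=> zr zr'; have := box_lip B zr zr'; have y0 := box_Fy_gt0 => H.
have := cabsD (G z - G z' - (z - z') / F y) ((z - z') / F y).
rewrite subrK cabsM cabsV.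
have E : cabs (z - z') / (2 * cabs (F y)) = cabs (z - z') / cabs (F y) / 2.
  by field; rewrite gt_eqF.
have := divr_ge0 (cabs_ge0 (z - z')) (cabs_ge0 (F y)); lra.
Qed.

Lemma box_y_in : cabs (y - y) < r.
Proof. by rewrite subrr normc0 (box_pos B). Qed.

Lemma box_gG z : cabs (z - y) < r -> cabs (G z) < rho -> g (G z) = z.
Proof.
move=> zr /(box_g B)[gr gE]; apply/eqP; rewrite -subr_eq0 -cabs_eq0.
apply/eqP/le_anti; rewrite cabs_ge0 andbT.
by apply: le_trans (box_G_lower gr zr) _; rewrite gE subrr normc0 mulr0.
Qed.

Lemma box_g0 : g 0 = y.
Proof.
by have := box_gG box_y_in; rewrite (box_G0 B) normc0; apply; exact: box_rho_gt0.
Qed.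

Lemma box_g_lip w w' : cabs w < rho -> cabs w' < rho ->
  cabs (g w - g w') <= 2 * cabs (F y) * cabs (w - w').
Proof.
move=> /(box_g B)[gr gE] /(box_g B)[gr' gE'].
by have := box_G_lower gr gr'; rewrite gE gE'.
Qed.

(** [G] stretches by at most 2 / |F(y)|, so the smaller disc lands in the ball of radius r / (4
    |F(y)|) on which [g] inverts [G]. *)
Lemma box_onto z : cabs (z - y) < r / 8 ->
  exists w, [/\ g w = z, cabs w < rho & cabs w <= 2 * cabs (z - y) / cabs (F y)].
Proof.
move=> zr; have r0 := box_pos B; have zr' : cabs (z - y) < r by lra.
have := box_G_upper zr' box_y_in; rewrite (box_G0 B) subr0 => H.
have Gr : cabs (G z) < rho.
  apply: le_lt_trans H _; rewrite /rho invfM mulrA ltr_pM2r ?invr_gt0 ?box_Fy_gt0 //.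
  lra.
by exists (G z); split => //; exact: box_gG.
Qed.

Lemma box_g_neq0 w : cabs w < rho -> F (g w) != 0.
Proof. by move=> /(box_g B)[/(box_neq0 B)]. Qed.

Lemma box_dg w : cabs w < rho -> hderiv g w (F (g w)).
Proof.
move=> wr e e0; have [gr gE] := box_g B wr; have y0 := box_Fy_gt0.
set A := F (g w); have A0 : 0 < cabs A by rewrite cabs_gt0 box_g_neq0.
pose k := 2 * cabs A * cabs (F y).
have k0 : 0 < k by rewrite !mulr_gt0.
have [d d0 Hd] := box_dG B gr (divr_gt0 e0 k0).
exists (Num.min (rho - cabs w) (d / (2 * cabs (F y)))).
  by rewrite lt_min subr_gt0 wr divr_gt0 ?mulr_gt0.
move=> h; rewrite lt_min => /andP[hr]; rewrite ltr_pdivlMr ?mulr_gt0 // => hd.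
have wr' : cabs (w + h) < rho by have := cabsD w h; lra.
have [gr' gE'] := box_g B wr'.
have := box_g_lip wr' wr; rewrite [w + h]addrC addrK [h + w]addrC => gl.
have := Hd (g (w + h) - g w) ltac:(by apply: le_lt_trans gl _; rewrite mulrC).
rewrite subrKC gE gE' -/A => H.
have A0' : A != 0 by rewrite -cabs_gt0.
have -> : g (w + h) - g w - h * A = - ((w + h - w - (g (w + h) - g w) / A) * A).
  by field.
rewrite cabsN cabsM; apply: le_trans (ler_wpM2r (ltW A0) H) _.
have : e / k * cabs (g (w + h) - g w) * cabs A <= e / k * (2 * cabs (F y) * cabs h) * cabs A.
  by rewrite ler_wpM2r ?(ltW A0) // ler_wpM2l // divr_ge0 // ltW.
have -> : e / k * (2 * cabs (F y) * cabs h) * cabs A = e * cabs h.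
  by rewrite /k; field; rewrite !gt_eqF.
exact.
Qed.

Lemma box_sol (phi : R -> C) (c : C) a b : a <= b ->
  (forall t, a <= t <= b -> cabs (phi t - y) < r) ->
  (forall t, a <= t <= b -> cderiv phi t (c * F (phi t))) ->
  G (phi b) = G (phi a) + (b - a)%:C%C * c.
Proof.
move=> ab pr pd.
have := @cderiv0_const _ (fun t => G (phi t) - (0 + t%:C%C * c)) a b ab.
have H t : a <= t <= b -> cderiv (fun t => G (phi t) - (0 + t%:C%C * c)) t 0.
  move=> ht; have := cderivB (cderiv_comp (pd t ht) (box_dG B (pr t ht))) (cderiv_affine 0 c t).
  by rewrite mulfK ?subrr // (box_neq0 B) // pr.
move=> /(_ H) E; rewrite rmorphB /=.
have -> : G (phi b) = (G (phi b) - (0 + b%:C%C * c)) + b%:C%C * c by ring.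
rewrite E; ring.
Qed.

End BoxTheory.

End FlowBox.

(** * Uniqueness of solutions *)

Section ODE.
Variable R : realType.
Local Notation C := (R[i]).
Implicit Types (z w x y : C) (t s h e r : R) (F : C -> C) (phi psi : R -> C) (J : set R).

Definition hol F := forall z, exists d, hderiv F z d.
Definition sc w F : C -> C := fun z => w * F z.

Lemma hderivZ w F z d : hderiv F z d -> hderiv (sc w F) z (w * d).
Proof.
move=> H e e0; pose k := 1 + cabs w; have k0 : 0 < k by rewrite ltr_pwDl ?cabs_ge0.
have [r r0 Hr] := H (e / k) (divr_gt0 e0 k0).
exists r => // h /Hr H1.
have -> : sc w F (z + h) - sc w F z - h * (w * d) = w * (F (z + h) - F z - h * d).
  by rewrite /sc; ring.
rewrite cabsM; apply: le_trans (ler_wpM2l (cabs_ge0 _) H1) _.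
rewrite mulrA ler_wpM2r ?cabs_ge0 // mulrA ler_pdivrMr // mulrC ler_pM2l // /k; lra.
Qed.

Lemma hol_sc w F : hol F -> hol (sc w F).
Proof. by move=> H z; have [d Hd] := H z; exists (w * d); exact: hderivZ. Qed.

Lemma sc_sc w w' F : sc w (sc w' F) = sc (w * w') F.
Proof. by apply/funext => z; rewrite /sc mulrA. Qed.

Lemma sc1 F : sc 1 F = F.
Proof. by apply/funext => z; rewrite /sc mul1r. Qed.

Lemma hol_box F y : hol F -> F y != 0 -> exists r G g, flow_box F y r G g.
Proof.
move=> hF y0; have Fy0 : 0 < cabs (F y) by rewrite cabs_gt0.
(* A deviation below |F(y)| / 3 leaves |F(z)| > 2 |F(y)| / 3, so the deviation is below |F(z)| /
   2. *)
have [d Hd] := hF y; have [r r0 Hr] := hderiv_cont Hd (divr_gt0 Fy0 (ltr0n _ 3)).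
exists r; apply: flow_box_ex => // z zr.
have := Hr _ zr; rewrite subrKC => H.
have := cabs_dist (F y) (F y - F z); rewrite subKr [in X in _ - X <= _]cabsC; lra.
Qed.

Lemma hol_zero F b : hol F -> F b = 0 -> exists K r, [/\ 0 <= K, 0 < r &
  forall z, cabs (z - b) < r -> cabs (F z) <= K * cabs (z - b)].
Proof.
move=> hF b0; have [d Hd] := hF b; have [r r0 Hr] := Hd 1 ltr01.
exists (1 + cabs d), r; split => //; first by rewrite addr_ge0 ?cabs_ge0.
move=> z /Hr; rewrite subrKC b0 subr0 => H.
have := cabsD (F z - (z - b) * d) ((z - b) * d); rewrite subrK cabsM; lra.
Qed.

(* An equilibrium is not left in finite time: only differentiability of [F]
   there is needed. *)
Lemma sol_eq_right F b phi a c : hol F -> F b = 0 -> a < c -> phi a = b ->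
  (forall t, a <= t <= c -> cderiv phi t (F (phi t))) ->
  exists2 e : R, 0 < e & forall t, a <= t < a + e -> t <= c -> phi t = b.
Proof.
move=> hF b0 ac pa pd; have [K [r [K0 r0 Hr]]] := hol_zero hF b0.
have [e e0 He] := cderiv_cont (pd a ltac:(by rewrite lexx ltW)) r0.
exists e => // t /andP[at_ te] tc; apply: cabs_small_eq => eta eta0.
(* The solution starts at [b], but [gronwall] wants a positive [c]; this one turns the bound at [t]
   into [eta]. *)
pose c1 := eta / expR ((K + 1) * (t - a)).
have c10 : 0 < c1 by rewrite divr_gt0 ?expR_gt0.
have := @gronwall _ (fun s => phi s - b) K (K + 1) c1 a t.
move=> /(_ ltac:(by rewrite K0; lra) c10) H.
have {}H := H _ _ _ t.
have -> : eta = c1 * expR ((K + 1) * (t - a)) by rewrite /c1 divfK // gt_eqF ?expR_gt0.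
apply: H; last by rewrite at_ lexx.
- move=> s /andP[as_ st]; have hs : a <= s <= c by rewrite as_ (le_trans st).
  by apply: cderiv_cont; exact: (cderivB (pd s hs) (cderiv_cst b s)).
- by rewrite pa subrr normc0 ltW.
- move=> s /andP[as_ st] _; have hs : a <= s <= c by rewrite as_ ltW // (lt_le_trans st).
  exists (F (phi s) - 0); first exact: (cderivB (pd s hs) (cderiv_cst b s)).
  rewrite subr0; apply: Hr; have := He (s - a); rewrite subrKC pa; apply.
  by rewrite ger0_norm; lra.
Qed.

Lemma sol_rev F phi a t : cderiv phi (a - t) (F (phi (a - t))) ->
  cderiv (fun s => phi (a - s)) t (sc (-1) F (phi (a - t))).
Proof.
have E s : a - s = -1 * s + a by ring.
rewrite {1}E => /cderiv_rescale; rewrite rmorphN rmorph1 /sc.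
by apply: (@cderiv_near _ _ _ _ _ 1) => // h _; rewrite -E.
Qed.

Lemma sol_eq_local F b phi a c t : hol F -> F b = 0 -> a <= t <= c -> phi t = b ->
  (forall s, a <= s <= c -> cderiv phi s (F (phi s))) ->
  exists2 e : R, 0 < e & forall s, a <= s <= c -> `|s - t| < e -> phi s = b.
Proof.
move=> hF b0 /andP[at_ tc] pt pd.
have [e1 e10 H1] : exists2 e : R, 0 < e & forall s, t <= s < t + e -> s <= c -> phi s = b.
  have [tc'|ct] := ltP t c.
    apply: (sol_eq_right hF b0 tc' pt) => s /andP[ts sc_].
    by apply: pd; rewrite (le_trans at_ ts).
  exists 1 => // s /andP[ts _] sc_; have -> : s = t by lra.
  exact: pt.
have [e2 e20 H2] : exists2 e : R, 0 < e & forall s, t - e < s <= t -> a <= s -> phi s = b.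
  have [at'|ta] := ltP a t; last first.
    exists 1 => // s /andP[_ st] as_; have -> : s = t by lra.
    exact: pt.
  have b0' : sc (-1) F b = 0 by rewrite /sc b0 mulr0.
  have := @sol_eq_right _ b (fun s => phi (t - s)) 0 (t - a) (hol_sc (-1) hF) b0'.
  rewrite subr_gt0 at' subr0 => /(_ isT pt)[].
    move=> s /andP[s0 sa]; apply: sol_rev; apply: pd; apply/andP; split; lra.
  move=> e e0 He; exists e => // s /andP[es st] as_.
  by have := He (t - s); rewrite subKr; apply; [apply/andP; split; lra|lra].
exists (Num.min e1 e2); first by rewrite lt_min e10.
move=> s /andP[as_ sc_]; rewrite lt_min => /andP[s1 s2].
have [ts|st] := leP t s.
  by apply: H1 => //; rewrite ts /=; move: s1; rewrite ger0_norm; lra.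
by apply: H2 => //; move: s2; rewrite ltr0_norm; [move=> *; apply/andP; split; lra|lra].
Qed.

(** At an equilibrium both solutions are constant; elsewhere both are the same translation in the
    injective coordinate [G]. *)
Lemma sol_unique_local F phi psi a c t : hol F -> a <= t <= c -> phi t = psi t ->
  (forall s, a <= s <= c -> cderiv phi s (F (phi s))) ->
  (forall s, a <= s <= c -> cderiv psi s (F (psi s))) ->
  exists2 e : R, 0 < e & forall s, a <= s <= c -> `|s - t| < e -> phi s = psi s.
Proof.
move=> hF atc E pd qd; have [F0|F0] := eqVneq (F (phi t)) 0.
  have [e1 e10 H1] := sol_eq_local hF F0 atc (erefl _) pd.
  have [e2 e20 H2] := sol_eq_local hF F0 atc (esym E) qd.
  exists (Num.min e1 e2); first by rewrite lt_min e10.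
  by move=> s hs; rewrite lt_min => /andP[/(H1 s hs) -> /(H2 s hs) ->].
have [r [G [g B]]] := hol_box hF F0.
have [e1 e10 H1] := cderiv_cont (pd t atc) (box_pos B).
have [e2 e20 H2] := cderiv_cont (qd t atc) (box_pos B).
exists (Num.min e1 e2); first by rewrite lt_min e10.
move=> s hs; rewrite lt_min => /andP[s1 s2].
pose m := Num.min s t; pose M := Num.max s t.
have mM : m <= M by rewrite /m /M ge_min le_max lexx.
have hm u : m <= u <= M -> a <= u <= c /\ `|u - t| <= `|s - t|.
  case/andP: atc hs => at_ tc /andP[as_ sc_].
  rewrite /m /M; case: (leP s t) => st /andP[mu uM].
    by rewrite ler0_norm 1?ler0_norm; [split; [apply/andP; split|]| |]; lra.
  by rewrite ger0_norm 1?ger0_norm; [split; [apply/andP; split|]| |]; lra.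
have pr u : m <= u <= M -> cabs (phi u - phi t) < r.
  by case/hm=> _ us; have := H1 (u - t); rewrite subrKC; apply; exact: le_lt_trans us s1.
have qr u : m <= u <= M -> cabs (psi u - phi t) < r.
  by case/hm=> _ us; have := H2 (u - t); rewrite subrKC -E; apply; exact: le_lt_trans us s2.
have pd' u : m <= u <= M -> cderiv phi u (1 * F (phi u)).
  by case/hm=> hu _; rewrite mul1r; exact: pd.
have qd' u : m <= u <= M -> cderiv psi u (1 * F (psi u)).
  by case/hm=> hu _; rewrite mul1r; exact: qd.
have e1' := box_sol B mM pr pd'; have e2' := box_sol B mM qr qd'.
have sM : m <= s <= M by rewrite /m /M ge_min le_max lexx.
have EG : G (phi s) = G (psi s).
  move: e1' e2'; rewrite /m /M; case: (leP s t) => _.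
    by rewrite E => -> /addIr.
  by rewrite E => -> ->.
apply/eqP; rewrite -subr_eq0 -cabs_eq0; apply/eqP/le_anti; rewrite cabs_ge0 andbT.
by apply: le_trans (box_G_lower B (pr s sM) (qr s sM)) _; rewrite EG subrr normc0 mulr0.
Qed.

Lemma sol_unique F phi psi a c t t' : hol F ->
  (forall s, a <= s <= c -> cderiv phi s (F (phi s))) ->
  (forall s, a <= s <= c -> cderiv psi s (F (psi s))) ->
  a <= t <= c -> a <= t' <= c -> phi t = psi t -> phi t' = psi t'.
Proof.
move=> hF pd qd atc atc' E.
have loc u : a <= u <= c -> exists2 d : R, 0 < d &
    forall s, a <= s <= c -> `|s - u| < d -> (phi u = psi u <-> phi s = psi s).
  move=> hu; have [Eu|nEu] := eqVneq (phi u) (psi u).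
    have [e e0 He] := sol_unique_local hF hu Eu pd qd.
    by exists e => // s hs su; split => // _; exact: He.
  have D0 : 0 < cabs (phi u - psi u) / 2 by rewrite divr_gt0 // cabs_gt0 subr_eq0.
  have [d1 d10 H1] := cderiv_cont (pd u hu) D0.
  have [d2 d20 H2] := cderiv_cont (qd u hu) D0.
  exists (Num.min d1 d2); first by rewrite lt_min d10.
  move=> s hs; rewrite lt_min => /andP[/H1 + /H2]; rewrite subrKC => h1 h2.
  split=> [/eqP|Es]; first by rewrite (negPf nEu).
  exfalso; have := cabs_tri (phi s) (phi u) (psi u); rewrite {2}Es.
  rewrite cabsC in h1; lra.
have [tt'|t't] := leP t t'.
  apply: (@loc_const _ (fun u => phi u = psi u) t t' tt' E) => u /andP[tu ut'].
  have hu : a <= u <= c.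
    by case/andP: atc => at_ _; case/andP: atc' => _ tc; rewrite (le_trans at_) // (le_trans ut').
  have [d d0 Hd] := loc u hu; exists d => // s /andP[ts st']; apply: Hd.
  by case/andP: atc => at_ _; case/andP: atc' => _ tc; rewrite (le_trans at_) // (le_trans st').
(* [loc_const] propagates from left to right only; for t' < t it is the negation that is carried
   from t' to t. *)
apply: contrapT => nE.
suff : ~ (phi t = psi t) by [].
apply: (@loc_const _ (fun u => ~ (phi u = psi u)) t' t (ltW t't) nE) => u /andP[tu ut'].
have hu : a <= u <= c.
  by case/andP: atc' => at_ _; case/andP: atc => _ tc; rewrite (le_trans at_) // (le_trans ut').
have [d d0 Hd] := loc u hu; exists d => // s /andP[ts st'] su.
have hs : a <= s <= c.
  by case/andP: atc' => at_ _; case/andP: atc => _ tc; rewrite (le_trans at_) // (le_trans st').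
by have := Hd s hs su; tauto.
Qed.

End ODE.

(** * The maximal flow and its group law *)

Section Flow.
Variable R : realType.
Local Notation C := (R[i]).
Implicit Types (z w x y : C) (t s h e r : R) (F : C -> C) (phi psi : R -> C) (J : set R).

Definition dom F x : set R := max_interval F x.
Definition fl F x t : C := flow F x t.

Lemma open_ball_sub J t : open J -> J t -> exists2 e : R, 0 < e & forall s, `|s - t| < e -> J s.
Proof.
rewrite openE => oJ /oJ; rewrite /interior => /nbhs_ballP[e e0 He].
by exists e => // s st; apply: He; rewrite -ball_normE /= distrC.
Qed.

Lemma ball_sub_open J :
  (forall t, J t -> exists2 e : R, 0 < e & forall s, `|s - t| < e -> J s) -> open J.
Proof.
move=> H; rewrite openE => t /H[e e0 He]; apply/nbhs_ballP; exists e => // s.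
by rewrite -ball_normE /= distrC; exact: He.
Qed.

Lemma is_solutionE F x J phi : is_solution F x J phi <->
  [/\ is_interval J, open J, J 0, phi 0 = x & forall t, J t -> cderiv phi t (F (phi t))].
Proof.
by split=> [[h1 h2 h3 h4 H]|[h1 h2 h3 h4 H]]; split => // t Jt; apply/cderiv_is_derive; exact: H.
Qed.

Lemma is_solution_unique F x J phi J' psi t : hol F ->
  is_solution F x J phi -> is_solution F x J' psi -> J t -> J' t -> phi t = psi t.
Proof.
move=> hF /is_solutionE[iJ _ J0 p0 pd] /is_solutionE[iJ' _ J'0 q0 qd] Jt J't.
pose m := Num.min 0 t; pose M := Num.max 0 t.
have m0 : m <= 0 <= M by rewrite /m /M ge_min le_max lexx.
have mt : m <= t <= M by rewrite /m /M ge_min le_max lexx !orbT.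
have Jm : J m /\ J' m by rewrite /m; case: leP.
have JM : J M /\ J' M by rewrite /M; case: leP.
apply: (sol_unique hF _ _ m0 mt); last by rewrite p0.
- by move=> s hs; apply: pd; apply: (iJ _ _ Jm.1 JM.1).
- by move=> s hs; apply: qd; apply: (iJ' _ _ Jm.2 JM.2).
Qed.

Lemma fl_eq F x J phi t : hol F -> is_solution F x J phi -> J t -> fl F x t = phi t.
Proof.
move=> hF sJ Jt; rewrite /fl /flow; case: xgetP => [y _ [J' [psi [sJ' J't <-]]]|/(_ (phi t))[]].
  exact: is_solution_unique sJ' sJ J't Jt.
by exists J, phi.
Qed.

Lemma dom_sol F x J phi t : is_solution F x J phi -> J t -> dom F x t.
Proof. by move=> sJ Jt; exists J, phi. Qed.

Lemma dom_interval F x : is_interval (dom F x).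
Proof.
move=> s t [J [phi [sJ Js]]] [J' [psi [sJ' J't]]] u /andP[su ut].
have [iJ _ J0 _ _] := sJ; have [iJ' _ J'0 _ _] := sJ'.
have [u0|u0] := leP u 0.
  by exists J, phi; split => //; apply: (iJ s 0) => //; rewrite su.
by exists J', psi; split => //; apply: (iJ' 0 t) => //; rewrite (ltW u0).
Qed.

Lemma dom_open F x : open (dom F x).
Proof.
apply: ball_sub_open => t [J [phi [sJ Jt]]].
have [_ oJ _ _ _] := sJ; have [e e0 He] := open_ball_sub oJ Jt.
by exists e => // s /He Js; exists J, phi.
Qed.

Lemma fl_sol F x t : hol F -> dom F x t -> cderiv (fl F x) t (F (fl F x t)).
Proof.
move=> hF [J [phi [sJ Jt]]]; have [_ oJ _ _ _] := sJ.
have [e e0 He] := open_ball_sub oJ Jt.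
have /is_solutionE[_ _ _ _ pd] := sJ.
rewrite (fl_eq hF sJ Jt); apply: (@cderiv_near _ _ _ _ _ e) (pd t Jt) => // h he.
by rewrite (fl_eq hF sJ) //; apply: He; rewrite addrC addKr.
Qed.

(* A box for [F] at [y] solves all the fields [w F], with [w] complex, at once. *)
Lemma box_is_solution F y r G g z w : hol F -> flow_box F y r G g ->
  cabs z < r / (4 * cabs (F y)) ->
  is_solution (sc w F) (g z) [set s | cabs (z + s%:C%C * w) < r / (4 * cabs (F y))]
    (fun s => g (z + s%:C%C * w)).
Proof.
move=> hF B zr; apply/is_solutionE; split.
- move=> s t /= hs ht u /andP[su ut]; have [st|ts] := ltP s t; last first.
    by have -> : u = s by lra.
  pose k := (u - s) / (t - s).
  have E : z + u%:C%C * w = on_seg (z + s%:C%C * w) (z + t%:C%C * w) k.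
    have -> : u = s + k * (t - s) by rewrite /k divfK ?gt_eqF ?subr_gt0 //; ring.
    by rewrite /on_seg !(rmorphD, rmorphM, rmorphB) /=; ring.
  pose m := Num.max (cabs (z + s%:C%C * w)) (cabs (z + t%:C%C * w)).
  apply: (@le_lt_trans _ _ m); last by rewrite gt_max hs ht.
  rewrite E; have := @disc_convex _ 0 m (z + s%:C%C * w) (z + t%:C%C * w) k.
  rewrite !subr0; apply; rewrite /m ?le_max ?lexx ?orbT //.
  by rewrite /k divr_ge0 ?ler_pdivrMr ?subr_gt0 ?mul1r ?lerB ?subr_ge0 ?(ltW st).
- apply: ball_sub_open => t /= ht.
  have k0 : 0 < 1 + cabs w by rewrite ltr_pwDl ?cabs_ge0.
  exists ((r / (4 * cabs (F y)) - cabs (z + t%:C%C * w)) / (1 + cabs w)).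
    by rewrite divr_gt0 ?subr_gt0.
  move=> s; rewrite ltr_pdivlMr // => hs.
  have -> : z + s%:C%C * w = (z + t%:C%C * w) + (s - t)%:C%C * w by rewrite rmorphB /=; ring.
  apply: le_lt_trans (cabsD _ _) _; rewrite cabsM cabs_real.
  have := mulr_ge0 (normr_ge0 (s - t)) ler01; lra.
- by rewrite /= mul0r addr0.
- by rewrite mul0r addr0.
- move=> t /= ht; rewrite /sc.
  exact: (cderiv_comp (cderiv_affine z w t) (box_dg B ht)).
Qed.

Lemma dom0 F x : hol F -> dom F x 0.
Proof.
move=> hF; have [F0|F0] := eqVneq (F x) 0.
  apply: (@dom_sol _ _ setT (fun=> x)) => //; apply/is_solutionE; split => //.
    exact: openT.
  by move=> t _; rewrite F0; exact: cderiv_cst.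
have [r [G [g B]]] := hol_box hF F0.
have := @box_is_solution F x r G g 0 1 hF B.
rewrite normc0 (box_g0 B) sc1 => /(_ (box_rho_gt0 B)) sJ.
by apply: dom_sol sJ _; rewrite /mkset mul0r addr0 normc0 (box_rho_gt0 B).
Qed.

Lemma fl0 F x : hol F -> fl F x 0 = x.
Proof.
move=> hF; have [J [phi [sJ J0]]] := dom0 x hF.
by rewrite (fl_eq hF sJ J0); case: sJ.
Qed.

Lemma fl_shift_sub F x s t : hol F -> dom F x s -> dom F x (s + t) ->
  dom F (fl F x s) t /\ fl F (fl F x s) t = fl F x (s + t).
Proof.
move=> hF ds dst.
have sJ : is_solution F (fl F x s) [set t | dom F x (s + t)] (fun t => fl F x (s + t)).
  apply/is_solutionE; split.
  - move=> u v /= du dv k /andP[uk kv]; apply: (dom_interval du dv).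
    by apply/andP; split; lra.
  - apply: ball_sub_open => u /= du; have [e e0 He] := open_ball_sub (@dom_open F x) du.
    by exists e => // v vu; apply: He; have -> : s + v - (s + u) = v - u by ring.
  - by rewrite /= addr0.
  - by rewrite addr0.
  - move=> u /= du; have := fl_sol hF du.
    have {1}-> : s + u = 1 * u + s by ring.
    move=> /cderiv_rescale; rewrite rmorph1 mul1r.
    by apply: (@cderiv_near _ _ _ _ _ 1) => // h _; rewrite mul1r addrC.
by split; [exact: dom_sol sJ _|exact: (fl_eq hF sJ)].
Qed.

Lemma dom_shift F x s t : hol F -> dom F x s -> dom F (fl F x s) t <-> dom F x (s + t).
Proof.
move=> hF ds; split=> [dt|dst]; last by have [] := fl_shift_sub hF ds dst.
have [d0 E] : dom F (fl F x s) (- s) /\ fl F (fl F x s) (- s) = fl F x (s - s).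
  by apply: fl_shift_sub => //; rewrite subrr; exact: dom0.
rewrite subrr fl0 // in E.
have := @fl_shift_sub F (fl F x s) (- s) (s + t) hF d0.
by rewrite addrA addNr add0r E => /(_ dt)[].
Qed.

Lemma fl_shift F x s t : hol F -> dom F x s -> dom F x (s + t) ->
  fl F (fl F x s) t = fl F x (s + t).
Proof. by move=> hF ds dst; have [] := fl_shift_sub hF ds dst. Qed.

Lemma fl_back F x s : hol F -> dom F x s ->
  dom F (fl F x s) (- s) /\ fl F (fl F x s) (- s) = x.
Proof.
move=> hF ds; have := fl_shift_sub hF ds (t := - s).
by rewrite subrr fl0 //; apply; exact: dom0.
Qed.

Lemma fl_scale F x (c t : R) : hol F -> dom F x (c * t) ->
  dom (sc c%:C%C F) x t /\ fl (sc c%:C%C F) x t = fl F x (c * t).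
Proof.
move=> hF dct.
have sJ : is_solution (sc c%:C%C F) x [set t | dom F x (c * t)] (fun t => fl F x (c * t)).
  apply/is_solutionE; split.
  - move=> u v /= du dv k /andP[uk kv]; have [c0|c0] := leP 0 c.
      by apply: (dom_interval du dv); rewrite !ler_wpM2l.
    by apply: (dom_interval dv du); rewrite !ler_wnM2l // ltW.
  - apply: ball_sub_open => u /= du; have [e e0 He] := open_ball_sub (@dom_open F x) du.
    have k0 : 0 < 1 + `|c| by rewrite ltr_pwDl.
    exists (e / (1 + `|c|)); first exact: divr_gt0.
    move=> v; rewrite ltr_pdivlMr // => vu; apply: He; rewrite -mulrBr normrM.
    by have := normr_ge0 (v - u); lra.
  - by rewrite /= mulr0; exact: dom0.
  - by rewrite mulr0 fl0.
  - move=> u /= du; have := fl_sol hF du; rewrite -{1}[c * u]addr0 => /cderiv_rescale.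
    by apply: (@cderiv_near _ _ _ _ _ 1) => // h _; rewrite addr0.
by split; [exact: dom_sol sJ _|exact: (fl_eq (hol_sc _ hF) sJ)].
Qed.

Lemma fl_equil F b t : hol F -> F b = 0 -> dom F b t /\ fl F b t = b.
Proof.
move=> hF b0; have sJ : is_solution F b setT (fun=> b).
  apply/is_solutionE; split => //; first exact: openT.
  by move=> s _; rewrite b0; exact: cderiv_cst.
by split; [exact: dom_sol sJ _|exact: (fl_eq hF sJ)].
Qed.

Lemma fl_neq0 F x t : hol F -> F x != 0 -> dom F x t -> F (fl F x t) != 0.
Proof.
move=> hF x0 dt; apply: contra_neq x0 => E; have [_ <-] := fl_back hF dt.
by have [_ ->] := fl_equil (- t) hF E.
Qed.

End Flow.

(** * Continuation of bounded solutions *)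

Section Continuation.
Variable R : realType.
Local Notation C := (R[i]).
Implicit Types (z w x y : C) (t s h e r : R) (F : C -> C) (phi psi : R -> C) (J : set R).

Lemma hol_cont F z : hol F -> hcont F z.
Proof. by move=> /(_ z)[d]; exact: hderiv_cont. Qed.

Lemma hol_bounded F M : hol F -> 0 <= M -> exists2 N : R, 0 < N & forall z, cabs z <= M -> cabs (F z) <= N.
Proof.
move=> hF M0; have MM : - M <= M by lra.
(* The bound is written [e^-1] so that it weakens as [e] shrinks; [unif_interval] is then applied in
   each coordinate of the square around the disc. *)
have loc (x0 y0 : R) : exists2 d : R, 0 < d & exists2 e : R, 0 < e & forall x y : R,
    `|x - x0| < d -> `|y - y0| < d -> cabs (F (x +i* y)%C) <= e^-1.
  have [d d0 Hd] := hol_cont (x0 +i* y0)%C hF ltr01.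
  pose k := 1 + cabs (F (x0 +i* y0)%C); have k0 : 0 < k by rewrite ltr_pwDl ?cabs_ge0.
  exists (d / 2); first by rewrite divr_gt0.
  exists k^-1; rewrite ?invr_gt0 // => x y hx hy; rewrite invrK.
  have := Hd ((x - x0) +i* (y - y0))%C.
  have -> : ((x0 +i* y0) + ((x - x0) +i* (y - y0)))%C = (x +i* y)%C :> C.
    by apply/eqP; rewrite eq_complex /= !subrKC !eqxx.
  have le2 := cabs_ReIm ((x - x0) +i* (y - y0))%C.
  move=> /(_ ltac:(by apply: le_lt_trans le2 _; rewrite /=; lra)).
  have := cabsD (F (x +i* y)%C - F (x0 +i* y0)%C) (F (x0 +i* y0)%C); rewrite subrK /k; lra.
have mono a b : 0 < b <= a -> forall c : R, c <= a^-1 -> c <= b^-1.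
  by move=> /andP[b0 ba] c /le_trans; apply; rewrite lef_pV2 // posrE // (lt_le_trans b0).
have [| |e e0 He] := @unif_interval R
  (fun (x e : R) => forall y : R, - M <= y <= M -> cabs (F (x +i* y)%C) <= e^-1) (- M) M MM.
- by move=> t e e' H he y hy; apply: (mono _ _ he); exact: H.
- move=> x0 _.
  have [| |e e0 He] := @unif_interval R
    (fun (y e : R) => forall x : R, `|x - x0| < e -> cabs (F (x +i* y)%C) <= e^-1) (- M) M MM.
  + move=> t e e' H he x hx; apply: (mono _ _ he); apply: H.
    by case/andP: he => _; exact: lt_le_trans.
  + move=> y0 _; have [d d0 [e e0 He]] := loc x0 y0.
    exists d, (Num.min d e); split; rewrite ?lt_min ?d0 //.
    move=> y _ yd x; rewrite lt_min => /andP[xd _].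
    by apply: (mono e) (He x y xd yd); rewrite lt_min d0 e0 ge_min lexx orbT.
  + by exists e, e; split => // s _ sx y hy; exact: He.
exists e^-1; rewrite ?invr_gt0 // => -[x y] zM.
have h1 := le_trans (cabs_Re (x +i* y)%C) zM; have h2 := le_trans (cabs_Im (x +i* y)%C) zM.
by apply: He; rewrite -ler_norml.
Qed.

(* A bounded solution does not stop: its limit is either a regular point, where
   a box continues it, or an equilibrium, which is not reached in finite time. *)
Lemma fl_extend F x (T M : R) : hol F -> 0 < T ->
  (forall t, 0 <= t < T -> dom F x t -> cabs (fl F x t) <= M) -> dom F x T.
Proof.
move=> hF T0 bM.
have M0 : 0 <= M.
  by apply: le_trans (cabs_ge0 _) (bM 0 _ (dom0 x hF)); rewrite lexx.
have [N N0 HN] := hol_bounded hF M0.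
suff /(_ T) : forall t, 0 <= t <= T -> dom F x t by apply; rewrite lexx ltW.
apply: real_induction; first exact: dom0.
  move=> t /andP[t0 tT] /(_ t); rewrite t0 lexx => /(_ isT) dt.
  have [e e0 He] := open_ball_sub (@dom_open _ F x) dt.
  by exists e => // s /andP[ts se] _; apply: He; rewrite ger0_norm; lra.
move=> t /andP[t0 tT] dlt; pose phi := fl F x.
(* Along these times [phi] moves by at most N t / 2^n, so it has a limit [l]. *)
pose s n := t - t / 2 ^+ n.
have pn n : 0 < t / 2 ^+ n by rewrite divr_gt0 ?exprn_gt0.
have sS n : t / 2 ^+ n.+1 = t / 2 ^+ n / 2 by rewrite exprS; field.
have sn n : 0 <= s n < t.
  have := pn n => ?; apply/andP; split; rewrite /s; last lra.
  rewrite subr_ge0 ler_pdivrMr ?exprn_gt0 // ler_peMr ?(ltW t0) //.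
  by rewrite exprn_ege1 // ler1n.
have phid u : 0 <= u < t -> cderiv phi u (F (phi u)) by move=> hu; apply: fl_sol (dlt u hu).
have phiN u : 0 <= u < t -> cabs (F (phi u)) <= N.
  move=> hu; apply: HN; apply: bM (dlt u hu); case/andP: hu => -> /= ut.
  exact: lt_le_trans ut tT.
have [|n|l Hl] := @geom_cvg _ (fun n => phi (s n)) (N * t).
- by rewrite mulr_ge0 // ltW.
- have /andP[s0 s1] := sn n; have /andP[s2 s3] := sn n.+1; have := sS n => sSn.
  have ss : s n <= s n.+1 by rewrite /s; have := pn n; lra.
  have := @cderiv_bound _ phi N (s n) (s n.+1) ss.
  move=> /(_ ltac:(move=> u /andP[u1 u2];
     exists (F (phi u)); [apply: phid|apply: phiN]; apply/andP; split; lra)) H.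
  apply: le_trans H _; rewrite -mulrA ler_pM2l // /s sSn; have := pn n; lra.
have [F0|F0] := eqVneq (F l) 0.
  (* A Gronwall estimate run backwards from [s n] to 0 puts [x] arbitrarily close to [l], so the
     solution is constant. *)
  suff -> : x = l by have [] := fl_equil t hF F0.
  apply: cabs_small_eq => eta eta0.
  have [K [r [K0 r0 Hr]]] := hol_zero hF F0.
  pose X := expR ((K + 1) * t); have X0 : 0 < X by exact: expR_gt0.
  pose mu := Num.min r eta; have mu0 : 0 < mu by rewrite lt_min r0.
  have [n Hn] := small_pow (4 * (N * t) + 1) (divr_gt0 mu0 X0).
  pose c := (4 * (N * t) + 1) / 2 ^+ n.
  have p2 : 0 < 2 ^+ n :> R by rewrite exprn_gt0.
  have c0 : 0 < c by rewrite divr_gt0 // ltr_wpDl // !mulr_ge0 // ltW.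
  have cX : c * X < mu by rewrite -ltr_pdivlMr.
  have /andP[s0 s1] := sn n.
  have cl : cabs (phi (s n) - l) <= c.
    rewrite cabsC; apply: le_trans (Hl n) _; rewrite ler_pM2r ?invr_gt0 //; lra.
  have cE u : 0 <= u <= s n -> c * expR ((K + 1) * (u - 0)) <= c * X.
    move=> /andP[u0 us]; rewrite ler_pM2l // ler_expR subr0 ler_pM2l; lra.
  have Hg := @gronwall _ (fun u => phi (s n - u) - l) K (K + 1) c 0 (s n).
  have psid u : 0 <= u <= s n -> cderiv (fun u => phi (s n - u) - l) u (- F (phi (s n - u)) - 0).
    move=> /andP[u0 us]; apply: cderivB (cderiv_cst l u); rewrite -mulN1r.
    by apply: sol_rev; apply: phid; apply/andP; split; lra.
  have {}Hg : cabs (phi (s n - s n) - l) <= c * expR ((K + 1) * (s n - 0)).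
    apply: Hg; rewrite ?s0 ?lexx ?subr0 //.
    - by rewrite K0; lra.
    - by move=> u /psid; exact: cderiv_cont.
    - move=> u /andP[u0 us] Hu; have hu : 0 <= u <= s n by rewrite u0 ltW.
      exists (- F (phi (s n - u)) - 0); first exact: psid.
      rewrite subr0 cabsN; apply: Hr; apply: le_lt_trans Hu _.
      apply: le_lt_trans (cE u hu) _; apply: lt_le_trans cX _.
      by rewrite ge_min lexx.
  move: Hg; rewrite subrr /phi fl0 // => /le_trans; apply.
  apply: le_trans (cE _ _) _; first by rewrite s0 lexx.
  by apply: le_trans (ltW cX) _; rewrite ge_min lexx orbT.
have [r [G [g B]]] := hol_box hF F0; have r0 := box_pos B.
have l0 := box_Fy_gt0 B; have rho0 := box_rho_gt0 B.
set rho := r / (4 * cabs (F l)) in rho0.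
pose mu := Num.min (r / 8) (rho / 2).
have mu0 : 0 < mu by rewrite lt_min; apply/andP; split; lra.
pose k := 8 * (N * t) / cabs (F l) + 4 * (N * t) + t.
have [n Hn] := small_pow k mu0.
have p2 : 0 < (2 ^+ n)^-1 :> R by rewrite invr_gt0 exprn_gt0.
have NT : 0 < N * t by rewrite mulr_gt0.
have NTF : 0 < 8 * (N * t) / cabs (F l) by rewrite divr_gt0 // mulr_gt0.
have k1 : 4 * (N * t) / 2 ^+ n < mu by apply: le_lt_trans Hn; rewrite ler_pM2r // /k; lra.
have k2 : 8 * (N * t) / cabs (F l) / 2 ^+ n < mu.
  by apply: le_lt_trans Hn; rewrite ler_pM2r // /k; lra.
have k3 : t / 2 ^+ n < mu by apply: le_lt_trans Hn; rewrite ler_pM2r // /k; lra.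
have mr : mu <= r / 8 by rewrite ge_min lexx.
have mrho : mu <= rho / 2 by rewrite ge_min lexx orbT.
have Hn' : cabs (phi (s n) - l) < r / 8 by rewrite cabsC; have := Hl n; lra.
have [w [gw wr wl]] := box_onto B Hn'.
have w2 : cabs w < rho / 2.
  apply: le_lt_trans wl _; apply: lt_le_trans mrho; apply: le_lt_trans k2.
  have -> : 8 * (N * t) / cabs (F l) / 2 ^+ n = 2 * (4 * (N * t) / 2 ^+ n) / cabs (F l) by ring.
  by rewrite ler_pM2r ?invr_gt0 // ler_pM2l // cabsC.
have sJ := box_is_solution 1 hF B wr; rewrite sc1 gw in sJ.
have ds : dom F x (s n) by apply: dlt.
(* [phi (s n)] has a coordinate [w] below rho / 2 in the box at [l], and the missing time is below
   rho / 2 as well, so the box reaches time [t]. *)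
have : dom F (phi (s n)) (t / 2 ^+ n).
  apply: dom_sol sJ _; rewrite /mkset mulr1; apply: le_lt_trans (cabsD _ _) _.
  by rewrite cabs_real gtr0_norm // -/rho; lra.
by move=> /(dom_shift _ hF ds); rewrite /s subrK.
Qed.

End Continuation.

(** * Complex time and commuting flows *)

Section ComplexTime.
Variable R : realType.
Local Notation C := (R[i]).
Implicit Types (z w x y : C) (t s h e r : R) (F : C -> C) (phi psi : R -> C) (J : set R).

(* The flow for the complex time [z], along the segment from [0] to [z]. *)
Definition cfl F z x : C := fl (sc z F) x 1.

Lemma box_fl F y r G g z w t : hol F -> flow_box F y r G g ->
  cabs z < r / (4 * cabs (F y)) -> cabs (z + t%:C%C * w) < r / (4 * cabs (F y)) ->
  dom (sc w F) (g z) t /\ fl (sc w F) (g z) t = g (z + t%:C%C * w).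
Proof.
move=> hF B zr ztr; have sJ := box_is_solution w hF B zr.
by split; [exact: dom_sol sJ _|exact: (fl_eq (hol_sc w hF) sJ)].
Qed.

Lemma box_cfl F y r G g z w : hol F -> flow_box F y r G g ->
  cabs z < r / (4 * cabs (F y)) -> cabs (z + w) < r / (4 * cabs (F y)) ->
  dom (sc w F) (g z) 1 /\ cfl F w (g z) = g (z + w).
Proof.
by move=> hF B zr zwr; have := @box_fl F y r G g z w 1 hF B zr; rewrite mul1r; exact.
Qed.

Lemma cfl_inj F z x y : hol F -> dom (sc z F) x 1 -> dom (sc z F) y 1 ->
  cfl F z x = cfl F z y -> x = y.
Proof.
move=> hF dx dy E; have hz := hol_sc z hF.
by have [_ <-] := fl_back hz dx; have [_ <-] := fl_back hz dy; rewrite -/(cfl F z x) E.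
Qed.

Lemma near_cfl F x d : hol F -> F x != 0 -> 0 < d -> exists2 e : R, 0 < e &
  forall y, cabs (y - x) < e -> exists2 z, cabs z < d & y = cfl F z x.
Proof.
move=> hF x0 d0; have [r [G [g B]]] := hol_box hF x0; have r0 := box_pos B.
have F0 := box_Fy_gt0 B.
exists (Num.min (r / 8) (d * cabs (F x) / 2)).
  by rewrite lt_min !divr_gt0 // mulr_gt0.
move=> y; rewrite lt_min => /andP[/(box_onto B)[w [gw wr wd]] yd].
exists w; first by apply: le_lt_trans wd _; rewrite ltr_pdivrMr //; lra.
have [_] := @box_cfl F x r G g 0 w hF B ltac:(by rewrite normc0 (box_rho_gt0 B))
  ltac:(by rewrite add0r).
by rewrite (box_g0 B) add0r gw.
Qed.

(** The derivative in [t] is what makes the translate of an orbit by a fixed complex time a solution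
    of [F] again; the derivative in [z] later differentiates along [sc w F]. *)
Definition strip_at F (eps : R) (phi : R -> C) t d := forall z, cabs z < d ->
  [/\ hderiv (fun z => cfl F z (phi t)) z (F (cfl F z (phi t))),
      cderiv (fun t => cfl F z (phi t)) t (F (cfl F z (phi t))),
      cabs (cfl F z (phi t) - phi t) < eps &
      dom (sc z F) (phi t) 1].

(** In the box at [fl F x t0] the orbit is g(t - t0) and its translate by [z] is g(t - t0 + z): real
    and complex times simply add. *)
Lemma strip_local F x t0 eps : hol F -> F x != 0 -> dom F x t0 -> 0 < eps ->
  exists d e : R, [/\ 0 < d, 0 < e &
    forall t, `|t - t0| < d -> strip_at F eps (fl F x) t e].
Proof.
move=> hF x0 dt e0; have y0 := fl_neq0 hF x0 dt; pose y := fl F x t0.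
have [r [G [g B]]] := hol_box hF y0; have rho0 := box_rho_gt0 B.
rewrite -/y in B rho0; set rho := r / (4 * cabs (F y)) in rho0.
have phiE t : `|t - t0| < rho -> dom F x t /\ fl F x t = g (t - t0)%:C%C.
  move=> ht; have [] := @box_fl F y r G g 0 1 (t - t0) hF B.
  - by rewrite normc0.
  - by rewrite add0r mulr1 cabs_real.
  rewrite (box_g0 B) add0r mulr1 sc1 => d1 E1; have := dom_shift (t - t0) hF dt.
  by rewrite subrKC => -[/(_ d1) dt' _]; rewrite -E1 fl_shift ?subrKC.
have cflE t z : `|t - t0| < rho -> cabs ((t - t0)%:C%C + z) < rho ->
    dom (sc z F) (fl F x t) 1 /\ cfl F z (fl F x t) = g ((t - t0)%:C%C + z).
  by move=> ht hz; have [_ ->] := phiE t ht; apply: (box_cfl hF B) => //; rewrite cabs_real.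
pose k := 2 * cabs (F y); have k0 : 0 < k by rewrite mulr_gt0 // (box_Fy_gt0 B).
exists (rho / 2), (Num.min (rho / 2) (eps / k)); split.
- lra.
- by rewrite lt_min (divr_gt0 e0 k0) andbT; lra.
move=> t ht z; rewrite lt_min => /andP[zr ze].
have tr : `|t - t0| < rho by lra.
have sum_lt s w : `|s - t0| + cabs w < rho -> cabs ((s - t0)%:C%C + w) < rho.
  by move=> H; apply: le_lt_trans (cabsD _ _) _; rewrite cabs_real.
have zt := sum_lt t z ltac:(lra).
have [d1 E1] := cflE t z tr zt; split => //.
- rewrite E1; have Hd := box_dg B zt.
  have H : hderiv (fun z => g ((t - t0)%:C%C + z)) z (F (g ((t - t0)%:C%C + z))).
    by move=> e /Hd[d d0 H]; exists d => // w /H; rewrite addrA.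
  apply: (@hderiv_near _ _ _ _ _ (rho / 2 - cabs z) _ _ H); first by rewrite subr_gt0.
  move=> w hw; have hzw := sum_lt t (z + w) ltac:(have := cabsD z w; lra).
  by have [_ ->] := cflE t (z + w) tr hzw.
- rewrite E1; have E s : (s - t0)%:C%C + z = (z - t0%:C%C) + s%:C%C * 1.
    by rewrite rmorphB; ring.
  have Hd := box_dg B zt; rewrite {1}E in Hd.
  have := cderiv_comp (cderiv_affine (z - t0%:C%C) 1 t) Hd; rewrite mul1r.
  apply: (@cderiv_near _ _ _ _ _ (rho / 2 - `|t - t0|)); first by rewrite subr_gt0.
  move=> h hh; rewrite -E; have th : `|t + h - t0| < rho / 2.
    by rewrite addrAC; have := ler_normD (t - t0) h; lra.
  have hth := sum_lt (t + h) z ltac:(lra).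
  by have [_ ->] := cflE (t + h) z ltac:(lra) hth.
- rewrite E1; have [_ ->] := phiE t tr.
  apply: le_lt_trans (box_g_lip B zt _) _; first by rewrite cabs_real.
  rewrite [_ + z]addrC addrK -/k mulrC -ltr_pdivlMr //.
Qed.

Lemma strip F x (a b eps : R) : hol F -> F x != 0 -> a <= b -> dom F x a -> dom F x b ->
  0 < eps -> exists2 d : R, 0 < d & forall t, a <= t <= b -> strip_at F eps (fl F x) t d.
Proof.
move=> hF x0 ab da db e0; apply: unif_interval => //.
  move=> t e e' H /andP[_ ee'] z hz; apply: H; exact: lt_le_trans hz ee'.
move=> t atb; have dt : dom F x t by exact: dom_interval da db _ atb.
have [d [e [d0 e0' H]]] := strip_local hF x0 dt e0.
by exists d, e; split => // s _; exact: H.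
Qed.

Lemma strip_flow F x (a b eps : R) : hol F -> F x != 0 -> a <= 0 <= b ->
  dom F x a -> dom F x b -> 0 < eps ->
  exists2 d : R, 0 < d & forall z, cabs z < d -> forall t, a <= t <= b ->
    [/\ dom F (cfl F z x) t, fl F (cfl F z x) t = cfl F z (fl F x t),
        dom (sc z F) (fl F x t) 1, cabs (cfl F z (fl F x t) - fl F x t) < eps &
        hderiv (fun z => cfl F z (fl F x t)) z (F (cfl F z (fl F x t)))].
Proof.
move=> hF x0 /andP[a0 b0] da db e0.
have [e1 e10 H1] := open_ball_sub (@dom_open _ F x) da.
have [e2 e20 H2] := open_ball_sub (@dom_open _ F x) db.
(* [is_solution] is about open intervals, so [a, b] is enlarged a little inside the domain. *)
have da' : dom F x (a - e1 / 2) by apply: H1; rewrite ler0_norm; lra.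
have db' : dom F x (b + e2 / 2) by apply: H2; rewrite ger0_norm; lra.
have ab' : a - e1 / 2 <= b + e2 / 2 by lra.
have [d d0 Hd] := strip hF x0 ab' da' db' e0.
exists d => [//|z zd t /andP[at_ tb]].
have sJ : is_solution F (cfl F z x) [set t | a - e1 / 2 < t < b + e2 / 2]
    (fun t => cfl F z (fl F x t)).
  apply/is_solutionE; split.
  - move=> u v /= /andP[u1 u2] /andP[v1 v2] k /andP[uk kv]; apply/andP; split; lra.
  - apply: ball_sub_open => u /= /andP[u1 u2].
    exists (Num.min (u - (a - e1 / 2)) (b + e2 / 2 - u)).
      by rewrite lt_min !subr_gt0 u1.
    by move=> s; rewrite lt_min !ltr_norml => H; apply/andP; split; lra.
  - by rewrite /=; apply/andP; split; lra.
  - by rewrite fl0.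
  - move=> u /= /andP[u1 u2].
    by have [] := Hd u ltac:(by rewrite !ltW) z zd.
have Jt : [set t | a - e1 / 2 < t < b + e2 / 2] t by rewrite /=; apply/andP; split; lra.
have [h1 h2 h3 h4] := Hd t ltac:(by apply/andP; split; lra) z zd.
by split => //; [exact: dom_sol sJ Jt|exact: (fl_eq hF sJ Jt)].
Qed.

Lemma cfl0 F x : hol F -> cfl F 0 x = x.
Proof.
move=> hF; rewrite /cfl; have F0 : sc 0 F x = 0 by rewrite /sc mul0r.
by have [_ ->] := fl_equil 1 (hol_sc 0 hF) F0.
Qed.

Lemma between0 s : Num.min 0 s <= 0 <= Num.max 0 s.
Proof. by rewrite ge_min le_max lexx. Qed.

Lemma between_s s : Num.min 0 s <= s <= Num.max 0 s.
Proof. by rewrite ge_min le_max lexx !orbT. Qed.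

Lemma dom_between F x s : hol F -> dom F x s -> dom F x (Num.min 0 s) /\ dom F x (Num.max 0 s).
Proof. by move=> hF ds; have d0 := dom0 x hF; split; case: leP. Qed.

(** A nearby initial point is [cfl F z x] for a small [z], and its orbit is the translate by [z] of
    the orbit of [x]. *)
Lemma fl_cont F x (a b eps : R) : hol F -> F x != 0 -> a <= 0 <= b ->
  dom F x a -> dom F x b -> 0 < eps ->
  exists2 d : R, 0 < d & forall y, cabs (y - x) < d -> forall t, a <= t <= b ->
    dom F y t /\ cabs (fl F y t - fl F x t) < eps.
Proof.
move=> hF x0 ab da db e0; have [d d0 Hd] := strip_flow hF x0 ab da db e0.
have [e e1 He] := near_cfl hF x0 d0; exists e => // y /He[z zd ->] t ht.
by have [h1 -> h3 h4 _] := Hd z zd t ht.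
Qed.

(* Being [T]-periodic is locally constant: nearby points are complex-time
   translates, and real and complex times commute. *)
Lemma per_loc F x (T : R) : hol F -> F x != 0 -> dom F x T ->
  exists2 d : R, 0 < d & forall y, cabs (y - x) < d ->
    [/\ F y != 0, dom F y T & fl F y T = y <-> fl F x T = x].
Proof.
move=> hF x0 dT; have [dm dM] := dom_between hF dT.
have [d d0 Hd] := strip_flow hF x0 (between0 T) dm dM ltr01.
have F0 : 0 < cabs (F x) by rewrite cabs_gt0.
have [e e0 He] := near_cfl hF x0 d0; have [e1 e10 He1] := hol_cont x hF F0.
exists (Num.min e e1); first by rewrite lt_min e0.
move=> y; rewrite lt_min => /andP[/He[z zd ->] /He1]; rewrite subrKC => Fy.
have [h1 h2 h3 h4 _] := Hd z zd T (between_s T).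
have [_ _ k3 _ _] := Hd z zd 0 (between0 T); rewrite fl0 // in k3.
split => //; last rewrite h2; last first.
  by split=> [E|->//]; exact: cfl_inj h3 k3 E.
apply: contraTneq Fy => ->; rewrite sub0r cabsN ltxx //.
Qed.

(** Minimum and maximum treat both directions of time alike. For an open [P] these [s] form an open
    interval, fit to carry an [is_solution]. *)
Definition reach (P : C -> Prop) F x s :=
  forall u, Num.min 0 s <= u <= Num.max 0 s -> dom F x u /\ P (fl F x u).

Lemma reach_sub P F x s t : reach P F x s -> Num.min 0 s <= t <= Num.max 0 s -> reach P F x t.
Proof.
move=> H /andP[st ts] u /andP[tu ut]; apply: H; apply/andP; split.
  by apply: le_trans tu; rewrite le_min st ge_min lexx.
by apply: le_trans ut _; rewrite ge_max ts le_max lexx.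
Qed.

Lemma reach_interval P F x : is_interval (reach P F x).
Proof.
move=> s t Hs Ht u /andP[su ut]; have [u0|u0] := leP u 0.
  apply: reach_sub Hs _; rewrite ge_min su orbT le_max u0 //.
by apply: reach_sub Ht _; rewrite ge_min (ltW u0) le_max ut orbT.
Qed.

Lemma reach_open P F x : hol F ->
  (forall z, P z -> exists2 d : R, 0 < d & forall y, cabs (y - z) < d -> P y) ->
  open (reach P F x).
Proof.
move=> hF oP; apply: ball_sub_open => s Hs; have [ds Ps] := Hs s (between_s s).
have [d1 d10 H1] := open_ball_sub (@dom_open _ F x) ds.
have [d d0 Hd] := oP _ Ps; have [d2 d20 H2] := cderiv_cont (fl_sol hF ds) d0.
exists (Num.min d1 d2); first by rewrite lt_min d10.
move=> t; rewrite lt_min => /andP[t1 t2] u /andP[tu ut].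
have [us|nus] := boolP (Num.min 0 s <= u <= Num.max 0 s); first exact: Hs.
have us : `|u - s| <= `|t - s|.
  have nrm := ler_norm (t - s); have nrm' := ler_norm (s - t); rewrite distrC in nrm'.
  move: tu ut nus; rewrite ge_min le_max ge_min le_max negb_and !negb_or -!ltNge ler_norml.
  move=> /orP h1 /orP h2 /orP h3; apply/andP.
  by case: h1 => h1; case: h2 => h2; case: h3 => /andP[h3 h4]; split; lra.
split; first by apply: H1; exact: le_lt_trans us t1.
by apply: Hd; have := H2 (u - s); rewrite subrKC; apply; exact: le_lt_trans us t2.
Qed.

End ComplexTime.

(** * Commutation, periodic orbits and orbits near equilibria *)

Section Periodic.
Variable R : realType.
Local Notation C := (R[i]).
Implicit Types (z w x y : C) (t s h e r T : R) (F : C -> C) (phi psi : R -> C) (J : set R).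

Lemma fl_cfl F w x t : hol F -> dom (sc w F) x t -> cfl F (t%:C%C * w) x = fl (sc w F) x t.
Proof.
move=> hF dt; have := @fl_scale _ (sc w F) x t 1 (hol_sc w hF).
by rewrite mulr1 sc_sc => /(_ dt)[].
Qed.

Definition regular F (tau : R) z := F z != 0 /\ dom F z tau.

(* The flows of [F] and [w F] commute, as both are complex-time flows of [F]. *)
Lemma fl_comm F w x tau s : hol F -> reach (regular F tau) (sc w F) x s ->
  dom (sc w F) (fl F x tau) s /\
  fl (sc w F) (fl F x tau) s = fl F (fl (sc w F) x s) tau.
Proof.
move=> hF Hs; have hw := hol_sc w hF.
have H0 : reach (regular F tau) (sc w F) x 0 by apply: reach_sub Hs _; exact: between0.
have sJ : is_solution (sc w F) (fl F x tau) (reach (regular F tau) (sc w F) x)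
    (fun s => fl F (fl (sc w F) x s) tau).
  apply/is_solutionE; split.
  - exact: reach_interval.
  - apply: reach_open => // z [z0 dz]; have [d d0 Hd] := per_loc hF z0 dz.
    by exists d => // y /Hd[y0 dy _].
  - exact: H0.
  - by rewrite fl0.
  - move=> u Hu; have [du [z0 dz]] := Hu u (between_s u); set z := fl _ _ u in z0 dz.
    have [dm dM] := dom_between hF dz.
    have [d d0 Hd] := strip_flow hF z0 (between0 tau) dm dM ltr01.
    have [e e0 He] := open_ball_sub (@dom_open _ (sc w F) x) du.
    have [_ _ _ _] := Hd 0 ltac:(by rewrite normc0) tau (between_s tau).
    rewrite cfl0 // => H1.
    (* For small [h] the value at u + h is the complex-time translate of [fl F z tau] by h w, so
       only the derivative at translation 0 is used. *)
    have H2 : cderiv (fun s => cfl F ((- u%:C%C * w) + s%:C%C * w) (fl F z tau)) u (w * F (fl F z tau)).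
      apply: (cderiv_comp (f := fun z0 => cfl F z0 (fl F z tau)) (cderiv_affine _ w u)).
      by have -> : - u%:C%C * w + u%:C%C * w = 0 by ring.
    pose k := 1 + cabs w; have k0 : 0 < k by rewrite ltr_pwDl ?cabs_ge0.
    apply: (@cderiv_near _ _ _ _ _ (Num.min e (d / k)) _ _ H2).
      by rewrite lt_min e0 divr_gt0.
    move=> h; rewrite lt_min => /andP[he]; rewrite ltr_pdivlMr // => hd.
    have -> : - u%:C%C * w + (u + h)%:C%C * w = h%:C%C * w by rewrite rmorphD /=; ring.
    have duh : dom (sc w F) x (u + h) by apply: He; rewrite addrC addKr.
    have dzh : dom (sc w F) z h by apply/dom_shift.
    rewrite -(fl_shift hw du duh) -/z -(fl_cfl hF dzh).
    have hwd : cabs (h%:C%C * w) < d.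
      rewrite cabsM cabs_real; apply: le_lt_trans hd; rewrite ler_wpM2l // /k; lra.
    by have [_ -> _ _ _] := Hd _ hwd tau (between_s tau).
by split; [exact: dom_sol sJ Hs|exact: (fl_eq hw sJ)].
Qed.

(** [T] may be any period, not just the least one: having the period [T] is the property that is
    locally constant. *)
Definition per F T x := [/\ F x != 0, dom F x T & fl F x T = x].

Lemma per_dom_nat F T x (n : nat) t : hol F -> per F T x ->
  (dom F x (t + n%:R * T) <-> dom F x t) /\ (dom F x t -> fl F x (t + n%:R * T) = fl F x t).
Proof.
move=> hF [_ dT E]; have step u : (dom F x (u + T) <-> dom F x u) /\ (dom F x u -> fl F x (u + T) = fl F x u).
  have H := dom_shift u hF dT; rewrite E addrC in H.
  split; first by tauto.
  by move=> /H du; have := fl_shift hF dT (t := u); rewrite E addrC => ->.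
elim: n => [|n [IH1 IH2]]; first by rewrite mul0r addr0.
have -> : t + n.+1%:R * T = t + n%:R * T + T by rewrite -natr1; ring.
have [h1 h2] := step (t + n%:R * T); split; first by tauto.
by move=> dt; rewrite h2 ?IH2 //; exact/IH1.
Qed.

Lemma archi_mul t T : 0 < T -> exists n : nat, `|t| < n%:R * T.
Proof.
move=> T0; exists (Num.bound `|t / T|); rewrite -ltr_pdivrMr //.
have := archi_boundP (normr_ge0 (t / T)).
by rewrite normrM normfV (gtr0_norm T0).
Qed.

Lemma per_dom F T x t : hol F -> 0 < T -> per F T x -> dom F x t.
Proof.
move=> hF T0 pT; have [n Hn] := archi_mul t T0.
have d0 := dom0 x hF.
have dp : dom F x (n%:R * T).
  by have := (per_dom_nat n 0 hF pT).1; rewrite add0r => ->.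
have dm : dom F x (- (n%:R * T)).
  by rewrite -(per_dom_nat n _ hF pT).1 addNr.
by apply: dom_interval dm dp _ _; rewrite -ler_norml ltW.
Qed.

Lemma per_red F T x t : hol F -> 0 < T -> per F T x ->
  exists2 t', 0 <= t' <= T & fl F x t' = fl F x t.
Proof.
move=> hF T0 pT; pose k := Num.floor (t / T).
have := floor_itv (t / T); rewrite -/k => /andP[k1 k2].
have k3 : k%:~R * T <= t by rewrite -ler_pdivlMr.
have k4 : t < k%:~R * T + T by move: k2; rewrite intrD mulr1z ltr_pdivrMr //; lra.
exists (t - k%:~R * T); first by apply/andP; split; lra.
have dall u := per_dom u hF T0 pT.
case: (k) => n.
  by rewrite -(per_dom_nat n _ hF pT).2 // subrK.
rewrite NegzE mulrNz mulNr opprK.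
exact: (per_dom_nat n.+1 t hF pT).2.
Qed.

Lemma fl_per F T x t : hol F -> 0 < T -> per F T x -> per F T (fl F x t).
Proof.
move=> hF T0 pT; have dall u := per_dom u hF T0 pT; have [x0 _ E] := pT.
split; first exact: fl_neq0.
- exact/dom_shift.
- by rewrite fl_shift //; have := (per_dom_nat 1 t hF pT).2; rewrite mul1r; apply.
Qed.

Lemma per_open F T z : hol F -> per F T z ->
  exists2 d : R, 0 < d & forall y, cabs (y - z) < d -> per F T y.
Proof.
move=> hF [z0 dz E]; have [d d0 Hd] := per_loc hF z0 dz.
by exists d => // y /Hd[y0 dy H]; split => //; exact/H.
Qed.

Lemma per_regular F T t z : hol F -> 0 < T -> per F T z -> regular F t z.
Proof. by move=> hF T0 pz; split; [case: pz|exact: per_dom pz]. Qed.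

(** Starting close enough keeps the orbit where [F] has a linear bound, so Gronwall applies up to
    [T]. For a [T]-periodic orbit this window is the whole orbit. *)
Lemma fl_near_equil F b T : hol F -> F b = 0 -> 0 < T ->
  exists r L : R, [/\ 0 < r, 0 < L & forall x, cabs (x - b) < r -> dom F x T ->
    forall t, 0 <= t <= T -> cabs (fl F x t - b) <= L * cabs (x - b)].
Proof.
move=> hF b0 T0; have [K [r [K0 r0 Hr]]] := hol_zero hF b0.
pose L := expR ((K + 1) * T); have L0 : 0 < L by exact: expR_gt0.
exists (r / L), L; split => //; first exact: divr_gt0.
move=> x; rewrite ltr_pdivlMr // => xr dT t /andP[t0 tT].
have [->|xb] := eqVneq x b.
  by have [_ ->] := fl_equil t hF b0; rewrite subrr normc0 mulr0.
have c0 : 0 < cabs (x - b) by rewrite cabs_gt0 subr_eq0.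
have dt u : 0 <= u <= T -> dom F x u by move=> hu; exact: (dom_interval (dom0 x hF) dT hu).
have vd u : 0 <= u <= T -> cderiv (fun u => fl F x u - b) u (F (fl F x u) - 0).
  by move=> /dt du; apply: cderivB (cderiv_cst b u); exact: fl_sol.
have eL u : 0 <= u <= T -> cabs (x - b) * expR ((K + 1) * (u - 0)) <= L * cabs (x - b).
  move=> /andP[u0 uT]; rewrite mulrC ler_pM2r // ler_expR subr0 ler_pM2l //; lra.
apply: le_trans (eL t _); last by rewrite t0.
apply: (@gronwall _ (fun u => fl F x u - b) K (K + 1) (cabs (x - b)) 0 T) => //.
- by rewrite K0; lra.
- by move=> u /vd; exact: cderiv_cont.
- by rewrite fl0.
- move=> u /andP[u0 uT] Hu; have hu : 0 <= u <= T by rewrite u0 ltW.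
  exists (F (fl F x u) - 0); first exact: vd.
  by rewrite subr0; apply: Hr; apply: le_lt_trans Hu _; apply: le_lt_trans (eL u hu) _; rewrite mulrC.
- by rewrite t0.
Qed.

(* If the [w F]-orbit of [x] converges to the equilibrium [a], it cannot return
   to the [F]-orbit of [x]: it would do so again and again, while periodic
   orbits through points near [a] stay near [a]. *)
Lemma no_return F w a T x u tau : hol F -> F a = 0 -> 0 < T ->
  (forall s, 0 <= s -> dom (sc w F) x s /\ per F T (fl (sc w F) x s)) ->
  (forall e, 0 < e -> exists2 S : R, 0 <= S & forall s, S <= s -> cabs (fl (sc w F) x s - a) < e) ->
  0 < u -> fl F x tau <> fl (sc w F) x u.
Proof.
move=> hF a0 T0 Hq Ha u0 E; have hw := hol_sc w hF.
have px : per F T x by have [_] := Hq 0 (lexx _); rewrite fl0.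
have dall t := per_dom t hF T0 px.
have nu0 n : 0 <= n%:R * u by rewrite mulr_ge0 // ltW.
(* By commutation every return is followed by an equal one. *)
have qn n : fl (sc w F) x (n%:R * u) = fl F x (n%:R * tau).
  elim: n => [|n IH]; first by rewrite !mul0r !fl0.
  have -> : n.+1%:R * u = u + n%:R * u by rewrite -natr1; ring.
  have -> : n.+1%:R * tau = n%:R * tau + tau by rewrite -natr1; ring.
  have [du _] := Hq u (ltW u0); have [dnu _] := Hq (u + n%:R * u) (addr_ge0 (ltW u0) (nu0 n)).
  rewrite -(fl_shift hw du dnu) -E -(fl_shift hF (dall _) (dall _)) -IH.
  have [|_ ->] // := @fl_comm F w x tau (n%:R * u) hF.
  move=> s; rewrite min_l // => /andP[s0 _]; have [ds ps] := Hq s s0.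
  by split => //; exact: per_regular ps.
have [r [L [r0 L0 HL]]] := fl_near_equil hF a0 T0.
have xa : x != a by case: px => + _ _; apply: contra_neq => ->.
have c0 : 0 < cabs (x - a) by rewrite cabs_gt0 subr_eq0.
(* So close to [a] that the orbit through this point stays within |x - a| / 2 of [a], although [x]
   lies on it. *)
have [S S0 HS] := Ha (Num.min r (cabs (x - a) / (2 * L))) ltac:(by rewrite lt_min r0 divr_gt0 // mulr_gt0).
have [n Hn] := archi_mul S u0.
have := HS (n%:R * u) (ltW (le_lt_trans (ler_norm S) Hn)).
have [dn pn] := Hq _ (nu0 n); set y := fl _ _ _ in dn pn *.
rewrite lt_min => /andP[yr]; rewrite ltr_pdivlMr ?mulr_gt0 // => yL.
have [t' ht' Et'] := per_red (- (n%:R * tau)) hF T0 pn.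
have [_ dT _] := pn; have := HL y yr dT t' ht'.
rewrite Et' /y qn; have [_ ->] := fl_back hF (dall (n%:R * tau)).
rewrite -qn -/y; lra.
Qed.

End Periodic.

(** * The period near a center *)

Section Centre.
Variable R : realType.
Local Notation C := (R[i]).
Implicit Types (z w x y : C) (t s h e r T : R) (F : C -> C) (phi psi : R -> C) (J : set R).

Lemma hderiv_linear F a l (eps : R) : hderiv F a l -> F a = 0 -> 0 < eps ->
  exists2 r : R, 0 < r & forall z, cabs (z - a) < r ->
    cabs (F z - (z - a) * l) <= eps * cabs (z - a).
Proof.
move=> Hl a0 e0; have [r r0 Hr] := Hl eps e0.
by exists r => // z /Hr; rewrite subrKC a0 subr0.
Qed.

(** Multiplying by exp(- l t) removes the linear part of the field at [a] and leaves only its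
    remainder. *)
Lemma drift_deriv F a l x t : hol F -> dom F x t ->
  cderiv (fun s => cexp (- l) s * (fl F x s - a)) t
    (cexp (- l) t * (F (fl F x t) - (fl F x t - a) * l)).
Proof.
move=> hF dt; have := cderivM (cderiv_cexp (- l) t) (cderivB (fl_sol hF dt) (cderiv_cst a t)).
congr (cderiv _ _ _); ring.
Qed.

Lemma drift F a l T kap : hol F -> hderiv F a l -> F a = 0 -> 0 < T -> 0 < kap ->
  exists2 r : R, 0 < r & forall x, x != a -> cabs (x - a) < r -> dom F x T ->
    forall t, 0 <= t <= T ->
      cabs (cexp (- l) t * (fl F x t - a) - (x - a)) <= kap * cabs (x - a).
Proof.
move=> hF Hl a0 T0 k0.
(* The Gronwall factor over [0, T] becomes exactly 1 + kap; the linearisation error gets half this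
   rate, for the strict inequality. *)
pose K' := ln (1 + kap) / T.
have K'0 : 0 < K' by rewrite divr_gt0 // ln_gt0 // ltrDl.
have KT : expR (K' * T) = 1 + kap by rewrite /K' divfK ?gt_eqF // lnK // posrE; lra.
have K'2 : 0 < K' / 2 by lra.
have [r r0 Hr] := hderiv_linear Hl a0 K'2.
(* [M] bounds |fl F x t - a| / |x - a| on [0, T], so a start within r / M keeps the orbit where the
   linearisation is accurate. *)
pose M := (1 + kap) * expR (`|Re l| * T).
have M0 : 0 < M by rewrite mulr_gt0 ?expR_gt0 //; lra.
exists (r / M); first exact: divr_gt0.
move=> x xa; rewrite ltr_pdivlMr // => xr dT t0 ht0.
have c0 : 0 < cabs (x - a) by rewrite cabs_gt0 subr_eq0.
have dt u : 0 <= u <= T -> dom F x u by move=> hu; exact: (dom_interval (dom0 x hF) dT hu).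
have eT u : 0 <= u <= T -> expR (K' * (u - 0)) - 1 <= kap.
  move=> /andP[u0 uT]; have : expR (K' * (u - 0)) <= expR (K' * T).
    by rewrite ler_expR ler_pM2l //; lra.
  rewrite KT; lra.
have H := @gronwall_dist _ (fun s => cexp (- l) s * (fl F x s - a)) (x - a) (K' / 2) K' 0 T.
apply: le_trans (_ : _ <= cabs (x - a) * (expR (K' * (t0 - 0)) - 1)) _; last first.
  by rewrite mulrC ler_pM2r // eT.
apply: H => //.
- lra.
- by rewrite subr_eq0.
- by move=> u /dt du; exact: cderiv_cont (drift_deriv a l hF du).
- by rewrite cexp0 mul1r fl0.
- move=> u /andP[u0 uT] Hu; have hu : 0 <= u <= T by rewrite u0 ltW.
  exists (cexp (- l) u * (F (fl F x u) - (fl F x u - a) * l)).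
    exact: drift_deriv (dt u hu).
  rewrite [in X in _ <= _ * X]cabsM cabsM mulrCA ler_wpM2l ?cabs_ge0 //.
  apply: Hr; apply: le_lt_trans xr.
  have h1 : cabs (cexp (- l) u * (fl F x u - a)) <= (1 + kap) * cabs (x - a).
    have := cabs_dist (cexp (- l) u * (fl F x u - a)) (x - a).
    have := ler_wpM2l (ltW c0) (eT u hu); move: Hu; lra.
  rewrite cabsM cabs_cexp in h1.
  have h2 : expR (- (`|Re l| * T)) <= expR (Re (- l) * u).
    rewrite ler_expR raddfN mulNr lerN2; apply: le_trans (ler_norm _) _.
    by rewrite normrM (ger0_norm u0) ler_wpM2l // ltW.
  have h3 : expR (- (`|Re l| * T)) * cabs (fl F x u - a) <= (1 + kap) * cabs (x - a).
    by apply: le_trans h1; rewrite ler_wpM2r ?cabs_ge0.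
  rewrite expRN mulrC ler_pdivrMr ?expR_gt0 // in h3.
  by rewrite mulrC /M; lra.
- exact: ltW.
Qed.

(** The factor exp(k t) cancels the linear decay; a remainder of relative size k / 4 lets the
    product grow at rate at most k / 2, so half of the decay survives. Boundedness then gives
    existence for all positive times. *)
Lemma attract G a k : hol G -> G a = 0 -> hderiv G a (- k)%:C%C -> 0 < k ->
  exists2 r : R, 0 < r & forall x, cabs (x - a) < r -> forall s, 0 <= s ->
    dom G x s /\ cabs (fl G x s - a) <= cabs (x - a) * expR (- (k / 2) * s).
Proof.
move=> hG a0 Hk k0.
have [r r0 Hr] := hderiv_linear Hk a0 (divr_gt0 k0 (ltr0n _ 4)).
exists r => // x xr s s0.
have [->|xa] := eqVneq x a.
  have [ds ->] := fl_equil s hG a0; split => //.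
  by rewrite subrr normc0 mul0r.
have c0 : 0 < cabs (x - a) by rewrite cabs_gt0 subr_eq0.
have bound T : 0 <= T -> dom G x T -> cabs (fl G x T - a) <= cabs (x - a) * expR (- (k / 2) * T).
  move=> T0 dT.
  have dt u : 0 <= u <= T -> dom G x u by move=> hu; exact: (dom_interval (dom0 x hG) dT hu).
  pose l : C := (- k)%:C%C; pose v s := cexp (- l) s * (fl G x s - a).
  have ReL : Re (- l) = k by rewrite /l raddfN /= opprK.
  have vE u : cabs (fl G x u - a) = cabs (v u) * expR (- k * u).
    rewrite /v cabsM cabs_cexp ReL mulNr expRN mulrAC divff ?mul1r //.
    by rewrite gt_eqF ?expR_gt0.
  have vle u : cabs (v u - (x - a)) <= cabs (x - a) * (expR (k / 2 * (u - 0)) - 1) ->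
      cabs (fl G x u - a) <= cabs (x - a) * expR (- (k / 2) * u).
    move=> Hu; have h1 : cabs (v u) <= cabs (x - a) * expR (k / 2 * u).
      have := cabs_dist (v u) (x - a); rewrite subr0 in Hu; lra.
    have E : expR (k / 2 * u) * expR (- k * u) = expR (- (k / 2) * u).
      by rewrite -expRD; congr expR; field.
    rewrite vE; have := ler_wpM2r (expR_ge0 (- k * u)) h1.
    by rewrite -(mulrA (cabs (x - a))) E.
  apply: (vle T); apply: (@gronwall_dist _ v (x - a) (k / 4) (k / 2) 0 T).
  - lra.
  - by rewrite subr_eq0.
  - by move=> ? /dt du; exact: cderiv_cont (drift_deriv a l hG du).
  - by rewrite /v cexp0 mul1r fl0.
  - move=> u /andP[u0 uT] /vle Hu; have hu : 0 <= u <= T by rewrite u0 ltW.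
    exists (cexp (- l) u * (G (fl G x u) - (fl G x u - a) * l)).
      exact: drift_deriv (dt u hu).
    rewrite /v [in X in _ <= _ * X]cabsM cabsM mulrCA ler_wpM2l ?cabs_ge0 //; apply: Hr.
    apply: le_lt_trans Hu _; apply: le_lt_trans xr; rewrite ler_piMr ?(ltW c0) //.
    by rewrite -[leRHS]expR0 ler_expR mulNr oppr_le0 mulr_ge0 //; lra.
  - lra.
  - by rewrite T0 lexx.
have small u : 0 <= u -> dom G x u -> cabs (fl G x u) <= cabs a + cabs (x - a).
  move=> u0 du; have := bound u u0 du; have := cabsD (fl G x u - a) a; rewrite subrK.
  have : cabs (x - a) * expR (- (k / 2) * u) <= cabs (x - a).
    by rewrite ler_piMr ?(ltW c0) // -[leRHS]expR0 ler_expR mulNr oppr_le0 mulr_ge0 //; lra.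
  lra.
have ds : dom G x s.
  have [->|sn0] := eqVneq s 0; first exact: dom0.
  apply: (@fl_extend _ G x s (cabs a + cabs (x - a)) hG).
    by rewrite lt_def sn0.
  by move=> t /andP[t0 _]; exact: small.
by split => //; exact: bound.
Qed.

(* A property that is locally constant on a punctured disc is constant there:
   a convex sector contains a point and its quarter turn, and four sectors
   cover everything. *)
Section Punctured.
Variables (a : C) (r : R) (P : C -> Prop).
Hypothesis Ploc : forall x, x != a -> cabs (x - a) < r ->
  exists2 d : R, 0 < d & forall y, y != a -> cabs (y - a) < r -> cabs (y - x) < d -> (P x <-> P y).

Let dot z w := Re z * Re w + Im z * Im w.

Lemma dotD z w u : dot (z + w) u = dot z u + dot w u.
Proof. by rewrite /dot !raddfD /=; ring. Qed.

Lemma dotZ h z u : dot (h%:C%C * z) u = h * dot z u.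
Proof. by rewrite /dot Re_scal Im_scal; ring. Qed.

Lemma dot_gt0 z : z != 0 -> 0 < dot z z.
Proof.
move=> z0; rewrite /dot -!expr2 lt_def addr_ge0 ?sqr_ge0 // andbT.
apply: contra_neq z0 => /eqP; rewrite paddr_eq0 ?sqr_ge0 // !sqrf_eq0.
by case: z => x y /= /andP[/eqP-> /eqP->].
Qed.

(** The segment misses [a], since the inner product with x - a stays positive along it. *)
Lemma punct_step x y : x != a -> cabs (x - a) < r -> y != a -> cabs (y - a) < r ->
  0 < dot (y - a) (x - a) -> P x -> P y.
Proof.
move=> xa xr ya yr xy Px.
have E0 : on_seg x y 0 = x by rewrite /on_seg mul0r addr0.
have E1 : on_seg x y 1 = y by rewrite /on_seg mul1r subrKC.
rewrite -E1; apply: (@loc_const _ (fun t => P (on_seg x y t)) 0 1 ler01).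
  by rewrite E0.
have segP t : 0 <= t <= 1 -> on_seg x y t != a /\ cabs (on_seg x y t - a) < r.
  move=> ht; split; last first.
    apply: (@le_lt_trans _ _ (Num.max (cabs (x - a)) (cabs (y - a)))); last by rewrite gt_max xr.
    by apply: disc_convex => //; rewrite le_max lexx ?orbT.
  rewrite -subr_eq0; apply/eqP => E; case/andP: ht => t0 t1.
  have : dot (on_seg x y t - a) (x - a) = (1 - t) * dot (x - a) (x - a) + t * dot (y - a) (x - a).
    have -> : on_seg x y t - a = (1 - t)%:C%C * (x - a) + t%:C%C * (y - a).
      by rewrite /on_seg rmorphB rmorph1; ring.
    by rewrite (dotD (_%:C%C * _)) !dotZ.
  rewrite E {1}/dot !mul0r addr0.
  have x0 : 0 < dot (x - a) (x - a) by apply: dot_gt0; rewrite subr_eq0.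
  have h1 : 0 <= (1 - t) * dot (x - a) (x - a) by rewrite mulr_ge0 ?subr_ge0 // ltW.
  have h2 : 0 <= t * dot (y - a) (x - a) by rewrite mulr_ge0 // ltW.
  have [t2|t2] := leP t (1 / 2).
    have : (1 / 2) * dot (x - a) (x - a) <= (1 - t) * dot (x - a) (x - a).
      by rewrite ler_pM2r //; lra.
    lra.
  have : (1 / 2) * dot (y - a) (x - a) < t * dot (y - a) (x - a) by rewrite ltr_pM2r.
  lra.
move=> t ht; have [ta tr] := segP t ht; have [d d0 Hd] := Ploc ta tr.
have k0 : 0 < 1 + cabs (y - x) by rewrite ltr_pwDl ?cabs_ge0.
exists (d / (1 + cabs (y - x))); first exact: divr_gt0.
move=> s hs; rewrite ltr_pdivlMr // => sd; have [sa sr] := segP s hs; apply: Hd => //.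
have -> : on_seg x y s - on_seg x y t = (s - t)%:C%C * (y - x).
  by rewrite /on_seg rmorphB /=; ring.
rewrite cabsM cabs_real; have := normr_ge0 (s - t); lra.
Qed.

(** [punct_step] needs acute angles, so the quarter turn takes two steps, with the factors (1 + i)/2
    and i/2; their moduli are below 1, which keeps the points in the disc. *)
Lemma punct_turn v : v != 0 -> cabs v < r -> P (a + v) ->
  P (a + (0 +i* 2^-1)%C * v).
Proof.
move=> v0 vr Pv.
have n1 : cabs ((2^-1 +i* 2^-1)%C : C) < 1.
  rewrite /= -[ltRHS]sqrtr1 ltr_sqrt ?ltr01 // ; lra.
have n2 : cabs ((0 +i* 2^-1)%C : C) < 1.
  rewrite /= -[ltRHS]sqrtr1 ltr_sqrt ?ltr01 // ; lra.
have c0 : 0 < cabs v by rewrite cabs_gt0.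
have c1 : (2^-1 +i* 2^-1)%C != 0 :> C by rewrite eq_complex /= invr_eq0 pnatr_eq0.
have c2 : (0 +i* 2^-1)%C != 0 :> C by rewrite eq_complex /= invr_eq0 pnatr_eq0 andbF.
have v2 := dot_gt0 v0.
have ne z : z != 0 -> a + z != a by rewrite -[a + z == a]subr_eq0 addrAC subrr add0r.
have sb z : a + z - a = z by rewrite addrAC subrr add0r.
apply: (@punct_step (a + (2^-1 +i* 2^-1)%C * v)); rewrite ?ne ?mulf_neq0 ?sb ?cabsM //.
- by apply: lt_trans vr; rewrite gtr_pMl.
- by apply: lt_trans vr; rewrite gtr_pMl.
- by move: v2; rewrite /dot; case: (v) => p q /=; nra.
apply: (@punct_step (a + v)); rewrite ?ne ?mulf_neq0 ?sb ?cabsM //.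
- by apply: lt_trans vr; rewrite gtr_pMl.
- by move: v2; rewrite /dot; case: (v) => p q /=; nra.
Qed.

Lemma punct_connected x y : x != a -> cabs (x - a) < r -> y != a -> cabs (y - a) < r ->
  P x -> P y.
Proof.
move=> xa xr ya yr Px; pose v := x - a; pose j : C := (0 +i* 2^-1)%C.
have v0 : v != 0 by rewrite subr_eq0.
have sb z : a + z - a = z by rewrite addrAC subrr add0r.
have ne z : z != 0 -> a + z != a by rewrite -[a + z == a]subr_eq0 sb.
have n2 : cabs j < 1 by rewrite /= -[ltRHS]sqrtr1 ltr_sqrt ?ltr01 // ; lra.
have j0 : j != 0 by rewrite eq_complex /= invr_eq0 pnatr_eq0 andbF.
have jr z : z != 0 -> cabs z < r -> j * z != 0 /\ cabs (j * z) < r.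
  move=> z0 zr; rewrite mulf_neq0 //; split => //; rewrite cabsM; apply: lt_trans zr.
  by rewrite gtr_pMl // cabs_gt0.
have P0 : P (a + v) by rewrite /v subrKC.
have P1 := punct_turn v0 xr P0; rewrite -/j in P1; have [v1 r1] := jr _ v0 xr.
have P2 := punct_turn v1 r1 P1; rewrite -/j in P2; have [v2 r2] := jr _ v1 r1.
have P3 := punct_turn v2 r2 P2; rewrite -/j in P3; have [v3 r3] := jr _ v2 r2.
have go z : z != 0 -> cabs z < r -> P (a + z) -> 0 < dot (y - a) z -> P y.
  by move=> z0 zr Pz dz; apply: (@punct_step (a + z)); rewrite ?sb ?ne.
have := dot_gt0 v0.
have := dot_gt0 (_ : y - a != 0); rewrite subr_eq0 => /(_ ya).
move: (go v v0 xr P0) (go _ v1 r1 P1) (go _ v2 r2 P2) (go _ v3 r3 P3).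
rewrite /dot /j; case: (v) => p q; case: (y - a) => p' q' /= h0 h1 h2 h3 y2 x2.
have [c|c] := ltP 0 (p' * p + q' * q); first exact: h0.
have [c'|c'] := ltP (p' * p + q' * q) 0; first by apply: h2; lra.
have cE : p' * p + q' * q = 0 by lra.
have [d|d] := ltP 0 (q' * p - p' * q); first by apply: h1; lra.
have [d'|d'] := ltP (q' * p - p' * q) 0; first by apply: h3; lra.
exfalso.
have dE : q' * p - p' * q = 0 by lra.
(* Lagrange's identity: inner product and determinant of two nonzero vectors cannot both vanish. *)
have : (p' * p' + q' * q') * (p * p + q * q) = 
  (p' * p + q' * q) * (p' * p + q' * q) + (q' * p - p' * q) * (q' * p - p' * q) by ring.
rewrite cE dE !mul0r addr0 => /eqP; rewrite mulf_eq0 !gt_eqF //.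
Qed.

End Punctured.

End Centre.

(** * The linearisation determines the period *)

Section CentrePeriod.
Variable R : realType.
Local Notation C := (R[i]).
Implicit Types (z w x y : C) (t s h e r T : R).
Variables (F : C -> C) (a l : C) (rU : R).
Hypotheses (hF : hol F) (Hl : hderiv F a l) (a0 : F a = 0) (rU0 : 0 < rU).
Hypothesis Hper : forall x, x != a -> cabs (x - a) < rU -> exists2 T : R, 0 < T & per F T x.
(** The metric trace of [a] lying inside the orbits around it, supplied by [jordan_int_far]. *)
Hypothesis Hsurr : forall x, x != a -> cabs (x - a) < rU ->
  forall b, exists t, cabs (a - b) <= cabs (fl F x t - b).

Lemma per_punct T x y : x != a -> cabs (x - a) < rU -> per F T x ->
  y != a -> cabs (y - a) < rU -> per F T y.
Proof.
move=> xa xr pT ya yr; apply: (@punct_connected _ a rU (per F T) _ x) => // {xa xr pT ya yr}.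
move=> {}x xa xr; have [T' T'0 px] := Hper xa xr.
have [x0 _ _] := px; have dT := per_dom T hF T'0 px.
have [d d0 Hd] := per_loc hF x0 dT; exists d => // {}y _ _ /Hd[y0 dy H].
by split=> -[_ _ E]; split => //; apply/H.
Qed.

Lemma punct_ex e : 0 < e -> exists x, [/\ x != a, cabs (x - a) < rU & cabs (x - a) < e].
Proof.
move=> e0; pose d := Num.min rU e / 2.
have m0 : 0 < Num.min rU e by rewrite lt_min rU0.
have d0 : 0 < d by rewrite /d; lra.
have E : a + d%:C%C - a = d%:C%C by rewrite addrAC subrr add0r.
exists (a + d%:C%C); rewrite -[_ == a]subr_eq0 E -cabs_gt0 cabs_real gtr0_norm // d0.
have : d < Num.min rU e by rewrite /d; lra.
by rewrite lt_min => /andP[].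
Qed.

Lemma common_period : exists2 T : R, 0 < T &
  forall x, x != a -> cabs (x - a) < rU -> per F T x.
Proof.
have [x [xa xr _]] := punct_ex ltr01; have [T T0 pT] := Hper xa xr.
by exists T => // y; exact: per_punct xa xr pT.
Qed.

(** [drift] with arbitrarily small [kap]: the orbit returns to [x] after [T], so the linear flow has
    to return as well. *)
Lemma centre_cexp T : 0 < T -> (forall x, x != a -> cabs (x - a) < rU -> per F T x) ->
  cexp (- l) T = 1.
Proof.
move=> T0 HT; apply: cabs_small_eq => e e0.
have [r r0 Hr] := drift hF Hl a0 T0 e0.
have [x [xa xr1 xr2]] := punct_ex r0; have [_ dT E] := HT x xa xr1.
have := Hr x xa xr2 dT T ltac:(by rewrite lexx ltW); rewrite E.
have -> : cexp (- l) T * (x - a) - (x - a) = (cexp (- l) T - 1) * (x - a) by ring.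
by rewrite cabsM ler_pM2r // cabs_gt0 subr_eq0.
Qed.

Lemma centre_Re : Re l = 0.
Proof.
have [T T0 HT] := common_period; have := centre_cexp T0 HT.
move=> /(congr1 (@normc R)); rewrite cabs_cexp normc1 -[RHS]expR0 => /expR_inj /eqP.
by rewrite raddfN mulf_eq0 (gt_eqF T0) orbF oppr_eq0 => /eqP.
Qed.

(** For l = 0 an orbit close to [a] stays within |x - a| / 2 of [x], while [Hsurr] with b = x gives
    a point at distance at least |x - a|. *)
Lemma centre_Im : Im l != 0.
Proof.
apply/eqP => I0; have [T T0 HT] := common_period.
have l0 : l = 0 by apply/eqP; rewrite eq_complex centre_Re I0 !eqxx.
have [r r0 Hr] := drift hF Hl a0 T0 (ltac:(lra) : 0 < 1 / 2).
have [x [xa xr1 xr2]] := punct_ex r0; have pT := HT x xa xr1; have [_ dT _] := pT.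
have [t Ht] := Hsurr xa xr1 x; have [t' ht' E] := per_red t hF T0 pT.
have := Hr x xa xr2 dT t' ht'; rewrite l0 oppr0.
have -> : cexp 0 t' = 1 :> C by rewrite /cexp !mul0r expR0 cos0 sin0 mulr0 mul1r addr0.
have -> : 1 * (fl F x t' - a) - (x - a) = fl F x t' - x by ring.
rewrite E; rewrite cabsC in Ht.
have : 0 < cabs (x - a) by rewrite cabs_gt0 subr_eq0.
lra.
Qed.

(** As l = i Im l, this is |2 pi i / l|, the period of the linearised flow. *)
Definition centre_T : R := 2 * pi / `|Im l|.
Definition centre_dir : C := (Num.sg (Im l))%:C%C * 'i%C.
Local Notation T0 := centre_T.
Local Notation sig := centre_dir.

Lemma centre_T_gt0 : 0 < T0.
Proof. by rewrite divr_gt0 ?normr_gt0 ?centre_Im // mulr_gt0 // pi_gt0. Qed.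

Lemma cexp_centre_T : cexp (- l) T0 = 1.
Proof.
have I0 := centre_Im.
rewrite /cexp !raddfN /= centre_Re oppr0 mul0r expR0 mulNr cosN sinN.
have -> : Im l * T0 = Num.sg (Im l) * (pi *+ 2).
  by rewrite /centre_T {1}(numEsg (Im l)) mulr2n; field; rewrite normr_eq0.
have [->|->] : Num.sg (Im l) = 1 \/ Num.sg (Im l) = -1.
  by case: sgrP I0 => // _ _; [left|right].
- by rewrite mul1r cos2pi sin2pi oppr0 mulr0 addr0 mulr1.
- by rewrite mulN1r cosN sinN cos2pi sin2pi !oppr0 mulr0 addr0 mulr1.
Qed.

(* The field [sig F] is a quarter turn of [F], hence points towards [a]. *)
Lemma centre_attract : exists r : R, [/\ 0 < r, r <= rU &
  forall x, x != a -> cabs (x - a) < r ->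
    [/\ forall s, 0 <= s -> dom (sc sig F) x s /\ fl (sc sig F) x s != a,
        forall s, 0 <= s -> cabs (fl (sc sig F) x s - a) <= cabs (x - a) &
        forall e, 0 < e -> exists2 S : R, 0 <= S &
          forall s, S <= s -> cabs (fl (sc sig F) x s - a) < e]].
Proof.
have hG := hol_sc sig hF; have G0 : sc sig F a = 0 by rewrite /sc a0 mulr0.
have I0 : 0 < `|Im l| by rewrite normr_gt0 centre_Im.
have H : hderiv (sc sig F) a (- `|Im l|)%:C%C.
  have := hderivZ sig Hl; congr (hderiv _ _ _).
  have : l = 'i%C * (Im l)%:C%C by rewrite {1}(complexE l) centre_Re rmorph0 add0r.
  rewrite /centre_dir; generalize (Im l) => m ->.
  have i2 : 'i%C * 'i%C = -1 :> C by rewrite -expr2 sqr_i.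
  transitivity ('i%C * 'i%C * ((Num.sg m)%:C%C * m%:C%C) : C); first by ring.
  by rewrite i2 mulN1r -rmorphM -rmorphN normrEsg.
have [r r0 Hr] := attract hG G0 H I0.
exists (Num.min r rU); split; rewrite ?lt_min ?r0 ?ge_min ?lexx ?orbT //.
move=> x xa; rewrite lt_min => /andP[xr xU].
set k := `|Im l| in I0 Hr.
have c0 : 0 < cabs (x - a) by rewrite cabs_gt0 subr_eq0.
have sig0 : sig != 0.
  rewrite mulf_neq0 //; last by rewrite eq_complex /= oner_eq0 andbF.
  by rewrite -cabs_eq0 cabs_real normr_eq0 sgr_eq0 centre_Im.
split=> [s s0|s s0|e e0].
- have [ds _] := Hr x xr s s0; split => //; have [T _ [x0 _ _]] := Hper xa xU.
  have : sc sig F (fl (sc sig F) x s) != 0 by apply: fl_neq0 => //; rewrite mulf_neq0.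
  by apply: contra_neq => ->.
- have [_ H2] := Hr x xr s s0; apply: le_trans H2 _; rewrite ler_piMr ?(ltW c0) //.
  by rewrite -[leRHS]expR0 ler_expR mulNr oppr_le0 mulr_ge0 //; lra.
- have q0 : 0 <= 2 / k * (cabs (x - a) / e).
    by rewrite mulr_ge0 // divr_ge0 ?ler0n ?(ltW I0) ?(ltW c0) ?(ltW e0).
  (* By exp(y) >= 1 + y with y = k s / 2, the decay factor is below e / |x - a| from this time
     on. *)
  exists (2 / k * (cabs (x - a) / e)) => // s Ss; have s0 : 0 <= s by exact: le_trans Ss.
  have [_ H2] := Hr x xr s s0; apply: le_lt_trans H2 _.
  rewrite mulNr expRN ltr_pdivrMr ?expR_gt0 //.
  have h1 := expR_ge1Dx (k / 2 * s).
  have h2 : cabs (x - a) / e <= k / 2 * s.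
    have := ler_wpM2l (ltac:(lra) : 0 <= k / 2) Ss.
    by have -> : k / 2 * (2 / k * (cabs (x - a) / e)) = cabs (x - a) / e by field; rewrite !gt_eqF.
  rewrite ler_pdivrMr // in h2.
  have := ler_wpM2l (ltW e0) h1; lra.
Qed.

(** The point [p] reached after [T0] is [x] moved by a small complex time [w]. Split [w] into Re w
    along [F] and [u] along [sig F]: the intermediate point [y] lies on the [F]-orbit and on the
    [sig F]-orbit of [x], so [no_return] forces u = 0. *)
Lemma centre_return d : 0 < d -> exists tau x,
  [/\ x != a, cabs (x - a) < rU, `|tau| <= d & fl F x (T0 - tau) = x].
Proof.
move=> d0; have [T T_gt0 HT] := common_period; have T00 := centre_T_gt0.
have [rA [rA0 rAU HA]] := centre_attract.
pose A := cabs l; have A0 : 0 < A.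
  by rewrite cabs_gt0; apply: contra_neq centre_Im => ->.
(* The box around [x] has radius X / 8, proportional to the distance to [a], because [F] shrinks
   linearly there; with relative error A / 16 the field varies on it by at most half its size. *)
have A16 : 0 < A / 16 by lra.
have [r1 r10 H1] := hderiv_linear Hl a0 A16.
(* The first bound brings [p] within an eighth of the box radius, as [box_onto] requires; the second
   makes |w| at most [d]. *)
pose kap := Num.min (1 / 128) (A * d / 4).
have Ad : 0 < A * d by rewrite mulr_gt0.
have kap0 : 0 < kap by rewrite lt_min; apply/andP; split; lra.
have [r2 r20 H2] := drift hF Hl a0 T00 kap0.
pose r := Num.min (rA / 2) (Num.min (r1 / 2) r2).
have r0 : 0 < r by rewrite !lt_min r20 !divr_gt0.
have [x [xa xU]] := punct_ex r0; rewrite !lt_min => /and3P[xA x1 x2].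
set X := cabs (x - a) in xU xA x1 x2.
have X0 : 0 < X by rewrite cabs_gt0 subr_eq0.
have px := HT x xa xU; have dall t := per_dom t hF T_gt0 px; have [x0 _ _] := px.
pose p := fl F x T0.
have px1 : cabs (p - x) <= kap * X.
  have := H2 x xa x2 (dall _) T0 ltac:(by rewrite lexx ltW).
  rewrite cexp_centre_T; have -> // : 1 * (fl F x T0 - a) - (x - a) = p - x by rewrite /p; ring.
have Fb z : cabs (z - a) < r1 -> cabs (F z) <= 17 / 16 * (A * cabs (z - a)) /\
    15 / 16 * (A * cabs (z - a)) <= cabs (F z).
  move=> /H1 h; have := cabsD (F z - (z - a) * l) ((z - a) * l); rewrite subrK.
  have := cabs_dist ((z - a) * l) ((z - a) * l - F z); rewrite subKr.
  rewrite (cabsC ((z - a) * l)) cabsM mulrC -/A; split; lra.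
have xr1 : cabs (x - a) < r1 by rewrite -/X; lra.
have [_ Fx] := Fb x xr1; rewrite -/X in Fx.
have AX : 0 < A * X by rewrite mulr_gt0.
have X8 : 0 < X / 8 by lra.
have [|G [g B]] := @flow_box_ex _ F x (X / 8) X8 x0 (fun z _ => hF z).
  move=> z zx.
  have za1 : cabs (z - a) <= 9 / 8 * X by have := cabs_tri x z a; rewrite -/X; lra.
  have za2 : 7 / 8 * X <= cabs (z - a).
    by have := cabs_tri z x a; rewrite -/X (cabsC x); lra.
  have zr1 : cabs (z - a) < r1 by lra.
  have [_ Fz] := Fb z zr1.
  have e1 := H1 z zr1; have e2 := H1 x xr1; rewrite -/X in e2.
  have := ler_wpM2l (ltW A0) za2; have := ler_wpM2l (ltW A0) za1.
  have : A * cabs (z - x) <= A * (X / 8) by rewrite ler_wpM2l // ltW.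
  have -> : F z - F x = (F z - (z - a) * l) - (F x - (x - a) * l) + (z - x) * l by ring.
  have := cabsD ((F z - (z - a) * l) - (F x - (x - a) * l)) ((z - x) * l).
  have := cabsB (F z - (z - a) * l) (F x - (x - a) * l).
  rewrite (cabsM (z - x)) -/A; lra.
have k1 : kap <= 1 / 128 by rewrite ge_min lexx.
have k2 : kap <= A * d / 4 by rewrite ge_min lexx orbT.
have kX : kap * X <= 1 / 128 * X by rewrite ler_pM2r.
have kX2 : kap * X <= A * d / 4 * X by rewrite ler_pM2r.
have p8 : cabs (p - x) < X / 8 / 8 by lra.
have [w [gw wr wd]] := box_onto B p8.
set rho := X / 8 / (4 * cabs (F x)) in wr.
have Fx0 : 0 < cabs (F x) by rewrite cabs_gt0.
have w_d : cabs w <= d.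
  apply: le_trans wd _; rewrite ler_pdivrMr //.
  have := ler_wpM2l (ltW d0) Fx; have := mulr_gt0 d0 AX; lra.
pose sg : R := Num.sg (Im l); have sg2 : sg * sg = 1.
  by rewrite /sg -expr2 sqr_sg centre_Im.
pose u := sg * Im w.
have uE : u%:C%C * sig = 'i%C * (Im w)%:C%C.
  rewrite /centre_dir -/sg /u rmorphM /=.
  transitivity ((sg%:C%C * sg%:C%C) * ('i%C * (Im w)%:C%C) : C); first by ring.
  by rewrite -rmorphM sg2 rmorph1 mul1r.
have cu : cabs (u%:C%C * sig) < rho.
  apply: le_lt_trans wr; rewrite uE cabsM cabs_real.
  have -> : cabs ('i%C : C) = 1 by rewrite /= expr0n /= add0r expr1n sqrtr1.
  by rewrite mul1r; exact: cabs_Im.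
have rho0 := box_rho_gt0 B; rewrite -/rho in rho0.
have [du] := @box_fl _ F x _ G g 0 sig u hF B ltac:(by rewrite normc0) ltac:(by rewrite add0r).
rewrite (box_g0 B) add0r in du *; set y := g _ => yE.
have [dy] := @box_fl _ F x _ G g (u%:C%C * sig) 1 (Re w) hF B cu
  ltac:(by rewrite mulr1 uE addrC -complexE).
rewrite mulr1 uE addrC -complexE gw -uE -/y sc1 in dy * => ytp.
have yE2 : y = fl F x (T0 - Re w).
  have [_] := fl_back hF dy; rewrite ytp /p fl_shift // => <-.
have Rew : `|Re w| <= d by apply: le_trans (cabs_Re w) w_d.
have attr z s : z != a -> cabs (z - a) < rA -> 0 <= s ->
    dom (sc sig F) z s /\ per F T (fl (sc sig F) z s).
  move=> za zA s0; have [h1 h2 _] := HA z za zA; have [ds sa] := h1 s s0.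
  split => //; apply: HT => //; apply: le_lt_trans (h2 s s0) _; exact: lt_le_trans zA rAU.
have xA' : cabs (x - a) < rA by rewrite -/X; lra.
exists (Re w), x; split => //.
have [u0|u0|u0] := ltrgt0P u.
- exfalso; have [_ _ h3] := HA x xa xA'.
  apply: (@no_return _ F sig a T x u (T0 - Re w) hF a0 T_gt0 _ h3 u0).
    by move=> s; exact: attr.
  by rewrite -yE2 yE.
(* For negative [u] the roles of [x] and [y] are exchanged, so that the time along [sig F] is
   positive. *)
- exfalso.
  have yx : cabs (y - x) < X / 8 by have [] := box_g B cu.
  have yA : cabs (y - a) < rA by have := cabs_tri x y a; rewrite -/X; lra.
  have ya : y != a.
    by rewrite -subr_eq0 -cabs_gt0; have := cabs_tri y x a; rewrite -/X cabsC; lra.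
  have [_ _ h3] := HA y ya yA.
  apply: (@no_return _ F sig a T y (- u) (- (T0 - Re w)) hF a0 T_gt0 _ h3).
  + by move=> s; exact: attr.
  + by rewrite oppr_gt0.
  + have [_] := fl_back (hol_sc sig hF) du; rewrite yE => ->.
    by have [_] := fl_back hF (dall (T0 - Re w)); rewrite -yE2.
- by rewrite -yE2 /y u0 rmorph0 mul0r (box_g0 B).
Qed.

(** [centre_return] makes T0 - tau a period of some point, hence of [x] by [per_punct]; letting tau
    tend to 0, continuity gives the period [T0]. *)
Lemma centre_period_T x : x != a -> cabs (x - a) < rU -> per F T0 x.
Proof.
move=> xa xU; have [T T_gt0 HT] := common_period; have T00 := centre_T_gt0.
have px := HT x xa xU; have [x0 _ _] := px; have dall t := per_dom t hF T_gt0 px.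
split => //; apply: cabs_small_eq => e e0.
have [d d0 Hd] := cderiv_cont (fl_sol hF (dall T0)) e0.
have [tau [z [za zU tau_d E]]] := centre_return (ltac:(lra) : 0 < d / 2).
have pz : per F (T0 - tau) z.
  have pz' := HT z za zU; have [z0 _ _] := pz'.
  by split => //; exact: per_dom pz'.
have [_ _ Ex] := per_punct za zU pz xa xU.
have := Hd (- tau); rewrite normrN Ex cabsC => H; apply/ltW/H; lra.
Qed.

End CentrePeriod.

(** * The center basin and its frontier *)

Section PlaneTopology.
Variable R : realType.
Local Notation C := (R[i]).
Local Notation Co := (R[i]^o).
Implicit Types (z w x y b : C) (U K : set Co) (e M : R).

Lemma nbhs_cabs z U : nbhs (z : Co) U <->
  exists2 e : R, 0 < e & forall w, cabs (w - z) < e -> U w.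
Proof.
split.
  move=> /nbhs_ballP[e /= e0 He].
  have eE : e = (Re e)%:C%C by case: (e) e0 => p q; rewrite ltcE /= => /andP[/eqP->].
  exists (Re e); first by rewrite eE ltcR in e0.
  move=> w wz; apply: He; rewrite -ball_normE /= eE normE ltcR -cabsN opprB //.
move=> [e e0 He]; apply/nbhs_ballP; exists e%:C%C; first by rewrite /= ltcR.
by move=> w; rewrite -ball_normE /= normE ltcR cabsC; exact: He.
Qed.

Lemma open_cabs U : open U <-> forall z, U z ->
  exists2 e : R, 0 < e & forall w, cabs (w - z) < e -> U w.
Proof.
rewrite openE; split=> [oU z Uz|H z Uz]; first exact/nbhs_cabs/oU.
by rewrite /interior; apply/nbhs_cabs/H.
Qed.

Lemma closure_cabs U z : closure U z <->
  forall e, 0 < e -> exists2 w, U w & cabs (w - z) < e.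
Proof.
split=> [cU e e0|H B /nbhs_cabs[e e0 He]].
  have [|w [Uw wz]] := cU [set w | cabs (w - z) < e]; last by exists w.
  by apply/nbhs_cabs; exists e.
by have [w Uw wz] := H e e0; exists w; split => //; exact: He.
Qed.

Lemma bounded_cabs U : bounded_set U <-> exists M, forall z, U z -> cabs z <= M.
Proof.
split=> [/ex_strict_bound_gt0[M _ HM]|[M HM]].
  by exists (Re M) => z Uz; have := HM z Uz; rewrite /= normE ltcE => /andP[_ /ltW].
exists M%:C%C; split; first by rewrite complex_real.
move=> x Mx z Uz /=; apply: le_trans (ltW Mx).
by rewrite normE lecR; exact: HM.
Qed.

Lemma path_connected (g : R -> C) (s t : R) :
  (forall u, s <= u <= t -> ccont g u) -> connected ((g : R -> Co) @` `[s, t]).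
Proof.
move=> gc; apply: connected_continuous_connected; first exact: segment_connected.
apply: continuous_in_subspaceT => u; rewrite inE /= in_itv /= => /gc cu.
move=> B /nbhs_cabs[e e0 He]; have [d d0 Hd] := cu e e0.
apply/nbhs_ballP; exists d => // v; rewrite -ball_normE /= distrC => vu.
by apply: He; have := Hd (v - u) vu; rewrite subrKC.
Qed.

Lemma component_path (g : R -> C) (s t : R) K : s <= t ->
  (forall u, s <= u <= t -> ccont g u) -> (forall u, s <= u <= t -> K (g u)) ->
  connected_component K (g s) (g t).
Proof.
move=> st gc gK.
apply: (@connected_component_max _ _ ((g : R -> Co) @` `[s, t])).
- by exists s; rewrite //= in_itv /= lexx.
- by move=> _ [u + <-]; rewrite /= in_itv /=; exact: gK.
- exact: path_connected.
- by exists t; rewrite //= in_itv /= lexx andbT.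
Qed.

Lemma ccont_affine z w t : ccont (fun s => z + s%:C%C * w) t.
Proof. exact: cderiv_cont (cderiv_affine z w t). Qed.

(* Otherwise the ray from [a] away from [b] avoids [G]. *)
Lemma jordan_int_far (G : set Co) (a b : C) : jordan_int G a -> G !=set0 ->
  exists2 z, G z & cabs (a - b) <= cabs (z - b).
Proof.
move=> [nGa bK] [z0 Gz0]; apply: contrapT => nH.
have Gb z : G z -> cabs (z - b) < cabs (a - b).
  by move=> Gz; rewrite ltNge; apply/negP => h; apply: nH; exists z.
have c0 : 0 < cabs (a - b) by apply: le_lt_trans (Gb _ Gz0); exact: cabs_ge0.
have /bounded_cabs[M HM] := bK.
pose g s := a + s%:C%C * (a - b).
have gK s : 0 <= s -> connected_component (~` G) a (g s).
  move=> s0; have {1}-> : a = g 0 by rewrite /g mul0r addr0.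
  apply: component_path => // u /andP[u0 us]; first exact: ccont_affine.
  move=> /Gb; have -> : g u - b = (1 + u)%:C%C * (a - b).
    by rewrite /g rmorphD rmorph1; ring.
  rewrite cabsM cabs_real ger0_norm ?addr_ge0 //.
  have := mulr_ge0 u0 (ltW c0); lra.
pose s := (`|M| + cabs a + 1) / cabs (a - b).
have s0 : 0 <= s by rewrite divr_ge0 ?cabs_ge0 // !addr_ge0 ?cabs_ge0.
have := HM _ (gK s s0); rewrite /g => h1.
have := cabs_dist (s%:C%C * (a - b)) (- a); rewrite cabsN opprK cabsM cabs_real ger0_norm //.
rewrite /s divfK ?gt_eqF // addrC; have := ler_norm M; rewrite addrC in h1; rewrite addrC.
move: h1; rewrite /s; lra.
Qed.

(* The component is contained in any set that is open and relatively closed. *)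
Lemma jordan_intI (G D : set Co) (a : C) : ~ G a -> D a ->
  (forall z, D z -> exists2 e : R, 0 < e & forall w, cabs (w - z) < e -> D w) ->
  (forall z, ~ D z -> ~ G z -> exists2 e : R, 0 < e & forall w, cabs (w - z) < e -> ~ D w) ->
  (exists M, forall z, D z -> cabs z <= M) -> jordan_int G a.
Proof.
move=> nGa Da oD cD [M HM]; split => //; apply/bounded_cabs; exists M.
pose K := connected_component (~` G) a.
suff KD : K `&` D = K by move=> z; rewrite -/K -KD => -[_]; exact: HM.
apply: component_connected.
- by exists a; split => //; exact: connected_component_refl.
- by exists D => //; exact/open_cabs.
(* The closure of [D], as the complement of the points with a neighbourhood free of [D]. *)
- exists (~` [set z | exists2 e : R, 0 < e & forall w, cabs (w - z) < e -> ~ D w]).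
    apply: open_closedC; apply/open_cabs => z [e e0 He].
    exists (e / 2); first by rewrite divr_gt0.
    move=> w wz; exists (e / 2); first by rewrite divr_gt0.
    move=> v vw; apply: He; have := cabs_tri w v z; lra.
  apply/seteqP; split=> z [Kz Hz]; split => //.
    by move=> [e e0 He]; apply: (He z) => //; rewrite subrr normc0.
  apply: contrapT => nD; apply: Hz; apply: cD => //.
  exact: connected_component_sub Kz.
Qed.

End PlaneTopology.

(** * Disjoint intervals on a line and on a circle *)

Section Packing.
Variable R : realType.
Variable I : eqType.
Implicit Types (s : seq I) (l r L : I -> R) (T : R).

Lemma seq_argmin (f : I -> R) s : s != [::] ->
  exists2 i, i \in s & forall j, j \in s -> f i <= f j.
Proof.
elim: s => // i s IH _; have [->|/IH[j js Hj]] := eqVneq s [::].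
  by exists i; [rewrite mem_head|move=> j; rewrite inE => /eqP->].
have [ij|ji] := leP (f i) (f j).
  exists i; first exact: mem_head.
  by move=> k; rewrite inE => /orP[/eqP->//|/Hj]; exact: le_trans.
exists j; first by rewrite inE js orbT.
by move=> k; rewrite inE => /orP[/eqP->|/Hj //]; exact: ltW.
Qed.

Lemma seq_unif (P : I -> R -> Prop) s :
  (forall i e e', P i e -> 0 < e' <= e -> P i e') ->
  (forall i, i \in s -> exists2 e : R, 0 < e & P i e) ->
  exists2 e : R, 0 < e & forall i, i \in s -> P i e.
Proof.
move=> mono; elim: s => [|i s IH] H; first by exists 1.
have [e e0 He] := H i (mem_head _ _).
have [e' e'0 He'] := IH (fun j js => H j (mem_behead (s := i :: s) js)).
have m0 : 0 < Num.min e e' by rewrite lt_min e0.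
exists (Num.min e e') => // j; rewrite inE => /orP[/eqP->|/He' Pj].
  by apply: mono He _; rewrite m0 ge_min lexx.
by apply: mono Pj _; rewrite m0 ge_min lexx orbT.
Qed.

(** Peel off the interval with the largest left end: by disjointness the others end before it
    starts. *)
Lemma packing s l r (A B : R) : uniq s -> A <= B ->
  (forall i, i \in s -> [/\ A <= l i, l i <= r i & r i <= B]) ->
  (forall i j t, i \in s -> j \in s -> i != j -> l i <= t <= r i -> l j <= t <= r j -> False) ->
  \sum_(i <- s) (r i - l i) <= B - A.
Proof.
elim: {s}(size s) {-2}s (erefl (size s)) B => [|n IH] s sn B us AB H D.
  by rewrite (size0nil sn) big_nil subr_ge0.
have s0 : s != [::] by rewrite -size_eq0 sn.
have [i is_ Hi] := seq_argmin (fun i => - l i) s0.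
have [Al lr rB] := H i is_; rewrite (big_rem i) //=.
have := IH (rem i s) _ (l i) (rem_uniq _ us) Al.
rewrite size_rem // sn => /(_ (erefl _)) IH'.
have : \sum_(j <- rem i s) (r j - l j) <= l i - A.
  apply: IH' => [j|j k t].
    rewrite mem_rem_uniq // inE => /andP[ji js]; have [h1 h2 h3] := H j js; split => //.
    rewrite leNgt; apply/negP => lir; apply: (D i j (l i)) => //; first by rewrite eq_sym.
      by rewrite lexx.
    by rewrite (ltW lir) andbT; have := Hi j js; rewrite lerN2.
  by rewrite !mem_rem_uniq // !inE => /andP[_ js] /andP[_ ks]; exact: D.
lra.
Qed.

(** Reduce the left ends modulo [T] and cut the circle at the least of them: an interval running
    past the end of this window would contain the cut point modulo [T], hence meet the interval that
    starts there. *)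
Lemma packing_mod s l L T : uniq s -> 0 < T ->
  (forall i, i \in s -> 0 <= L i < T) ->
  (forall i j (k : int) t, i \in s -> j \in s -> i != j -> l i <= t <= l i + L i ->
     l j <= t + k%:~R * T <= l j + L j -> False) ->
  \sum_(i <- s) L i <= T.
Proof.
move=> us T0 HL D; have [->|s0] := eqVneq s [::]; first by rewrite big_nil ltW.
pose k i := Num.floor (l i / T); pose l' i := l i - (k i)%:~R * T.
have l'T i : 0 <= l' i < T.
  have := floor_itv (l i / T); rewrite -/(k i) => /andP[k1 k2].
  have k3 : (k i)%:~R * T <= l i by rewrite -ler_pdivlMr.
  have k4 : l i < (k i)%:~R * T + T by move: k2; rewrite intrD mulr1z ltr_pdivrMr //; lra.
  by rewrite /l'; apply/andP; split; lra.
have D' i j (n : int) t : i \in s -> j \in s -> i != j -> l' i <= t <= l' i + L i ->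
    l' j <= t + n%:~R * T <= l' j + L j -> False.
  move=> is_ js ij /andP[h1 h2] /andP[h3 h4].
  apply: (D i j (n - k i + k j) (t + (k i)%:~R * T)) => //.
    by rewrite /l' in h1 h2; apply/andP; split; lra.
  rewrite !(intrD, intrN) /=; rewrite /l' in h3 h4; apply/andP; split; lra.
have [m ms Hm] := seq_argmin l' s0.
have /andP[m0 mT] := l'T m.
have -> : \sum_(i <- s) L i = \sum_(i <- s) ((l' i + L i) - l' i).
  by apply: eq_bigr => i _; rewrite addrAC subrr add0r.
have -> : T = (l' m + T) - l' m by ring.
apply: packing => //; first by rewrite lerDl ltW.
- move=> i is_; have /andP[L0 LT] := HL i is_; have /andP[i0 iT] := l'T i.
  split; [exact: Hm|by rewrite lerDl|].
  have [->|im] := eqVneq i m; first by have /andP[_] := HL m ms; lra.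
  rewrite leNgt; apply/negP => h; apply: (D' i m (-1) (l' m + T)) => //.
    by apply/andP; split; lra.
  rewrite mulrN1z mulN1r addrK lexx lerDl.
  by have /andP[] := HL m ms.
- move=> i j t is_ js ij h1 h2; apply: (D' i j 0 t) => //.
  by rewrite mul0r addr0.
Qed.

End Packing.

(** * The annulus of periodic orbits, the basin and its frontier *)

Section Basin.
Variable R : realType.
Local Notation C := (R[i]).
Implicit Types (z w x y : C) (t s h u v : R).

Lemma reach_rev P (G : C -> C) x s : hol G -> reach P G x s -> reach P G (fl G x s) (- s).
Proof.
move=> hG H v hv; have [ds _] := H s (between_s s).
have [] := H (s + v); last first.
  by move=> dv Pv; have [h1 h2] := fl_shift_sub hG ds dv; rewrite h2.
move: hv; rewrite !ge_min !le_max => /andP[/orP h1 /orP h2].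
by apply/andP; split; apply/orP; case: h1; case: h2; lra.
Qed.

Variables (F : C -> C) (a x0 : C) (T r e : R).
Let sig : C := e%:C%C * 'i%C.
Local Notation G := (sc sig F).
Hypotheses (hF : hol F) (a0 : F a = 0) (T0 : 0 < T) (e2 : e * e = 1).
Hypothesis Hper : forall x, x != a -> cabs (x - a) < r -> per F T x.
Hypothesis Hatt : forall x, x != a -> cabs (x - a) < r ->
    [/\ forall s, 0 <= s -> dom G x s /\ fl G x s != a,
        forall s, 0 <= s -> cabs (fl G x s - a) <= cabs (x - a) &
        forall eps, 0 < eps -> exists2 S : R, 0 <= S &
          forall s, S <= s -> cabs (fl G x s - a) < eps].
Hypotheses (x0a : x0 != a) (x0r : cabs (x0 - a) < r).

Let hG : hol G := hol_sc sig hF.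
Let q s : C := fl G x0 s.
Let J s := reach (per F T) G x0 s.

(* The trajectory [q] of the orthogonal field moves from [x0] towards [a]; [J]
   consists of the times up to which it only crosses [T]-periodic orbits.
   [annulus] will turn out to be the basin without [a], and [inner s] the
   interior of the orbit through [q s]. *)
Definition annulus y := exists s t, J s /\ y = fl F (q s) t.
Definition inner s y := y = a \/ exists s' t, s < s' /\ y = fl F (q s') t.

Let attP x s : x != a -> cabs (x - a) < r -> 0 <= s -> dom G x s /\ per F T (fl G x s).
Proof.
move=> xa xr s0; have [h1 h2 _] := Hatt xa xr; have [ds sa] := h1 s s0.
by split => //; apply: Hper => //; exact: le_lt_trans (h2 s s0) xr.
Qed.

Let att_reach x s : x != a -> cabs (x - a) < r -> 0 <= s -> reach (per F T) G x s.
Proof.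
by move=> xa xr s0 u; rewrite min_l // => /andP[u0 _]; exact: attP.
Qed.

Let J_ge s s' : J s -> s <= s' -> J s'.
Proof.
move=> Js ss'; have [s'0|s'0] := leP 0 s'; first exact: att_reach.
have J0 : J 0 by exact: att_reach.
by apply: (reach_interval Js J0); rewrite ss' ltW.
Qed.

Let J_dom s : J s -> dom G x0 s.
Proof. by move=> /(_ s (between_s s))[]. Qed.

Let J_per s : J s -> per F T (q s).
Proof. by move=> /(_ s (between_s s))[]. Qed.

Lemma annulus_per y : annulus y -> per F T y.
Proof. by move=> [s [t [Js ->]]]; apply: fl_per => //; exact: J_per. Qed.

Lemma annulus_fl y t : annulus y -> annulus (fl F y t).
Proof.
move=> [s [u [Js ->]]]; exists s, (u + t); split => //.
by rewrite fl_shift //; apply: per_dom (J_per Js).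
Qed.

Lemma reach_regular x s t : reach (per F T) G x s -> reach (regular F t) G x s.
Proof. by move=> H u /H[du pu]; split => //; exact: per_regular pu. Qed.

(** Commutation slides the trajectory of [z] back along the [F]-flow onto [q], which thereby is
    continued to s0 + s. *)
Lemma orbit_shift s0 t z s : J s0 -> z = fl F (q s0) t -> reach (per F T) G z s ->
  J (s0 + s) /\ fl G z s = fl F (q (s0 + s)) t.
Proof.
move=> Js0 zE Hs; have dall u := per_dom u hF T0 (J_per Js0).
have key u : Num.min 0 s <= u <= Num.max 0 s ->
    [/\ dom G x0 (s0 + u), q (s0 + u) = fl F (fl G z u) (- t) & per F T (q (s0 + u))].
  move=> hu; have Hu := reach_sub Hs hu.
  have [d1 E1] := fl_comm hF (reach_regular (- t) Hu).
  have [_ zq] := fl_back hF (dall t); rewrite -zE in zq; rewrite zq in d1 E1.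
  have ds0 := J_dom Js0; have du : dom G x0 (s0 + u) by apply/(dom_shift _ hG ds0).
  have E : q (s0 + u) = fl F (fl G z u) (- t) by rewrite -E1 /q (fl_shift hG ds0 du).
  split => //; rewrite E; apply: fl_per => //.
  by have [_] := Hu u (between_s u).
have [d1 E1 p1] := key s (between_s s); split.
  move=> v hv; have [hv0|hv0] := boolP (Num.min 0 s0 <= v <= Num.max 0 s0).
    exact: Js0.
  have [] := key (v - s0); last by rewrite subrKC.
  move: hv hv0; rewrite !ge_min !le_max negb_and !negb_or -!ltNge.
  move=> /andP[/orP h1 /orP h2] /orP h3; apply/andP; split; apply/orP;
  by case: h1 => h1; case: h2 => h2; case: h3 => /andP[h3 h4]; lra.
have [_ pz] := Hs s (between_s s).
have [_] := fl_back hF (per_dom (- t) hF T0 pz).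
by rewrite opprK -E1 => ->.
Qed.

Lemma annulus_shift z s : annulus z -> reach (per F T) G z s -> annulus (fl G z s).
Proof.
move=> [s0 [t [Js0 zE]]] Hs; have [Js E] := orbit_shift Js0 zE Hs.
by exists (s0 + s), t.
Qed.

(** In the box at [y] the coordinate of y' splits into a part along [sig] and a real part, that is,
    a move across the orbits followed by one along an orbit. *)
Lemma near_per y eps : per F T y -> 0 < eps -> exists2 d : R, 0 < d &
  forall y', cabs (y' - y) < d -> exists u tau,
    [/\ `|u| < eps, reach (per F T) G y u & y' = fl F (fl G y u) tau].
Proof.
move=> py eps0; have [y0 _ _] := py.
have [d d0 Hd] := per_open hF py; have [rb [g0 [g B]]] := hol_box hF y0.
have Fy := box_Fy_gt0 B; have rb0 := box_pos B; have rho0 := box_rho_gt0 B.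
pose rho := rb / (4 * cabs (F y)).
pose m := Num.min (rb / 8) (Num.min (eps * cabs (F y) / 2) (d / 4)).
exists m; first by rewrite !lt_min !divr_gt0 ?mulr_gt0.
move=> y'; rewrite !lt_min => /and3P[/(box_onto B)[w [gw wr wd]] h1 h2].
have we : cabs w < eps by apply: le_lt_trans wd _; rewrite ltr_pdivrMr //; lra.
have wd2 : 2 * cabs (F y) * cabs w < d.
  rewrite ler_pdivlMr // in wd; lra.
have i1 : cabs ('i%C : C) = 1 by rewrite /= expr0n /= add0r expr1n sqrtr1.
have en : `|e| = 1.
  have : `|e| * `|e| = 1 by rewrite -normrM e2 normr1.
  have := normr_ge0 e; nra.
have csig v : cabs (v%:C%C * sig) = `|v|.
  by rewrite /sig !cabsM !cabs_real i1 en !mulr1.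
pose u := e * Im w.
have uE : u%:C%C * sig = 'i%C * (Im w)%:C%C.
  rewrite /sig /u rmorphM /=.
  transitivity ((e%:C%C * e%:C%C) * ('i%C * (Im w)%:C%C) : C); first by ring.
  by rewrite -rmorphM e2 rmorph1 mul1r.
have uw : `|u| <= cabs w by rewrite /u normrM en mul1r cabs_Im.
have bx v : `|v| <= cabs w -> dom G y v /\ fl G y v = g (v%:C%C * sig).
  move=> vw; have := @box_fl _ F y rb g0 g 0 sig v hF B.
  rewrite (box_g0 B) add0r csig normc0; apply => //; exact: le_lt_trans vw wr.
have cu : cabs (u%:C%C * sig) < rho by rewrite csig; exact: le_lt_trans uw wr.
exists u, (Re w); split.
- exact: le_lt_trans uw we.
- move=> v /andP[v1 v2]; have vu : `|v| <= `|u|.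
    have := ler_norm u; have := ler_norm (- u); rewrite normrN ler_norml.
    move: v1 v2; rewrite ge_min le_max => /orP v1 /orP v2.
    by case: v1 => v1; case: v2 => v2 h3 h4; apply/andP; split; lra.
  have vw := le_trans vu uw; have [dv ->] := bx v vw; split => //.
  apply: Hd; have cv : cabs (v%:C%C * sig) < rho by rewrite csig; exact: le_lt_trans vw wr.
  have := box_g_lip B cv (_ : cabs 0 < rho); rewrite normc0 (box_g0 B) subr0 csig => H.
  apply: le_lt_trans (H rho0) _; apply: le_lt_trans wd2.
  by rewrite ler_wpM2l // mulr_ge0 ?cabs_ge0.
- have [_ ->] := bx u uw.
  have := @box_fl _ F y rb g0 g (u%:C%C * sig) 1 (Re w) hF B cu.
  by rewrite mulr1 uE addrC -complexE gw sc1 => /(_ wr)[_ ->].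
Qed.

(** Stated at every [T]-periodic point, in the annulus or not: the annulus is clopen among these
    points. *)
Lemma annulus_loc y : per F T y -> exists2 d : R, 0 < d &
  forall y', cabs (y' - y) < d -> (annulus y <-> annulus y').
Proof.
move=> py; have [d d0 Hd] := near_per py ltr01; exists d => // y' /Hd[u [tau [_ Hu ->]]].
have [du pu] := Hu u (between_s u).
split=> [Ay|Ay']; first by apply: annulus_fl; exact: annulus_shift.
have Az : annulus (fl G y u).
  by have [_ <-] := fl_back hF (per_dom tau hF T0 pu); exact: annulus_fl.
have := annulus_shift Az (reach_rev hG Hu).
by have [_ ->] := fl_back hG du.
Qed.

Lemma annulus_punct x : x != a -> cabs (x - a) < r -> annulus x.
Proof.
move=> xa xr; apply: (@punct_connected _ a r annulus _ x0) => //; last first.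
  by exists 0, 0; split; [exact: att_reach|rewrite /q !fl0].
move=> {xa xr}x xa xr; have [d d0 Hd] := annulus_loc (Hper xa xr).
by exists d => // y _ _ /Hd.
Qed.

Lemma q_tail eps : 0 < eps -> exists2 S : R, 0 <= S &
  forall s t, S <= s -> cabs (fl F (q s) t - a) < eps.
Proof.
move=> eps0; have [r1 [L [r10 L0 HL]]] := fl_near_equil hF a0 T0.
have [_ _ H] := Hatt x0a x0r.
have [|S S0 HS] := H (Num.min r1 (eps / L)); first by rewrite lt_min r10 divr_gt0.
exists S => // s t Ss; have := HS s Ss; rewrite lt_min -/(q s) => /andP[h1].
rewrite ltr_pdivlMr // => h2; have s0 := le_trans S0 Ss.
have [_ ps] := attP x0a x0r s0; rewrite -/(q s) in ps; have [_ dT _] := ps.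
have [t' ht' <-] := per_red t hF T0 ps.
apply: le_lt_trans (HL _ h1 dT t' ht') _; lra.
Qed.

(** Compactness of the closed band of orbits between [q s1] and [q s2]: [unif_interval] over one
    period, then over [s], with [fl_cont] passing to neighbouring orbits. *)
Lemma orbit_unif (good : C -> R -> Prop) s1 s2 : J s1 -> s1 <= s2 ->
  (forall z k k', good z k -> 0 < k' <= k -> good z k') ->
  (forall s t, s1 <= s <= s2 -> exists d k : R, [/\ 0 < d, 0 < k &
     forall z, cabs (z - fl F (q s) t) < d -> good z k]) ->
  exists2 k : R, 0 < k & forall s t, s1 <= s <= s2 -> good (fl F (q s) t) k.
Proof.
move=> J1 s12 mono loc.
have Js s : s1 <= s <= s2 -> J s by move=> /andP[h _]; exact: J_ge h.
have [| |k k0 Hk] := @unif_interval R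
  (fun s k => forall t, 0 <= t <= T -> good (fl F (q s) t) k) s1 s2 s12.
- by move=> s k k' H hk t ht; apply: mono hk; exact: H.
- move=> s0 hs0; have J0 := Js _ hs0; have p0 := J_per J0.
  have dall t := per_dom t hF T0 p0.
  have [| |k k0 Hk] := @unif_interval R
    (fun t k => forall z, cabs (z - fl F (q s0) t) < k -> good z k) 0 T (ltW T0).
  + move=> t k k' H hk z hz; apply: mono (hk); apply: H; apply: lt_le_trans hz _.
    by case/andP: hk.
  + move=> t0 _; have [d [k [d0 k0 H]]] := loc s0 t0 hs0.
    have [d1 d10 H1] := cderiv_cont (fl_sol hF (dall t0)) (ltac:(lra) : 0 < d / 2).
    exists d1, (Num.min (d / 2) k); split; rewrite ?lt_min ?k0 ?andbT //; first lra.
    move=> t _ tt z; rewrite lt_min => /andP[z1 _].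
    apply: (mono z k); last by rewrite lt_min k0 ge_min lexx orbT andbT; lra.
    apply: H; have := H1 (t - t0) tt; rewrite subrKC.
    have := cabs_tri (fl F (q s0) t) z (fl F (q s0) t0); lra.
  have [z0 dT _] := p0.
  have [d d0 Hd] := fl_cont hF z0 (ltac:(by rewrite lexx ltW) : 0 <= 0 <= T) (dom0 _ hF) dT k0.
  have [d1 d10 H1] := cderiv_cont (fl_sol hG (J_dom J0)) d0.
  exists d1, k; split => // s _ ss t ht; apply: (Hk t ht).
  have := H1 (s - s0) ss; rewrite subrKC => qs.
  by have [_] := Hd _ qs t ht.
- exists k => // s t hs; have [t' ht' <-] := per_red t hF T0 (J_per (Js s hs)).
  exact: Hk.
Qed.

(** Beyond some [S] the orbits are close to [a] by [q_tail]; what remains is a compact band.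
    [inner_closed] uses the same splitting. *)
Lemma inner_bounded s : J s -> exists M : R, forall y, inner s y -> cabs y <= M.
Proof.
move=> Js; have [S S0 HS] := q_tail ltr01.
have [| | |k k0 Hk] := @orbit_unif (fun z k => cabs z <= k^-1) s (Num.max s S) Js.
- by rewrite le_max lexx.
- move=> z k k' /le_trans H /andP[k'0 kk]; apply: H.
  by rewrite lef_pV2 // posrE // (lt_le_trans k'0).
- move=> s' t _; pose M := cabs (fl F (q s') t) + 1.
  have M0 : 0 < M by rewrite ltr_wpDl ?cabs_ge0.
  exists 1, M^-1; split; rewrite ?invr_gt0 // => z hz; rewrite invrK.
  have := cabs_dist z (fl F (q s') t); rewrite /M; lra.
exists (Num.max k^-1 (cabs a + 1)) => y [->|[s' [t [ss' ->]]]].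
  by rewrite le_max lerDl ler01 orbT.
rewrite le_max; have [Ss|sS] := leP S s'.
  have := HS s' t Ss; have := cabs_dist (fl F (q s') t) a => h1 h2.
  by apply/orP; right; lra.
by rewrite Hk // (ltW ss') le_max (ltW sS) orbT.
Qed.

Lemma inner_closed s y : J s -> ~ inner s y -> (forall t, y <> fl F (q s) t) ->
  exists2 d : R, 0 < d & forall y', cabs (y' - y) < d -> ~ inner s y'.
Proof.
move=> Js nD nG.
have ya : y != a by apply/eqP => E; apply: nD; left.
have c0 : 0 < cabs (y - a) by rewrite cabs_gt0 subr_eq0.
have [S S0 HS] := q_tail (ltac:(lra) : 0 < cabs (y - a) / 2).
have [| | |k k0 Hk] := @orbit_unif (fun z k => k <= cabs (z - y)) s (Num.max s S) Js.
- by rewrite le_max lexx.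
- by move=> z k k' H /andP[_ h]; exact: le_trans h H.
- move=> s' t /andP[ss' _]; pose d := cabs (fl F (q s') t - y).
  have d0 : 0 < d.
    rewrite cabs_gt0 subr_eq0; apply/eqP => E; move: ss'; rewrite le_eqVlt => /orP[/eqP ss|ss].
      by apply: (nG t); rewrite ss E.
    by apply: nD; right; exists s', t.
  exists (d / 2), (d / 2); split; rewrite ?divr_gt0 // => z zd.
  by have := cabs_tri z (fl F (q s') t) y; rewrite -/d (cabsC _ z); lra.
exists (Num.min k (cabs (y - a) / 4)); first by rewrite lt_min k0 divr_gt0.
move=> y'; rewrite lt_min => /andP[yk ya4] [y'a|[s' [t [ss' y'E]]]].
  by move: ya4; rewrite y'a cabsC; lra.
have [Ss|sS] := leP S s'.
  have := HS s' t Ss; rewrite -y'E; have := cabs_tri y' y a; rewrite (cabsC y y'); lra.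
have : k <= cabs (y' - y) by rewrite y'E Hk // (ltW ss') le_max (ltW sS) orbT.
lra.
Qed.

Lemma inner_open s y : J s -> inner s y ->
  exists2 d : R, 0 < d & forall y', cabs (y' - y) < d -> inner s y'.
Proof.
move=> Js [->|[s' [t [ss' yE]]]]; last first.
  have Js' := J_ge Js (ltW ss'); have ps' := J_per Js'.
  have py : per F T y by rewrite yE; exact: fl_per.
  have ss0 : 0 < s' - s by rewrite subr_gt0.
  have [d d0 Hd] := near_per py ss0; exists d => // y' /Hd[u [tau [us Hu ->]]].
  have [Ju ->] := orbit_shift Js' yE Hu; right; exists (s' + u), (t + tau); split.
    by move: us; rewrite ltr_norml => /andP[]; lra.
  by rewrite fl_shift //; apply: per_dom (J_per Ju).
have qa : q s != a.
  by have [+ _ _] := J_per Js; apply: contra_neq => ->.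
have c0 : 0 < cabs (q s - a) by rewrite cabs_gt0 subr_eq0.
have r0 : 0 < r by apply: le_lt_trans x0r; exact: cabs_ge0.
have [r1 [L [r10 L0 HL]]] := fl_near_equil hF a0 T0.
exists (Num.min r (Num.min r1 (cabs (q s - a) / L))); first by rewrite !lt_min r0 r10 divr_gt0.
move=> {}y; rewrite !lt_min => /and3P[yr yr1]; rewrite ltr_pdivlMr // => yL.
have [->|ya] := eqVneq y a; first by left.
have [s' [t [Js' yE]]] := annulus_punct ya yr.
(* If s' <= s, moving [y] inwards for the time s - s' keeps it close to [a] and puts it on the orbit
   of [q s], which would then pass too close to [a] to contain [q s]. *)
right; exists s', t; split => //; rewrite ltNge; apply/negP => s's.
have v0 : 0 <= s - s' by rewrite subr_ge0.
have Hv := att_reach ya yr v0.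
have [Jv vE] := orbit_shift Js' yE Hv; rewrite subrKC in vE.
have [_ pv] := attP ya yr v0; have [_ dT _] := pv.
have [_ h2 _] := Hatt ya yr; have := h2 _ v0 => h3.
have [t' ht' E'] := per_red (- t) hF T0 pv.
have := HL _ (le_lt_trans h3 yr1) dT t' ht'.
rewrite E' vE; have [_ ->] := fl_back hF (per_dom t hF T0 (J_per Js)).
have := ler_wpM2l (ltW L0) h3; rewrite -vE; lra.
Qed.

Lemma inner_annulus s y : J s -> inner s y -> y = a \/ annulus y.
Proof.
move=> Js [->|[s' [t [ss' ->]]]]; [by left|right].
by exists s', t; split => //; exact: J_ge (ltW ss').
Qed.

Lemma annulus_open y : y = a \/ annulus y ->
  exists2 d : R, 0 < d & forall y', cabs (y' - y) < d -> y' = a \/ annulus y'.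
Proof.
move=> [->|Ay].
  exists r; first by apply: le_lt_trans x0r; exact: cabs_ge0.
  move=> y' yr; have [->|ya] := eqVneq y' a; [by left|right].
  exact: annulus_punct.
have [d d0 Hd] := annulus_loc (annulus_per Ay); exists d => // y' /Hd H.
by right; apply/H.
Qed.


Lemma per_orbit T' y z : 0 < T' -> per F T' y ->
  solution_orbit F y z <-> exists t, z = fl F y t.
Proof.
move=> T'0 py; split=> [[t _ <-]|[t ->]]; first by exists t.
by exists t => //; exact: per_dom py.
Qed.

Lemma solution_orbit_fl y t : dom F y t -> solution_orbit F (fl F y t) = solution_orbit F y.
Proof.
move=> dt; apply/seteqP; split=> z [s ds <-].
  have dts : dom F y (t + s) by apply/(dom_shift _ hF dt).
  by exists (t + s) => //; have := fl_shift hF dt dts; rewrite /fl => ->.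
have dts : dom F (fl F y t) (s - t) by apply/(dom_shift _ hF dt); rewrite subrKC.
by exists (s - t) => //; have := fl_shift hF dt (t := s - t); rewrite subrKC; apply.
Qed.

Lemma per_periodic T' y : 0 < T' -> per F T' y -> periodic_orbit F y.
Proof.
move=> T'0 py; have [y0 _ _] := py; split => //.
  by apply/seteqP; split=> // t _; exact: (per_dom t hF T'0 py).
exists T' => // t.
have := (per_dom_nat 1 t hF py).2 (per_dom t hF T'0 py); rewrite mul1r.
exact.
Qed.

Lemma periodic_per y : periodic_orbit F y -> exists2 T' : R, 0 < T' & per F T' y.
Proof.
move=> [y0 dT [T' T'0 H]]; exists T' => //; split => //; first by rewrite /dom dT.
by have := H 0; rewrite add0r -!/(fl F y _) fl0.
Qed.

Lemma annulus_in_basin y : annulus y -> center_basin F a y.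
Proof.
move=> Ay; have py := annulus_per Ay; right; split; first exact: per_periodic py.
case: Ay => s [t [Js yE]]; have ps := J_per Js.
rewrite yE solution_orbit_fl; last exact: per_dom ps.
have orbE z := per_orbit z T0 ps.
apply: (@jordan_intI _ (solution_orbit F (q s)) (inner s)).
- move=> /orbE[u aE]; have [qs0 _ _] := ps.
  by have := fl_neq0 hF qs0 (per_dom u hF T0 ps); rewrite -aE a0 eqxx.
- by left.
- by move=> z; exact: inner_open.
- move=> z nz nG; apply: inner_closed => // u zE.
  by apply: nG; apply/orbE; exists u.
- exact: inner_bounded.
Qed.

Definition annulus_limit y := forall d, 0 < d -> exists2 y', annulus y' & cabs (y' - y) < d.

Lemma limit_regular y : y != a -> annulus_limit y -> F y != 0.
Proof.
move=> ya ly; apply/eqP => y0; have [r1 [L [r10 L0 HL]]] := fl_near_equil hF y0 T0.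
have c0 : 0 < cabs (a - y) by rewrite cabs_gt0 subr_eq0 eq_sym.
have [|y' Ay' ] := ly (Num.min r1 (cabs (a - y) / L)); first by rewrite lt_min r10 divr_gt0.
rewrite lt_min => /andP[yr]; rewrite ltr_pdivlMr // => yL.
have py := annulus_per Ay'; have [_ dT _] := py.
have [y'a|[_ jG]] := annulus_in_basin Ay'.
  by have [+ _ _] := py; rewrite y'a a0 eqxx.
have [|z [t _ <-] Hz] := jordan_int_far y jG.
  by exists (fl F y' 0), 0 => //; exact: per_dom py.
have [t' ht' E] := per_red t hF T0 py.
have := HL _ yr dT t' ht'; rewrite E /fl; move: Hz; lra.
Qed.

(** Nearby annulus points are [T]-periodic, so [y] is, by the equivalence in [per_loc]; then
    [annulus_loc] applies at [y] itself. *)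
Lemma limit_annulus y : annulus_limit y -> F y != 0 -> dom F y T -> annulus y.
Proof.
move=> ly y0 dT; have [d d0 Hd] := per_loc hF y0 dT.
have [y' Ay' y'd] := ly d d0; have [_ _ H] := Hd y' y'd.
have [_ _ py'] := annulus_per Ay'.
have py : per F T y by split => //; exact/H.
have [d' d'0 Hd'] := annulus_loc py; have [y2 Ay2 y2d] := ly d' d'0.
by apply/(Hd' y2).
Qed.

Lemma limit_fl y t : annulus_limit y -> F y != 0 -> dom F y t -> annulus_limit (fl F y t).
Proof.
move=> ly y0 dt d d0; have [dm dM] := dom_between hF dt.
have [d' d'0 Hd'] := fl_cont hF y0 (between0 t) dm dM d0.
have [y' Ay' y'd] := ly d' d'0; have [_ H] := Hd' y' y'd t (between_s t).
by exists (fl F y' t) => //; exact: annulus_fl.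
Qed.

(** In a bounded annulus the solutions through limit points are bounded, so they last for the time
    [T] and stay in the annulus. Together with [a] it would be clopen and contain a whole ray from
    [a]. *)
Lemma annulus_unbounded : ~ exists M : R, forall y, annulus y -> cabs y <= M.
Proof.
move=> [M HM].
have cl y : annulus_limit y -> y = a \/ annulus y.
  move=> ly; have [->|ya] := eqVneq y a; [by left|right].
  have y0 := limit_regular ya ly; apply: limit_annulus => //.
  apply: (@fl_extend _ F y T (M + 1) hF T0) => t _ dt.
  have [y' Ay' y'd] := limit_fl ly y0 dt ltr01.
  have := HM _ Ay'; have := cabs_dist (fl F y t) y'; rewrite cabsC; lra.
pose W z := z = a \/ annulus z.
have Wloc z : exists2 d : R, 0 < d & forall z', cabs (z' - z) < d -> (W z <-> W z').
  have [Wz|nWz] := pselect (W z).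
    by have [d d0 Hd] := annulus_open Wz; exists d => // z' /Hd.
  have za : z != a by apply/eqP => E; apply: nWz; left.
  have c0 : 0 < cabs (a - z) by rewrite cabs_gt0 subr_eq0 eq_sym.
  have : ~ annulus_limit z by move=> /cl.
  move=> /existsNP[d /not_implyP[d0 nH]].
  exists (Num.min d (cabs (a - z))); first by rewrite lt_min d0.
  move=> z'; rewrite lt_min => /andP[z1 z2]; split => // -[z'a|Az'].
    by rewrite z'a ltxx in z2.
  by exfalso; apply: nH; exists z'.
pose N := `|M| + cabs a + 1.
have N0 : 0 < N by rewrite ltr_wpDl // addr_ge0 ?cabs_ge0.
have : W (a + N%:C%C).
  apply: (@loc_const _ (fun u => W (a + u%:C%C)) 0 N (ltW N0)).
    by left; rewrite rmorph0 addr0.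
  move=> u _; have [d d0 Hd] := Wloc (a + u%:C%C); exists d => // s _ su.
  apply: Hd; have -> : a + s%:C%C - (a + u%:C%C) = (s - u)%:C%C by rewrite rmorphB /=; ring.
  by rewrite cabs_real.
case=> [/eqP|/HM].
  rewrite -subr_eq0 addrAC subrr add0r -cabs_eq0 cabs_real normr_eq0 gt_eqF //.
have := cabs_dist (N%:C%C) (- a); rewrite opprK cabsN cabs_real gtr0_norm // [_ + a]addrC.
have := ler_norm M; rewrite /N; lra.
Qed.

(** The orbit of a point outside the annulus never meets the annulus, which thus lies in the
    component of [a] in the complement of this orbit; that component is bounded, the annulus is
    not. *)
Lemma basin_sub_annulus x : center_basin F a x -> x = a \/ annulus x.
Proof.
move=> [->|[perx [nGa bK]]]; first by left.
right; apply: contrapT => nAx; have [T' T'0 px] := periodic_per perx.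
have dall t := per_dom t hF T'0 px; have [xF _ _] := px.
set Gam := solution_orbit F x in nGa bK.
have AG y : annulus y -> ~ Gam y.
  move=> Ay [t dt yE]; apply: nAx; have [_ <-] := fl_back hF (dall t).
  by rewrite /fl yE; exact: annulus_fl.
pose K := connected_component (~` Gam).
have J0 : J 0 by exact: att_reach.
apply: annulus_unbounded; have /bounded_cabs[M HM] := bK; exists M => y Ay; apply: HM.
(* [a] is joined to [y] by a segment to [q S], then along [q] to [q s], then along [F]. Taking [S]
   nonnegative keeps the segment in the disc around [a]. *)
case: (Ay) => s [t [Js yE]]; pose S := Num.max s 0.
have S0 : 0 <= S by rewrite le_max lexx orbT.
have sS : s <= S by rewrite le_max lexx.
have JJ u : s <= u -> J u by exact: J_ge.
have annq u v : s <= u -> annulus (fl F (q u) v) by move=> su; exists u, v; split => //; exact: JJ.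
have h1 : K a (q S).
  have E0 : on_seg a (q S) 0 = a by rewrite /on_seg mul0r addr0.
  have E1 : on_seg a (q S) 1 = q S by rewrite /on_seg mul1r subrKC.
  have := @component_path _ (on_seg a (q S)) 0 1 (~` Gam) ler01; rewrite E0 E1; apply.
    by move=> u _; exact: ccont_affine.
  move=> u /andP[u0 u1].
  have [-> //|ua] := eqVneq (on_seg a (q S) u) a.
  apply: AG; apply: annulus_punct => //.
  have -> : on_seg a (q S) u - a = u%:C%C * (q S - a) by rewrite /on_seg; ring.
  have [_ h2 _] := Hatt x0a x0r.
  rewrite cabsM cabs_real ger0_norm //; apply: le_lt_trans x0r; apply: le_trans (h2 S S0).
  by rewrite ler_piMl ?cabs_ge0.
have h2 : K (q s) (q S).
  apply: (@component_path _ q s S) => // u /andP[su _]; first exact: cderiv_cont (fl_sol hG (J_dom (JJ u su))).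
  by have := AG _ (annq u 0 su); rewrite fl0.
have ps := J_per Js; have [t' /andP[t'0 _] E'] := per_red t hF T0 ps.
have h3 : K (q s) y.
  have := @component_path _ (fl F (q s)) 0 t' (~` Gam) t'0; rewrite fl0 // E' -yE; apply => u _.
    exact: cderiv_cont (fl_sol hF (per_dom u hF T0 ps)).
  by apply: AG; exact: annq.
exact: connected_component_trans h1 (connected_component_trans (connected_component_sym h2) h3).
Qed.

Lemma basinE x : center_basin F a x <-> x = a \/ annulus x.
Proof.
split; first exact: basin_sub_annulus.
by case=> [->|]; [left|exact: annulus_in_basin].
Qed.

Lemma frontierE x : frontier (center_basin F a) x <->
  [/\ x != a, ~ annulus x & annulus_limit x].
Proof.
have intE z : interior (center_basin F a) z <-> z = a \/ annulus z.
  split=> [/interior_subset/basinE //|/annulus_open[d d0 Hd]].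
  by apply/nbhs_cabs; exists d => // w /Hd /basinE.
split=> [[/closure_cabs cx nx]|[xa nx lx]].
  have {}nx : ~ (x = a \/ annulus x) by move=> /intE.
  have xa : x != a by apply/eqP => E; apply: nx; left.
  split => //; first by move=> Ax; apply: nx; right.
  move=> d d0; have c0 : 0 < cabs (a - x) by rewrite cabs_gt0 subr_eq0 eq_sym.
  have [|w /basinE Ww] := cx (Num.min d (cabs (a - x))); first by rewrite lt_min d0.
  rewrite lt_min => /andP[wd wa]; exists w => //.
  by case: Ww => // wE; rewrite wE ltxx in wa.
split; first by apply/closure_cabs => d d0; have [w Aw wd] := lx d d0; exists w => //; apply/basinE; right.
by move=> /intE[/eqP|//]; rewrite (negPf xa).
Qed.

Lemma frontier_regular x : frontier (center_basin F a) x -> F x != 0.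
Proof. by move=> /frontierE[xa _ lx]; exact: limit_regular. Qed.

Lemma frontier_fl x t : frontier (center_basin F a) x -> dom F x t ->
  frontier (center_basin F a) (fl F x t).
Proof.
move=> fx dt; have x0' := frontier_regular fx.
have /frontierE[xa nx lx] := fx; apply/frontierE; split.
- have := fl_neq0 hF x0' dt; apply: contra_neq => -> //.
- move=> Ay; apply: nx; have [_ <-] := fl_back hF dt; exact: annulus_fl.
- exact: limit_fl.
Qed.

(* A separatrix that lasted for the time [T] would close up. *)
Lemma frontier_short x s t : frontier (center_basin F a) x -> dom F x s -> dom F x t ->
  t - s < T.
Proof.
move=> fx ds dt; rewrite ltNge; apply/negP => Tts.
have fy := frontier_fl fx ds; have y0 := frontier_regular fy.
have /frontierE[ya nAy ly] := fy; apply: nAy; apply: limit_annulus => //.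
have dts : dom F (fl F x s) (t - s) by apply/(dom_shift _ hF ds); rewrite subrKC.
by apply: (dom_interval (dom0 _ hF) dts); rewrite Tts ltW.
Qed.

(* [inner s] is open, and closed off the orbit of [q s]: a segment that leaves
   it meets this orbit. *)
Lemma orbit_crossing s s' t x : J s -> s <= s' -> ~ inner s x -> exists u v,
  fl F (q s) u = on_seg (fl F (q s') t) x v /\ 0 <= v <= 1.
Proof.
move=> Js; rewrite le_eqVlt => /orP[/eqP ss|ss] nx.
  by exists t, 0; rewrite ss /on_seg mul0r addr0 lexx ler01.
pose y := fl F (q s') t; apply: contrapT => nH; apply: nx.
have E1 : on_seg y x 1 = x by rewrite /on_seg mul1r subrKC.
rewrite -E1; apply: (@loc_const _ (fun v => inner s (on_seg y x v)) 0 1 ler01).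
  by right; exists s', t; split => //; rewrite /on_seg mul0r addr0.
move=> v hv.
have [d d0 Hd] : exists2 d : R, 0 < d & forall z, cabs (z - on_seg y x v) < d ->
    (inner s (on_seg y x v) <-> inner s z).
  have [iv|niv] := pselect (inner s (on_seg y x v)).
    by have [d d0 Hd] := inner_open Js iv; exists d => // z /Hd.
  have [|d d0 Hd] := inner_closed Js niv.
    by move=> u E; apply: nH; exists u, v.
  by exists d => // z /Hd.
have k0 : 0 < 1 + cabs (x - y) by rewrite ltr_pwDl ?cabs_ge0.
exists (d / (1 + cabs (x - y))); first exact: divr_gt0.
move=> w _; rewrite ltr_pdivlMr // => wv; apply: Hd.
have -> : on_seg y x w - on_seg y x v = (w - v)%:C%C * (x - y).
  by rewrite /on_seg rmorphB /=; ring.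
rewrite cabsM cabs_real; have := normr_ge0 (w - v); lra.
Qed.


Lemma per_int T' y (k : int) t : 0 < T' -> per F T' y ->
  fl F y (t + k%:~R * T') = fl F y t.
Proof.
move=> T'0 py; have dall u := per_dom u hF T'0 py.
case: k => n; first exact: (per_dom_nat n t hF py).2.
have := (per_dom_nat n.+1 (t + (Negz n)%:~R * T') hF py).2 (dall _).
rewrite NegzE mulrNz mulNr -[_ *~ Posz n.+1]/(n.+1%:R) subrK.
by move=> ->.
Qed.

(** Two compact pieces of distinct orbits are disjoint, hence at positive distance. *)
Lemma frontier_separated x y s t s' t' :
  dom F x s -> dom F x t -> dom F y s' -> dom F y t' -> s <= 0 <= t -> s' <= 0 <= t' ->
  (forall u, dom F x u -> fl F x u <> y) ->
  exists2 d : R, 0 < d & forall u v, s <= u <= t -> s' <= v <= t' ->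
    d <= cabs (fl F x u - fl F y v).
Proof.
move=> ds dt ds' dt' /andP[s0 t0] /andP[s'0 t'0] nxy.
have dx u : s <= u <= t -> dom F x u by move=> hu; exact: (dom_interval ds dt hu).
have dy v : s' <= v <= t' -> dom F y v by move=> hv; exact: (dom_interval ds' dt' hv).
have mono (k k' c : R) : k <= c -> 0 < k' <= k -> k' <= c.
  by move=> kc /andP[_ h]; exact: le_trans h kc.
have [| | |d d0 Hd] := @unif_interval R
  (fun u d => forall v, s' <= v <= t' -> d <= cabs (fl F x u - fl F y v)) s t.
- exact: le_trans s0 t0.
- by move=> u k k' H hk v hv; apply: mono hk; exact: H.
- move=> u0 hu0.
  have [| | |d d0 Hd] := @unif_interval R
    (fun v d => forall u, s <= u <= t -> `|u - u0| < d -> d <= cabs (fl F x u - fl F y v)) s' t'.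
  + exact: le_trans s'0 t'0.
  + move=> v k k' H hk u hu uk; apply: mono (hk); apply: H => //.
    by case/andP: hk => _; exact: lt_le_trans.
  + move=> v0 hv0; pose c := cabs (fl F x u0 - fl F y v0).
    have c0 : 0 < c.
      rewrite cabs_gt0 subr_eq0; apply/eqP => E.
      have [dv yE] := fl_back hF (dy v0 hv0).
      rewrite -E in dv yE; have du := dx u0 hu0.
      have duv : dom F x (u0 - v0) by apply/(dom_shift _ hF du).
      by apply: (nxy (u0 - v0) duv); rewrite -(fl_shift hF du duv).
    have c4 : 0 < c / 4 by lra.
    have [d1 d10 H1] := cderiv_cont (fl_sol hF (dx u0 hu0)) c4.
    have [d2 d20 H2] := cderiv_cont (fl_sol hF (dy v0 hv0)) c4.
    exists d2, (Num.min d1 (c / 2)); split => //; first by rewrite lt_min d10; lra.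
    move=> v hv vd u hu; rewrite lt_min => /andP[ud _].
    have := H1 (u - u0) ud; have := H2 (v - v0) vd; rewrite !subrKC => h2 h1.
    have := cabs_tri (fl F x u) (fl F x u0) (fl F y v0).
    have := cabs_tri (fl F y v) (fl F x u) (fl F y v0).
    rewrite -/c (cabsC (fl F x u0)) => h3 h4; rewrite ge_min; apply/orP; right; lra.
  + by exists d, d; split => // u hu ud v hv; exact: Hd.
- by exists d => // u v hu hv; exact: Hd.
Qed.

(* One periodic orbit close enough to the frontier passes near all the given
   separatrices, following each for nearly its whole length; the passages are
   disjoint and fit into one period. *)
Lemma frontier_sum (I : eqType) (s : seq I) (x : I -> C) (al be : I -> R) : uniq s ->
  (forall i, i \in s -> [/\ frontier (center_basin F a) (x i), al i <= 0 <= be i,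
     dom F (x i) (al i) & dom F (x i) (be i)]) ->
  (forall i j, i \in s -> j \in s -> i != j -> forall u, dom F (x i) u -> fl F (x i) u <> x j) ->
  \sum_(i <- s) (be i - al i) <= T.
Proof.
move=> us Hx Hxx; have [->|s_n0] := eqVneq s [::]; first by rewrite big_nil ltW.
have [eta eta0 Heta] : exists2 eta : R, 0 < eta & forall i, i \in s -> forall j, j \in s ->
    i != j -> forall u v, al i <= u <= be i -> al j <= v <= be j ->
    eta <= cabs (fl F (x i) u - fl F (x j) v).
  apply: seq_unif => [i k k' H /andP[_ kk] j js ij u v hu hv|i is_].
    exact: le_trans kk (H j js ij u v hu hv).
  apply: (@seq_unif _ _ (fun j k => i != j -> forall u v, al i <= u <= be i ->
      al j <= v <= be j -> k <= cabs (fl F (x i) u - fl F (x j) v))) => [j k k' H /andP[_ kk] ij u v hu hv|j js].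
    exact: le_trans kk (H ij u v hu hv).
  have [->|ij] := eqVneq i j; first by exists 1.
  have [fi hi di di'] := Hx i is_; have [fj hj dj dj'] := Hx j js.
  have [d d0 Hd] := frontier_separated di di' dj dj' hi hj (Hxx i j is_ js ij).
  by exists d.
have eta2 : 0 < eta / 2 by lra.
(* For each separatrix, an annulus orbit with a point so close to [x i] that it shadows the whole
   given piece. *)
have /choice[S HS] : forall i, exists si, i \in s -> J si /\ exists t (d : R),
    [/\ 0 < d, forall y, cabs (y - x i) < d -> forall u, al i <= u <= be i ->
          cabs (fl F y u - fl F (x i) u) < eta / 2 & cabs (fl F (q si) t - x i) < d].
  move=> i.
  have [is_|nis] := boolP (i \in s); last by exists 0.
  have [fi hi di di'] := Hx i is_; have x0' := frontier_regular fi.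
  have [d d0 Hd] := fl_cont hF x0' hi di di' eta2.
  have /frontierE[_ _ /(_ d d0)[y [si [t [Jsi ->]]] yd]] := fi.
  exists si => _; split => //; exists t, d; split => // z zd u hu.
  by have [_] := Hd z zd u hu.
(* The least parameter gives the outermost of these orbits. The segments from the chosen points to
   the [x i] cross it, at points even closer to the [x i], so this one orbit serves all of them. *)
have [m ms Hm] := seq_argmin S s_n0.
have [Jm _] := HS m ms; pose p := q (S m); have pp : per F T p := J_per Jm.
have dall u := per_dom u hF T0 pp.
have /choice[th Hth] : forall i, exists thi, i \in s -> forall u, al i <= u <= be i ->
    cabs (fl F p (thi + u) - fl F (x i) u) < eta / 2.
  move=> i.
  have [is_|nis] := boolP (i \in s); last by exists 0.
  have [Ji [t [d [d0 Hd yd]]]] := HS i is_; have [/frontierE[xa nA _] _ _ _] := Hx i is_.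
  have [|v [w [E /andP[w0 w1]]]] := @orbit_crossing (S m) (S i) t (x i) Jm (Hm i is_).
    by move=> /(inner_annulus Jm)[/eqP|//]; rewrite (negPf xa).
  exists v => _ u hu; rewrite -(fl_shift hF (dall v) (dall _)); apply: Hd => //.
  rewrite /p E; set y := fl F _ t in yd *.
  have -> : on_seg y (x i) w - x i = (1 - w)%:C%C * (y - x i).
    by rewrite /on_seg rmorphB rmorph1; ring.
  rewrite cabsM cabs_real ger0_norm ?subr_ge0 //; apply: le_lt_trans yd.
  by rewrite ler_piMl ?cabs_ge0 //; lra.
(* Two passages that overlap modulo [T] would bring two separatrices within less than [eta] of each
   other. *)
apply: (@packing_mod _ _ s (fun i => th i + al i)) => //.
  move=> i is_; have [fi /andP[h1 h2] d1 d2] := Hx i is_.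
  by rewrite subr_ge0 (le_trans h1 h2) (frontier_short fi d1 d2).
move=> i j k t is_ js ij /andP[h1 h2] /andP[h3 h4].
have hu : al i <= t - th i <= be i by apply/andP; split; lra.
have hv : al j <= t + k%:~R * T - th j <= be j by apply/andP; split; lra.
have := Hth i is_ _ hu; have := Hth j js _ hv; rewrite !subrKC per_int // => e1 e2'.
have := Heta i is_ j js ij _ _ hu hv.
have := cabs_tri (fl F p t) (fl F (x i) (t - th i)) (fl F (x j) (t + k%:~R * T - th j)).
rewrite (cabsC _ (fl F p t)); lra.
Qed.

End Basin.

(** * Separatrices *)

Section Separatrices.
Variable R : realType.
Local Notation C := (R[i]).
Implicit Types (x y z : C) (t s e : R).

(** [fr_sum] needs ends that belong to the domain and have 0 between them, so the open interval is
    approximated from inside, losing at most e / 2 at each end. *)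
Lemma interval_measure (J : set R) (T e : R) : is_interval J -> J 0 ->
  (forall s t, J s -> J t -> t - s < T) -> 0 < e ->
  exists al be, [/\ al <= 0 <= be, J al, J be &
    (lebesgue_measure J <= (be - al + e)%:E)%E].
Proof.
move=> iJ J0 JT e0; have T0 : 0 < T by have := JT 0 0 J0 J0; rewrite subrr.
have sJ : has_sup J.
  by split; [exists 0|exists T => t Jt; have := JT 0 t J0 Jt; lra].
have lJ : has_inf J.
  by split; [exists 0|exists (- T) => t Jt; have := JT t 0 Jt J0; lra].
have e2 : 0 < e / 2 by lra.
have [b0 Jb0 Hb] := sup_adherent e2 sJ; have [a0 Ja0 Ha] := inf_adherent e2 lJ.
exists (Num.min a0 0), (Num.max b0 0); split.
- by rewrite ge_min lexx orbT le_max lexx orbT.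
- by case: leP.
- by case: leP.
have JS : J `<=` `[inf J, sup J].
  move=> t Jt; rewrite /= in_itv /=; apply/andP; split; first exact: ge_inf lJ.2 _ Jt.
  exact: ub_le_sup sJ.2 _ Jt.
have mJ : measurable J by move/is_intervalP: iJ => ->; exact: measurable_itv.
suff H : (lebesgue_measure (`[inf J, sup J]%classic : set R) <=
    (Num.max b0 0 - Num.min a0 0 + e)%:E)%E.
  by apply: le_trans H; apply: le_measure => //; exact: mem_set.
have h1 : a0 < inf J + e / 2 := Ha.
have h2 : Num.min a0 0 <= a0 by rewrite ge_min lexx.
have h3 : b0 <= Num.max b0 0 by rewrite le_max lexx.
have h4 : inf J <= 0 by exact: ge_inf lJ.2 _ J0.
have h5 : 0 <= sup J by exact: ub_le_sup sJ.2 _ J0.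
rewrite lebesgue_measure_itv /= lte_fin; case: ifP => _.
  by rewrite -EFinB lee_fin; lra.
rewrite lee_fin; have : Num.min a0 0 <= 0 by rewrite ge_min lexx orbT.
have : 0 <= Num.max b0 0 by rewrite le_max lexx orbT.
lra.
Qed.

Variables (F : C -> C) (fr : set C) (T : R).
Hypothesis hF : hol F.
Hypothesis fr_fl : forall x t, fr x -> dom F x t -> fr (fl F x t).
Hypothesis fr_short : forall x s t, fr x -> dom F x s -> dom F x t -> t - s < T.
Hypothesis fr_sum : forall (I : eqType) (s : seq I) (x : I -> C) (al be : I -> R), uniq s ->
  (forall i, i \in s -> [/\ fr (x i), al i <= 0 <= be i, dom F (x i) (al i) & dom F (x i) (be i)]) ->
  (forall i j, i \in s -> j \in s -> i != j -> forall u, dom F (x i) u -> fl F (x i) u <> x j) ->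
  \sum_(i <- s) (be i - al i) <= T.

(* One point on each orbit, namely the one picked by [transit_time]. *)
Let reps : set C := [set x | fr x /\ x = xget 0 (solution_orbit F x)].

Lemma reps_orbit x y u : reps x -> reps y -> dom F x u -> fl F x u = y -> x = y.
Proof. by move=> [_ xE] [_ yE] du E; rewrite xE yE -E (solution_orbit_fl hF). Qed.

Lemma orbit_self x : solution_orbit F x x.
Proof. by exists 0; [exact: dom0|exact: fl0]. Qed.

Lemma fr_rep y : fr y -> exists x, [/\ reps x, solution_orbit F x = solution_orbit F y &
  x = xget 0 (solution_orbit F y)].
Proof.
move=> fy; pose x := xget (0 : C) (solution_orbit F y).
have [t dt xE] : solution_orbit F y x by apply: (xgetPex 0); exists y; exact: orbit_self.
have E : solution_orbit F x = solution_orbit F y by rewrite -xE; exact: solution_orbit_fl.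
by exists x; split => //; split; [rewrite -xE; exact: fr_fl|rewrite E].
Qed.

(** Any n representatives whose solutions last for the time 1/(m + 1) have n/(m + 1) <= T by
    [fr_sum], so each [N m] is finite; openness of the domains puts every representative in some
    [N m]. *)
Lemma reps_countable : countable reps.
Proof.
pose N (m : nat) : set C := [set x | reps x /\ dom F x (m.+1%:R^-1)].
have NN m : finite_set (N m).
  apply: contrapT => iN; have [n Hn] := archi_mul (T + 1) (ltac:(by rewrite invr_gt0) : 0 < m.+1%:R^-1 :> R).
  have [B BN nB] := infinite_set_fset n iN.
  have : \sum_(x <- finmap.enum_fset B) (m.+1%:R^-1 - 0) <= T.
    apply: (@fr_sum _ (finmap.enum_fset B) id (fun=> 0) (fun=> m.+1%:R^-1)) => //.
    - move=> x xB; have [[fx _] dx] := BN x xB; split => //; last exact: dom0.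
      by rewrite lexx /= invr_ge0 ler0n.
    - move=> x y xB yB xy u du E; have [rx _] := BN x xB; have [ry _] := BN y yB.
      by move: xy; rewrite (reps_orbit rx ry du E) eqxx.
  rewrite big_const_seq count_predT iter_addr_0 subr0 -[_ *+ size _]mulr_natl => h.
  have h2 : n%:R * m.+1%:R^-1 <= (size (finmap.enum_fset B))%:R * m.+1%:R^-1 :> R.
    by rewrite ler_pM2r ?invr_gt0 // ler_nat.
  have := lt_le_trans Hn (le_trans h2 h); have := ler_norm (T + 1); lra.
have RN : reps `<=` \bigcup_(m in setT) N m.
  move=> x rx.
  have [e e0 He] := open_ball_sub (@dom_open _ F x) (dom0 x hF).
  have [n Hn] := archi_mul 1 e0; exists n => //; split => //; apply: He.
  rewrite subr0 ger0_norm ?invr_ge0 // invf_plt ?posrE //.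
  rewrite normr1 in Hn; rewrite -ltr_pdivrMr // mul1r in Hn.
  by apply: lt_le_trans Hn _; rewrite ler_nat.
apply: sub_countable (subset_card_le RN) _.
by apply: bigcup_countable => // m _; exact: finite_set_countable.
Qed.

Lemma separatrices : exists (Q : set nat) (S : nat -> set R[i]^o),
  [/\ forall n, Q n -> double_sided_separatrix F (S n) /\ S n `<=` (fr : set R[i]^o),
      (fr : set R[i]^o) = \bigcup_(n in Q) S n &
      (\esum_(n in Q) transit_time F (S n) <= T%:E)%E].
Proof.
have /countable_injP[f finj] := reps_countable.
(* Separatrices are indexed by the codes of their representatives, so distinct indices belong to
   distinct orbits. *)
pose Q := f @` reps; pose p n := xget (0 : C) [set x | reps x /\ f x = n].
have pP n : Q n -> reps (p n) /\ f (p n) = n.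
  by move=> [x rx fx]; apply: (xgetPex 0 (P := [set x | reps x /\ f x = n])); exists x.
pose S n : set R[i]^o := solution_orbit F (p n).
have tE n : Q n -> transit_time F (S n) = lebesgue_measure (dom F (p n)).
  by move=> /pP[[_ pE] _]; rewrite /transit_time /S -pE.
have Sfr n : Q n -> S n `<=` (fr : set R[i]^o).
  by move=> /pP[[fp _] _] z [t dt <-]; exact: fr_fl.
exists Q, S; split.
- move=> n Qn; split; last exact: Sfr.
  have [[fp _] _] := pP n Qn; split; first by exists (p n).
  exists (p n); first exact: orbit_self.
  exists T; split; first exact: num_real.
  move=> M TM t dt /=; apply: le_trans (ltW TM); have d0 := dom0 (p n) hF.
  have := fr_short fp d0 dt; have := fr_short fp dt d0; rewrite ler_norml => *.
  by apply/andP; split; lra.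
- apply/seteqP; split=> [y fy|y [n Qn]]; last exact: Sfr.
  have [x [rx E _]] := fr_rep fy; exists (f x); first by exists x.
  have Qx : Q (f x) by exists x.
  have [rp fp] := pP _ Qx; have E2 : p (f x) = x by apply: finj; rewrite // mem_set.
  by rewrite /S E2 E; exact: orbit_self.
- apply: ge_ereal_sup => _ [X [finX XQ] <-]; rewrite fsbig_finite //.
  set s := finmap.enum_fset (fset_set X).
  have sQ n : n \in s -> Q n.
    by move=> ns; apply: XQ; rewrite -inE -in_fset_set.
  apply/lee_addgt0Pr => e e0.
  (* Each approximation may lose e / k, in total at most [e]; the successor avoids division by zero
     for an empty list. *)
  pose k : R := (size s).+1%:R.
  have k0 : 0 < k by rewrite ltr0n.
  have /choice[g Hg] : forall n, exists g : R * R, n \in s ->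
      [/\ g.1 <= 0 <= g.2, dom F (p n) g.1, dom F (p n) g.2 &
          (lebesgue_measure (dom F (p n)) <= (g.2 - g.1 + e / k)%:E)%E].
    move=> n.
    have [ns|nns] := boolP (n \in s); last by exists (0, 0).
    have [[fp _] _] := pP n (sQ n ns).
    have [al [be H]] := interval_measure (@dom_interval _ F (p n)) (dom0 (p n) hF)
      (fun u v => @fr_short (p n) u v fp) (divr_gt0 e0 k0).
    by exists (al, be).
  apply: (@le_trans _ _ (\sum_(n <- s) (((g n).2 - (g n).1) + e / k)%:E)%E).
    rewrite big_seq [leRHS]big_seq; apply: lee_sum => n ns.
    by rewrite (tE n (sQ n ns)); have [_ _ _ H] := Hg n ns; exact: H.
  rewrite sumEFin lee_fin big_split /=.
  have h1 : \sum_(n <- s) ((g n).2 - (g n).1) <= T.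
    apply: (@fr_sum _ s p) => //.
    - exact: finmap.fset_uniq.
    - move=> n ns; have [h1 h2 h3 _] := Hg n ns.
      by split => //; have [[fp _] _] := pP n (sQ n ns).
    - move=> n m ns ms nm u du E; have [rn fn] := pP n (sQ n ns).
      have [rm fm] := pP m (sQ m ms).
      by move: nm; rewrite -fn -fm (reps_orbit rn rm du E) eqxx.
  rewrite big_const_seq count_predT iter_addr_0 -[_ *+ size _]mulr_natl.
  have h2 : (size s)%:R * (e / k) <= e.
    rewrite mulrA ler_pdivrMr // mulrC ler_pM2l // ler_nat //.
  by rewrite lerD.
Qed.

End Separatrices.

Theorem theorem4p8 (R : realType) (F : R[i]^o -> R[i]^o) (a : R[i]^o)
    (F_entire : entire_fun F) (F_neq0 : exists z, F z != 0)
    (a_center : is_center F a) :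
  exists (Q : set nat) (C : nat -> set R[i]^o),
    [/\ forall n, Q n -> double_sided_separatrix F (C n) /\
                         C n `<=` frontier (center_basin F a),
        frontier (center_basin F a) = \bigcup_(n in Q) C n,
        complex.Im (center_period F a) = 0 &
        (\esum_(n in Q) transit_time F (C n) <=
          `|complex.Re (center_period F a)|%:E)%E].
Proof.
have hF : hol F by move=> z; exists (derive1 F z); exact: derivable_hderiv.
have [a0 [U /nbhs_cabs[rU rU0 HU] Hc]] := a_center.
pose l : R[i] := derive1 F a; have Hl : hderiv F a l by exact: derivable_hderiv.
have Hper (x : R[i]) : x != a -> normc (x - a) < rU -> exists2 T : R, 0 < T & per F T x.
  by move=> xa /HU Ux; have [/(periodic_per hF)] := Hc x Ux xa.
have Hsurr (x : R[i]) : x != a -> normc (x - a) < rU ->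
    forall b : R[i], exists t, normc (a - b) <= normc (fl F x t - b).
  move=> xa xr b; have [T T0 px] := Hper x xa xr.
  have [_ jG] := Hc x (HU x xr) xa.
  have [|z [t _ <-] H] := jordan_int_far b jG; last by exists t.
  by exists x; exact: orbit_self.
have l_re : complex.Re l = 0 := centre_Re hF Hl a0 rU0 Hper.
have l_im : complex.Im l != 0 := centre_Im hF Hl a0 rU0 Hper Hsurr.
pose T := centre_T l; have T0 : 0 < T := centre_T_gt0 hF Hl a0 rU0 Hper Hsurr.
have HT : forall x : R[i], x != a -> normc (x - a) < rU -> per F T x :=
  centre_period_T hF Hl a0 rU0 Hper Hsurr.
have [r [r0 rrU Hatt]] := centre_attract hF Hl a0 rU0 Hper Hsurr.
have [x0 [x0a x0U x0r]] := punct_ex a rU0 r0.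
pose e : R := Num.sg (complex.Im l).
have e2 : e * e = 1 by rewrite -expr2 sqr_sg l_im.
have Hp (x : R[i]) : x != a -> normc (x - a) < r -> per F T x.
  by move=> xa xr; apply: HT => //; exact: lt_le_trans xr rrU.
have periodE : center_period F a = (2 * pi / complex.Im l)%:C%C.
  have lE : l = 'i%C * (complex.Im l)%:C%C.
    by rewrite {1}(complexE l) l_re rmorph0 add0r.
  transitivity (2 * (pi : R)%:C%C * 'i%C / l : R[i]); first by [].
  move: l_im lE; generalize (complex.Im l) => w w0 ->.
  have i0 : 'i%C != 0 :> R[i] by rewrite eq_complex /= oner_eq0 andbF.
  have w0' : w%:C%C != 0 :> R[i] by rewrite eq_complex /= (negPf w0).
  rewrite !rmorphM fmorphV rmorph_nat /=; field.
  by rewrite i0 w0'.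
have [Q [S [h1 h2 h3]]] := separatrices hF
  (frontier_fl hF a0 T0 e2 Hp Hatt x0a x0r) (frontier_short hF a0 T0 e2 Hp Hatt x0a x0r)
  (frontier_sum hF a0 T0 e2 Hp Hatt x0a x0r).
exists Q, S; split => //; rewrite periodE //=.
by rewrite normrM normfV ger0_norm // mulr_ge0 // pi_ge0.
Qed.
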